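(* Let $m=n=1$ and let $g\in V_f$. If $g$ has no degenerate folds, i.e. if $\mathcal{D}[g]=\emptyset$, then the critical set $\mathcal{C}[g]$ is persistent to smooth perturbations (that is, $g$ is persistent under global equivalence on $M\times N$).
   Context: Setting. Consider fast-slow systems $\epsilon\dot x=g(x,y)$, $\dot y=h(x,y)$ in the singular limit $\epsilon\to 0$, with one fast variable $x$ and one slow variable $y$; only systems with bounded global attractors are considered. Fix compact regions (intervals) $M\subset\mathbb{R}$ (for $x$) and $N\subset\mathbb{R}$ (for $y$) with nonempty interior, and let $m(x)$ denote the outward normal of $M$ at $x\in\partial M$. All sets below are considered inside $M\times N$. $V_f$ is the set of $g\in C^\infty(\mathbb{R}^2,\mathbb{R})$ such that $g(x,y)\,m(x)<0$ for all $(x,y)\in\partial M\times N$, and such that for all $(x,y)\in M\times\partial N$, $g(x,y)=0$ implies $g_x(x,y)\neq0$. Critical set: $\mathcal{C}[g]=\{(x,y): g(x,y)=0\}$. Fold set: $\mathcal{F}[g]=\{p\in\mathcal{C}[g]: g_x(p)=0\}$. Let $\pi(x,y)=y$ and, for $p=(x,y)$, let $\Pi(p)=\{q\in\mathcal{F}[g]:\pi(q)=\pi(p)\}$. Degenerate folds: $\mathcal{D}[g]=\mathcal{D}_1[g]\cup\mathcal{D}_2[g]\cup\mathcal{D}_3[g]$, where - $\mathcal{D}_1[g]=\{p\in\mathcal{F}[g]: g_y(p)=0\}$ (fold tangency), - $\mathcal{D}_2[g]=\{p\in\mathcal{F}[g]: g_{xx}(p)=0\}$ (hysteresis point), - $\mathcal{D}_3[g]=\{p\in\mathcal{F}[g]: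 |\Pi(p)|\ge2\}$ (multiple limit point). Global equivalence: $g\sim\tilde g$ on $M\times N$ if there are functions $X:M\times N\to\mathbb{R}$, $Y:N\to\mathbb{R}$ and a smooth function $S:M\times N\to(0,\infty)$ with $\tilde g(x,y)=S(x,y)\,g(X(x,y),Y(y))$ on $M\times N$, such that $\Phi(x,y)=(X(x,y),Y(y))$ is a diffeomorphism of $M\times N$. Persistence: $g$ (equivalently, its critical set) is persistent if for every $r$ and every unfolding $G\in C^\infty(M\times N\times\mathbb{R}^r)$ of $g$, i.e. $G(x,y,0)=g(x,y)$ on $M\times N$, there is a neighbourhood $W$ of $0$ in $\mathbb{R}^r$ such that $G(\cdot,\cdot,\lambda)\sim g$ on $M\times N$ for all $\lambda\in W$. *)

(* Defs.v *)
From HB Require Import structures.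
From mathcomp Require Import all_boot all_order all_algebra.
From mathcomp Require Import all_classical all_reals all_analysis.

Set Implicit Arguments.
Unset Strict Implicit.
Unset Printing Implicit Defensive.
Import Order.TTheory GRing.Theory Num.Theory.
Import numFieldNormedType.Exports.
Local Open Scope classical_set_scope.
Local Open Scope ring_scope.

(* Meant for [U] open, so that the two-sided continuity, differentiability and
   derivatives at a point of [U] only see the values of [f] on [U], and for
   finite-dimensional [V] and [W]. *)
Fixpoint Ck_on (R : realType) (V W : normedModType R) (U : set V) (k : nat)
    (f : V -> W) : Prop :=
  match k with
  | 0%N => forall x, U x -> {for x, continuous f}
  | k'.+1 => (forall x, U x -> differentiable f x) /\
             forall v : V, Ck_on U k' ('D_v f : V -> W)
  end.

(* C^oo on an arbitrary subset [A], in the usual sense of having a C^oo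
   extension to an open neighbourhood of [A]; for [A = setT] this is plain
   C^oo.  Only the values of [f] on [A] matter. *)
Definition smooth_on (R : realType) (V W : normedModType R) (A : set V)
    (f : V -> W) : Prop :=
  exists U : set V, exists F : V -> W,
    [/\ open U, A `<=` U, forall k, Ck_on U k F & {in A, f =1 F}].

Definition diffeo_on (R : realType) (V : normedModType R) (A : set V)
    (Phi : V -> V) : Prop :=
  [/\ smooth_on A Phi, set_bij A A Phi &
      exists Psi : V -> V, smooth_on A Psi /\ {in A, cancel Phi Psi}].

Definition boundary (T : topologicalType) (A : set T) : set T :=
  closure A `\` interior A.

(* In dimension one every vector is normal to the (zero-dimensional) boundary,
   so the outward unit normal is the unit vector pointing out of [M]. *)
Definition outward_normal (R : realType) (M : set R) (x v : R) : Prop :=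
  `|v| = 1 /\
  \forall t \near 0^'+, ~ M (x + t * v) /\ M (x - t * v).

Section Planar.
Variable R : realType.
Implicit Types (M N : set R) (m : R -> R) (g : R * R -> R) (p q : R * R).

Definition partial_x g : R * R -> R := 'D_((1, 0) : R * R) g.
Definition partial_y g : R * R -> R := 'D_((0, 1) : R * R) g.

Definition Vf M N m : set (R * R -> R) :=
  [set g : R * R -> R | [/\ smooth_on [set: R * R] g,
    forall x y, (boundary M `*` N) (x, y) -> g (x, y) * m x < 0 &
    forall x y, (M `*` boundary N) (x, y) ->
      g (x, y) = 0 -> partial_x g (x, y) != 0]].

Definition critical_set M N g : set (R * R) :=
  [set p | (M `*` N) p /\ g p = 0].

Definition fold_set M N g : set (R * R) :=
  [set p | critical_set M N g p /\ partial_x g p = 0].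

Definition fold_level M N g p : set (R * R) :=
  [set q | fold_set M N g q /\ q.2 = p.2].

Definition fold_tangency M N g : set (R * R) :=
  [set p | fold_set M N g p /\ partial_y g p = 0].

Definition hysteresis M N g : set (R * R) :=
  [set p | fold_set M N g p /\ partial_x (partial_x g) p = 0].

Definition multiple_limit M N g : set (R * R) :=
  [set p | fold_set M N g p /\ (`I_2 #<= fold_level M N g p)%card].

Definition degenerate_folds M N g : set (R * R) :=
  fold_tangency M N g `|` hysteresis M N g `|` multiple_limit M N g.

Definition global_equiv M N (g g' : R * R -> R) : Prop :=
  exists (X : R * R -> R) (Y : R -> R) (S : R * R -> R),
    [/\ smooth_on (M `*` N) S,
        forall p, (M `*` N) p -> 0 < S p,
        forall x y, (M `*` N) (x, y) ->
          g' (x, y) = S (x, y) * g (X (x, y), Y y) &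
        diffeo_on (M `*` N) (fun p => (X p, Y p.2))].

Definition persistent M N g : Prop :=
  forall (r : nat) (G : R * R * 'rV[R]_r -> R),
    smooth_on ((M `*` N) `*` [set: 'rV[R]_r]) G ->
    (forall p, (M `*` N) p -> G (p, 0) = g p) ->
    \forall lambda \near (0 : 'rV[R]_r),
      global_equiv M N (fun p => G (p, lambda)) g.

End Planar.

(* Main.v *)
(* All maps are built smoothly in [(x, y, l)] jointly, where [l] is the unfolding
   parameter and [F] a smooth extension of the unfolding, and reduce to the
   identity at [l = 0]; compactness of [M `*` N] then yields what is needed for
   all small [l].  Near a fold, [F (., y, l)] has one critical point, with
   critical value [c (y, l)], and [c] has nonzero derivative in [y]; the implicit
   function theorem gives [Y] with [c (Y (y, l), l) = c (y, 0)].  Fold levels are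
   distinct and interior to [N], so cut-offs glue these maps to the identity.
   Once critical values match, [F (X, Y, l) = F (x, y, 0)] has, near every zero
   of [F (., 0)], exactly one solution [X] close to [x] on the same branch; it is smooth
   through the folds because both sides have the form [c + s ^+ 2 * H] there, by
   Hadamard's lemma.  A cut-off in [F (x, y, 0)] blends [X] into [x] away from the
   critical set, where the factor [S = F (x, y, 0) / F (X, Y, l)] is a quotient of
   nonvanishing functions, while [S = 1] close to the critical set. *)

From HB Require Import structures.
Require Import Defs.
From mathcomp Require Import all_boot all_order all_algebra.
From mathcomp Require Import all_classical all_reals all_analysis.
From mathcomp Require Import lra ring.

Set Implicit Arguments.
Unset Strict Implicit.
Unset Printing Implicit Defensive.
Import Order.TTheory GRing.Theory Num.Theory.
Import numFieldNormedType.Exports.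
Local Open Scope classical_set_scope.
Local Open Scope ring_scope.

(** * Calculus of C^k maps *)

(** Each nondegeneracy condition pays for one step. No fold tangency: [F_y], and with it the
    [y]-derivative of the critical value, is nonzero. No hysteresis point: [F_xx] is nonzero, so the
    critical point of a slice persists and is locally unique. No multiple limit point: [Y] sees only
    [y], so it can match one critical value per level. [Vf] takes care of the frame: without zeros
    on the sides [x = a] and [x = b], [X] can be the identity near them; without folds on [y = c]
    and [y = d], so can [Y]; hence the rectangle is mapped onto itself. The obstacle at a fold is
    that the equation for [X] has two nearby solutions and a vanishing derivative in [X]. The sign
    of [F_x] tells the two apart, and measuring [X] by its ratio to the distance from the critical
    point turns the equation into a nondegenerate one. The unfolding is known only over the closed
    rectangle, so a derivative of [g] agrees with that of [F (., 0)] only where the rectangle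
    contains a segment on both sides of the point. *)

Section Differentiability.
Context {R : realType}.
Implicit Types (V W : normedModType R).

Lemma differentiable_le_eps V W (f : V -> W) x : differentiable f x ->
  forall e, 0 < e ->
  \forall y \near x, `|f y - f x - 'd f x (y - x)| <= e * `|y - x|.
Proof.
move=> df e e0.
have /eqaddoP/(_ e e0) := diff_locally df.
rewrite [in X in _ -> X](near_shift 0 x).
by apply: filterS => y /=; rewrite !fctE /= subr0 opprD addrA addrK.
Qed.

(** Used to prove differentiability by guessing the differential. The guesses are plain lambda
    terms, so linearity is a hypothesis on a bare function. *)
Lemma differentiable_eps V W (f L : V -> W) x : linear L -> continuous L ->
  (forall e, 0 < e ->
    \forall y \near x, `|f y - f x - L (y - x)| <= e * `|y - x|) ->
  differentiable f x /\ 'd f x = L :> (V -> W).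
Proof.
move=> linL cL fL.
pose L' : {linear V -> W} := HB.pack L (GRing.isLinear.Build R V W *:%R L linL).
have E : f \o shift x = cst (f x) + L' +o_ 0 id.
  apply/eqaddoP => e e0; move: (fL e e0).
  rewrite (near_shift 0 x); apply: filterS => y.
  by rewrite /= !fctE /= subr0 opprD addrA addrK.
have dE := diff_unique (df := L') cL E.
split => //; apply/diff_locallyP; rewrite dE; split => //; exact: cL.
Qed.

Lemma near_eq_differentiable V W (f h : V -> W) x :
  (\near x, f x = h x) -> differentiable f x -> differentiable h x.
Proof.
move=> fh df.
have fhx : f x = h x by exact: nbhs_singleton fh.
have cd : continuous ('d f x) by apply: diff_continuous.
apply: (differentiable_eps (L := 'd f x) _ _ _).1 => //; first exact: linearP.
move=> e e0; have := differentiable_le_eps df e0.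
by apply: filterS2 fh => y <-; rewrite fhx.
Qed.

Lemma linear_is_diff V W (A : V -> W) x : linear A -> continuous A ->
  differentiable A x /\ 'd A x = A :> (V -> W).
Proof.
move=> lA cA; apply: differentiable_eps => // e e0; near=> y.
pose A' : {linear V -> W} := HB.pack A (GRing.isLinear.Build R V W *:%R A lA).
by rewrite -[A]/(A' : V -> W) linearB subrr normr0 mulr_ge0// ltW.
Unshelve. all: by end_near. Qed.

Lemma linear_derive V W (A : V -> W) x v : linear A -> continuous A ->
  'D_v A x = A v.
Proof. by move=> lA cA; have [d dE] := linear_is_diff x lA cA; rewrite deriveE// dE. Qed.

End Differentiability.

Section CkOn.
Context {R : realType}.
Implicit Types (V W : normedModType R).

Lemma Ck_onS V W (U U' : set V) k (f : V -> W) : U' `<=` U ->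
  Ck_on U k f -> Ck_on U' k f.
Proof.
move=> sU; elim: k f => [|k IH] f /=; first by move=> h x /sU /h.
by move=> [h1 h2]; split => [x /sU /h1//|v]; exact/IH/h2.
Qed.

(** The derivatives in [Ck_on] are two-sided and do not depend on the set, so nothing has to be
    glued. *)
Lemma Ck_on_local V W (U : set V) k (f : V -> W) :
  (forall x, U x -> exists U', [/\ open U', U' x & Ck_on U' k f]) -> Ck_on U k f.
Proof.
elim: k f => [|k IH] f /= h.
  by move=> x /h[U' [_ U'x]]; apply.
split => [x /h[U' [_ U'x [+ _]]]|v]; first exact.
by apply: IH => x /h[U' [oU' U'x [_ /(_ v)]]]; exists U'.
Qed.

Lemma Ck_on_eq V W (U : set V) k (f h : V -> W) : open U ->
  (forall x, U x -> f x = h x) -> Ck_on U k f -> Ck_on U k h.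
Proof.
move=> oU; have nU x : U x -> \near x, U x by move=> Ux; exact: open_nbhs_nbhs.
elim: k f h => [|k IH] f h fh /=.
  move=> cf x Ux; have : f y @[y --> x] --> h x by rewrite -fh//; exact: cf.
  apply: cvg_trans; apply: near_eq_cvg.
  by apply: filterS (nU _ Ux) => y /fh.
move=> [df Df]; split => [x Ux|v].
  apply: near_eq_differentiable (df _ Ux).
  by apply: filterS (nU _ Ux) => y /fh.
apply: IH (Df v) => x Ux; apply: near_eq_derive.
by apply: filterS (nU _ Ux) => y /fh.
Qed.

Lemma Ck_onW V W (U : set V) k (f : V -> W) : Ck_on U k.+1 f -> Ck_on U k f.
Proof.
elim: k f => [|k IH] f /=.
  by move=> [df _] x /df; exact: differentiable_continuous.
by move=> [df Df]; split => // v; apply: IH; split; have [] := Df v.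
Qed.

Lemma Ck_on_cst V W (U : set V) k (c : W) : Ck_on U k (cst c : V -> W).
Proof.
elim: k c => [|k IH] c /=; first by move=> x _; exact: cst_continuous.
split => [x _|v]; first exact: differentiable_cst.
rewrite [X in Ck_on _ _ X](_ : _ = cst 0) //.
by apply/funext => x; rewrite derive_cst.
Qed.

Lemma Ck_on_linear V W (U : set V) k (A : V -> W) : linear A -> continuous A ->
  Ck_on U k A.
Proof.
move=> lA cA; case: k => [|k] /=; first by move=> x _; exact: cA.
split => [x _|v]; first exact: (linear_is_diff x lA cA).1.
rewrite [X in Ck_on _ _ X](_ : _ = cst (A v)); first exact: Ck_on_cst.
by apply/funext => x; rewrite linear_derive.
Qed.

Lemma Ck_onD V W (U : set V) k (f h : V -> W) : open U ->
  Ck_on U k f -> Ck_on U k h -> Ck_on U k (fun x => f x + h x).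
Proof.
move=> oU; elim: k f h => [|k IH] f h /=.
  by move=> cf ch x Ux; apply: continuousD; [exact: cf|exact: ch].
move=> [df Df] [dh Dh]; split => [x Ux|v].
  by apply: differentiableD; [exact: df|exact: dh].
apply: Ck_on_eq (IH _ _ (Df v) (Dh v)) => // x Ux.
by rewrite [RHS]deriveD//; apply: diff_derivable; [exact: df|exact: dh].
Qed.

Lemma Ck_onM V (U : set V) k (f h : V -> R) : open U ->
  Ck_on U k f -> Ck_on U k h -> Ck_on U k (fun x => f x * h x).
Proof.
move=> oU; elim: k f h => [|k IH] f h.
  by move=> cf ch x Ux; apply: continuousM; [exact: cf|exact: ch].
move=> Cf Ch; move: (Cf) (Ch) => /= [df Df] [dh Dh]; split => [x Ux|v].
  by apply: differentiableM; [exact: df|exact: dh].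
apply: (@Ck_on_eq _ _ _ _ (fun x => f x * 'D_v h x + h x * 'D_v f x)) => //.
  by move=> x Ux; rewrite [RHS]deriveM//; apply: diff_derivable; [exact: df|exact: dh].
by apply: Ck_onD => //; apply: IH => //; exact: Ck_onW.
Qed.

Lemma Ck_onV V (U : set V) k (f : V -> R) : open U -> (forall x, U x -> f x != 0) ->
  Ck_on U k f -> Ck_on U k (fun x => (f x)^-1).
Proof.
move=> oU f0; elim: k f f0 => [|k IH] f f0.
  by move=> cf x Ux; apply: continuousV; [exact: f0|exact: cf].
move=> Cf; move: (Cf) => /= [df Df]; split => [x Ux|v].
  by apply: differentiableV; [exact: df|exact: f0].
have Cfi := IH _ f0 (Ck_onW Cf).
apply: (@Ck_on_eq _ _ _ _ (fun x => (cst (-1) x * 'D_v f x) * ((f x)^-1 * (f x)^-1))) => //.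
  move=> x Ux; rewrite [RHS]deriveV//; [|exact: f0|exact/diff_derivable/df].
  by rewrite /cst mulN1r -exprVn expr2 /GRing.scale /= mulrC mulrN mulNr.
by repeat apply: Ck_onM => //; exact: Ck_on_cst.
Qed.

(* The linear part [A] keeps the parameter space abstract: only finitely many
   coordinates of the inner map vary nonlinearly. *)
Lemma derive_comp V W (f : V -> R) (A : W -> V) (a b : W -> R) (u v : V) w :
  linear A -> continuous A -> differentiable a w -> differentiable b w ->
  differentiable f (A w + a w *: u + b w *: v) ->
  differentiable (fun w => f (A w + a w *: u + b w *: v)) w /\
  forall x, 'D_x (fun w => f (A w + a w *: u + b w *: v)) w =
    'D_(A x) f (A w + a w *: u + b w *: v)
    + 'D_x a w * 'D_u f (A w + a w *: u + b w *: v)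
    + 'D_x b w * 'D_v f (A w + a w *: u + b w *: v).
Proof.
move=> lA cA da db; pose h w := A w + a w *: u + b w *: v.
rewrite -/(h w) => dfw.
have dA : differentiable A w by exact: (linear_is_diff w lA cA).1.
have dau : differentiable (fun w => a w *: u) w by exact/differentiableZl/da.
have dbv : differentiable (fun w => b w *: v) w by exact/differentiableZl/db.
have dh : differentiable h w.
  by apply: differentiableD => //; apply: differentiableD.
have dfh : differentiable (f \o h) w by exact: differentiable_comp.
split => // x; rewrite [LHS](@deriveE _ _ _ (f \o h))// diff_comp//.
rewrite /= -[X in 'd f _ X]deriveE//.
have -> : 'D_x h w = A x + 'D_x a w *: u + 'D_x b w *: v.
  rewrite [LHS](@deriveD _ _ _ (fun w => A w + a w *: u)); last 2 first.
  - by apply: diff_derivable; apply: differentiableD.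
  - exact: diff_derivable.
  rewrite (@deriveD _ _ _ A); [|exact: diff_derivable|exact: diff_derivable].
  rewrite linear_derive// (deriveE x dau) (deriveE x dbv).
  by rewrite (diffZl _ da) (diffZl _ db) !deriveE.
by rewrite !linearD !linearZ !(deriveE _ dfw).
Qed.

(** By the chain rule, a derivative of the composite involves only composites of derivatives of [f]
    with the same inner map; the induction therefore varies [f] and keeps [A], [a] and [b] fixed. *)
Lemma Ck_on_comp V W (U : set W) (U' : set V) k (f : V -> R) (A : W -> V)
    (a b : W -> R) (u v : V) :
  open U -> open U' -> linear A -> continuous A ->
  (forall w, U w -> U' (A w + a w *: u + b w *: v)) ->
  Ck_on U' k f -> Ck_on U k a -> Ck_on U k b ->
  Ck_on U k (fun w => f (A w + a w *: u + b w *: v)).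
Proof.
move=> oU oU' lA cA UU'.
elim: k f => [|k IH] f.
  move=> cf ca cb w Uw.
  apply: (@continuous_comp _ _ _ (fun w => A w + a w *: u + b w *: v) f); last exact/cf/UU'.
  apply: continuousD; last by apply: continuousZl; exact: cb.
  by apply: continuousD; [exact: cA|apply: continuousZl; exact: ca].
move=> Cf Ca Cb; move: (Cf) (Ca) (Cb) => /= [df Df] [da Da] [db Db].
have dcomp w (Uw : U w) := derive_comp lA cA (da w Uw) (db w Uw) (df _ (UU' w Uw)).
split => [w /dcomp[]//|x].
pose h w := A w + a w *: u + b w *: v.
apply: (@Ck_on_eq _ _ _ _ (fun w => 'D_(A x) f (h w) +
  'D_x a w * 'D_u f (h w) + 'D_x b w * 'D_v f (h w))) => //.
  by move=> w /dcomp[_ ->].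
have Ca' := Ck_onW Ca; have Cb' := Ck_onW Cb.
have CD y : Ck_on U k ('D_y f \o h) by exact: (IH ('D_y f)).
by apply: Ck_onD => //; [apply: Ck_onD => //; [exact: CD|]|]; apply: Ck_onM => //; exact: CD.
Qed.

Lemma Ck_on_pair V W1 W2 (U : set V) k (f : V -> W1) (h : V -> W2) : open U ->
  Ck_on U k f -> Ck_on U k h -> Ck_on U k (fun x => (f x, h x)).
Proof.
move=> oU; elim: k f h => [|k IH] f h /=.
  by move=> cf ch x Ux; apply: cvg_pair; [exact: cf|exact: ch].
move=> [df Df] [dh Dh]; split => [x Ux|v].
  by apply: differentiable_pair; [exact: df|exact: dh].
apply: Ck_on_eq (IH _ _ (Df v) (Dh v)) => // x Ux.
rewrite [RHS]deriveE; last by apply: differentiable_pair; [exact: df|exact: dh].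
by rewrite diff_pair ?deriveE//; [exact: dh|exact: df|exact: df|exact: dh].
Qed.

End CkOn.

(** * Smoothness at a point *)

Section SmoothAt.
Context {R : realType}.
Implicit Types (V W : normedModType R).

(** One neighbourhood serves all orders, so that smoothness at a point is an open condition. *)
Definition smooth_at V W (f : V -> W) (x : V) : Prop :=
  exists U : set V, [/\ open U, U x & forall k, Ck_on U k f].

Lemma near_and V (P P' : V -> Prop) (x : V) :
  (\near x, P x) -> (\near x, P' x) -> \near x, P x /\ P' x.
Proof. exact: filterI. Qed.

Lemma near_comp V W (f : V -> W) (x : V) (P : W -> Prop) :
  {for x, continuous f} -> (\forall y \near f x, P y) -> \forall y \near x, P (f y).
Proof. by move=> cf nP; exact: (cf _ nP). Qed.

Lemma smooth_at_near V W (f : V -> W) x :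
  smooth_at f x -> \near x, smooth_at f x.
Proof.
move=> [U [oU Ux Uf]]; have : \near x, U x by exact: open_nbhs_nbhs.
by apply: filterS => y Uy; exists U.
Qed.

Lemma smooth_at_differentiable V W (f : V -> W) x :
  smooth_at f x -> differentiable f x.
Proof. by move=> [U [_ Ux /(_ 1%N) [+ _]]]; exact. Qed.

Lemma smooth_at_continuous V W (f : V -> W) x :
  smooth_at f x -> {for x, continuous f}.
Proof. by move=> /smooth_at_differentiable; exact: differentiable_continuous. Qed.

Lemma smooth_at_near_open V W (f : V -> W) x (P : set W) : smooth_at f x ->
  open P -> P (f x) -> \near x, P (f x).
Proof.
move=> /smooth_at_continuous cf oP Pfx.
have nP : nbhs (f x) P by exact: open_nbhs_nbhs.
exact: (cf _ nP).
Qed.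

Lemma smooth_at_derivable V W (f : V -> W) x v :
  smooth_at f x -> derivable f x v.
Proof. by move=> /smooth_at_differentiable; exact: diff_derivable. Qed.

Lemma smooth_at_derive V W (f : V -> W) x v :
  smooth_at f x -> smooth_at ('D_v f) x.
Proof.
move=> [U [oU Ux Uf]]; exists U; split => // k; have [_ +] := Uf k.+1; exact.
Qed.

Lemma smooth_at_eq V W (f h : V -> W) x : (\near x, f x = h x) ->
  smooth_at f x -> smooth_at h x.
Proof.
move=> fh [U [oU Ux Uf]]; have : \near x, U x /\ f x = h x.
  by apply: filterI => //; exact: open_nbhs_nbhs.
rewrite -nbhs_nearE nbhsE/= => -[B [oB Bx] BU]; exists B; split => // k.
apply: (@Ck_on_eq _ _ _ _ _ f) => // [y /BU[]//|].
by apply: Ck_onS (Uf k) => y /BU[].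
Qed.

Lemma smooth_at_ext V W (f h : V -> W) x : f =1 h ->
  smooth_at f x -> smooth_at h x.
Proof. by move=> /funext ->. Qed.

(** The set of all points where [F] is smooth is open and can serve as the neighbourhood of [A]. *)
Lemma smooth_on_smooth_at V W (A : set V) (f F : V -> W) :
  (forall x, A x -> smooth_at F x) -> (forall x, A x -> f x = F x) ->
  smooth_on A f.
Proof.
move=> AF fF; exists [set x | smooth_at F x], F; split => //.
- rewrite openE => x /smooth_at_near; exact.
- move=> k; apply: Ck_on_local => x [U [oU Ux Uf]]; by exists U.
- by move=> x /set_mem /fF.
Qed.

Lemma smooth_on_ext V W (A : set V) (f : V -> W) : smooth_on A f ->
  exists F : V -> W,
    (forall x, A x -> smooth_at F x) /\ (forall x, A x -> f x = F x).
Proof.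
move=> [U [F [oU AU UF fF]]]; exists F; split => [x /AU Ux|x Ax].
  by exists U.
by apply: fF; rewrite inE.
Qed.

Lemma smooth_at_cst V W (c : W) x : smooth_at (fun _ : V => c) x.
Proof. exists setT; split => // [|k]; [exact: openT|exact: Ck_on_cst]. Qed.

Lemma smooth_atD V W (f h : V -> W) x : smooth_at f x -> smooth_at h x ->
  smooth_at (fun x => f x + h x) x.
Proof.
move=> [U [oU Ux Uf]] [U' [oU' U'x Uh]].
have oI := openI oU oU'; exists (U `&` U'); split => // k.
by apply: Ck_onD => //; [apply: Ck_onS (Uf k)|apply: Ck_onS (Uh k)] => y [].
Qed.

Lemma smooth_atM V (f h : V -> R) x : smooth_at f x -> smooth_at h x ->
  smooth_at (fun x => f x * h x) x.
Proof.
move=> [U [oU Ux Uf]] [U' [oU' U'x Uh]].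
have oI := openI oU oU'; exists (U `&` U'); split => // k.
by apply: Ck_onM => //; [apply: Ck_onS (Uf k)|apply: Ck_onS (Uh k)] => y [].
Qed.

Lemma smooth_atN V (f : V -> R) x : smooth_at f x -> smooth_at (fun x => - f x) x.
Proof.
move=> sf; apply: smooth_at_eq (smooth_atM (smooth_at_cst (-1 : R) x) sf).
by apply: nearW => y; rewrite mulN1r.
Qed.

Lemma smooth_atB V (f h : V -> R) x : smooth_at f x -> smooth_at h x ->
  smooth_at (fun x => f x - h x) x.
Proof. by move=> sf /smooth_atN; exact: smooth_atD. Qed.

Lemma smooth_atV V (f : V -> R) x : f x != 0 -> smooth_at f x ->
  smooth_at (fun x => (f x)^-1) x.
Proof.
move=> fx0 sf; have cf := smooth_at_continuous sf; move: sf => [U [oU Ux Uf]].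
have : \near x, U x /\ f x != 0.
  apply: filterI; first exact: open_nbhs_nbhs.
  have nz : nbhs (f x) [set y : R | y != 0] by apply: open_nbhs_nbhs; split => //; exact: open_neq.
  exact: (cf _ nz).
rewrite -nbhs_nearE nbhsE/= => -[B [oB Bx] BU]; exists B; split => // k.
apply: Ck_onV => // [y /BU[]//|].
by apply: Ck_onS (Uf k) => y /BU[].
Qed.

Lemma smooth_at_pair V W1 W2 (f : V -> W1) (h : V -> W2) x :
  smooth_at f x -> smooth_at h x -> smooth_at (fun x => (f x, h x)) x.
Proof.
move=> [U [oU Ux Uf]] [U' [oU' U'x Uh]].
have oI := openI oU oU'; exists (U `&` U'); split => // k.
by apply: Ck_on_pair => //; [apply: Ck_onS (Uf k)|apply: Ck_onS (Uh k)] => y [].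
Qed.

Lemma continuous_pair V W1 W2 (f : V -> W1) (h : V -> W2) x :
  {for x, continuous f} -> {for x, continuous h} ->
  {for x, continuous (fun x => (f x, h x))}.
Proof. by move=> cf ch; apply: cvg_pair; [exact: cf|exact: ch]. Qed.

Definition clinear V W (A : V -> W) : Prop := linear A /\ continuous A.

Lemma clinear_continuous V W (A : V -> W) x : clinear A -> {for x, continuous A}.
Proof. by move=> [_]; exact. Qed.

Lemma clinear_id V : clinear (@id V).
Proof. by split => // x; exact: cvg_id. Qed.

Lemma clinear_cst0 V W : clinear (fun _ : V => 0 : W).
Proof.
split => [a x y|x]; first by rewrite scaler0 addr0.
exact: cst_continuous.
Qed.

Lemma clinear_fst V W1 W2 (A : V -> W1 * W2) :
  clinear A -> clinear (fun x => (A x).1).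
Proof.
move=> [lA cA]; split => [a x y|x]; first by rewrite lA.
by apply: (continuous_comp (cA x)); exact: cvg_fst.
Qed.

Lemma clinear_snd V W1 W2 (A : V -> W1 * W2) :
  clinear A -> clinear (fun x => (A x).2).
Proof.
move=> [lA cA]; split => [a x y|x]; first by rewrite lA.
by apply: (continuous_comp (cA x)); exact: cvg_snd.
Qed.

Lemma clinear_pair V W1 W2 (A : V -> W1) (B : V -> W2) :
  clinear A -> clinear B -> clinear (fun x => (A x, B x)).
Proof.
move=> [lA cA] [lB cB]; split => [a x y|x]; first by rewrite lA lB.
by apply: cvg_pair; [exact: cA|exact: cB].
Qed.

Lemma smooth_at_clinear V W (A : V -> W) x : clinear A -> smooth_at A x.
Proof.
move=> [lA cA]; exists setT; split => // [|k]; [exact: openT|].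
exact: Ck_on_linear.
Qed.

Lemma smooth_at_comp V W (f : V -> R) (A : W -> V) (a b : W -> R) (u v : V) w :
  clinear A -> smooth_at f (A w + a w *: u + b w *: v) ->
  smooth_at a w -> smooth_at b w ->
  smooth_at (fun w => f (A w + a w *: u + b w *: v)) w.
Proof.
move=> cA [U [oU Ux Uf]] sa sb.
have cl : {for w, continuous (fun w => A w + a w *: u + b w *: v)}.
  apply: continuousD; last by apply/continuousZl/smooth_at_continuous.
  apply: continuousD; first exact: cA.2.
  by apply/continuousZl/smooth_at_continuous.
have nU : \near w, U (A w + a w *: u + b w *: v).
  by apply: (cl U); exact: open_nbhs_nbhs.
move: sa sb => [U1 [oU1 U1x Ua]] [U2 [oU2 U2x Ub]].
have : \near w, U (A w + a w *: u + b w *: v) /\ (U1 `&` U2) w.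
  by apply: filterI => //; apply: open_nbhs_nbhs; split => //; exact: openI.
rewrite -nbhs_nearE nbhsE/= => -[B [oB Bx] BU]; exists B; split => // k.
apply: (Ck_on_comp (U' := U)) => //; try by case: cA.
- by move=> y /BU[].
- by apply: Ck_onS (Ua k) => y /BU[_ []].
- by apply: Ck_onS (Ub k) => y /BU[_ []].
Qed.

Lemma smooth_at_comp_clinear V W (f : V -> R) (A : W -> V) w :
  clinear A -> smooth_at f (A w) -> smooth_at (fun w => f (A w)) w.
Proof.
move=> cA sf; have E x : A x + (0:R) *: (0 : V) + (0:R) *: (0 : V) = A x.
  by rewrite !scaler0 !addr0.
have := @smooth_at_comp _ _ f A (fun=> 0) (fun=> 0) 0 0 w cA; rewrite E.
move=> /(_ sf (smooth_at_cst _ _) (smooth_at_cst _ _)).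
by apply: smooth_at_eq; apply: nearW => x; rewrite E.
Qed.

(** The inclusion of a slice is affine, not linear; its constant part enters [smooth_at_comp] as
    [1 *: (0, w)]. *)
Lemma smooth_at_slice V W (f : V * W -> R) v w :
  smooth_at f (v, w) -> smooth_at (fun v => f (v, w)) v.
Proof.
move=> sf; have E x : (x, 0 : W) + (1 : R) *: (0 : V, w) + (0:R) *: (0 : V * W) = (x, w).
  by rewrite scaler0 scale1r addr0; congr pair; rewrite /= ?addr0 ?add0r.
have := @smooth_at_comp _ _ f (fun v => (v, 0)) (fun=> 1) (fun=> 0) (0, w) 0 v.
rewrite E => /(_ (clinear_pair (clinear_id _) (clinear_cst0 _ _))).
move=> /(_ sf (smooth_at_cst _ _) (smooth_at_cst _ _)).
by apply: smooth_at_eq; apply: nearW => x; rewrite E.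
Qed.

Lemma smooth_at_comp_real W (f : R -> R) (a : W -> R) w :
  smooth_at f (a w) -> smooth_at a w -> smooth_at (fun w => f (a w)) w.
Proof.
move=> sf sa; have E x : 0 + a x *: (1 : R) + (0:R) *: (0 : R) = a x.
  by rewrite scaler0 add0r addr0 /GRing.scale/= mulr1.
have := @smooth_at_comp _ _ f (fun=> 0) a (fun=> 0) 1 0 w (clinear_cst0 _ _).
rewrite E => /(_ sf sa (smooth_at_cst _ _)).
by apply: smooth_at_eq; apply: nearW => x; rewrite E.
Qed.

Lemma smooth_at_comp1 V W (f : R * V -> R) (a : W -> R) (A : W -> V) w :
  clinear A -> smooth_at f (a w, A w) -> smooth_at a w ->
  smooth_at (fun w => f (a w, A w)) w.
Proof.
move=> cA sf sa.
have E x : (0 : R, A x) + a x *: (1 : R, 0 : V) + (0:R) *: (0 : R * V) = (a x, A x).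
  rewrite scaler0 addr0; congr pair; rewrite /= ?scaler0 ?addr0//.
  by rewrite add0r /GRing.scale/= mulr1.
have := @smooth_at_comp _ _ f (fun w => (0, A w)) a (fun=> 0) (1, 0) 0 w.
rewrite E => /(_ (clinear_pair (clinear_cst0 _ _) cA) sf sa (smooth_at_cst _ _)).
by apply: smooth_at_eq; apply: nearW => x; rewrite E.
Qed.

Lemma smooth_at_comp_pair V W (f : R * (R * V) -> R) (a b : W -> R) (A : W -> V) w :
  clinear A -> smooth_at f (a w, (b w, A w)) -> smooth_at a w -> smooth_at b w ->
  smooth_at (fun w => f (a w, (b w, A w))) w.
Proof.
move=> cA sf sa sb.
have E x : (0 : R, (0 : R, A x)) + a x *: (1 : R, (0 : R, 0 : V))
    + b x *: (0 : R, (1 : R, 0 : V)) = (a x, (b x, A x)).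
  congr pair; rewrite /=.
    by rewrite add0r scaler0 addr0 /GRing.scale/= mulr1.
  congr pair; rewrite /= ?scaler0 ?addr0//.
  by rewrite add0r /GRing.scale/= mulr1.
have := @smooth_at_comp _ _ f (fun w => (0, (0, A w))) a b (1, (0, 0)) (0, (1, 0)) w.
rewrite E => /(_ (clinear_pair (clinear_cst0 _ _) (clinear_pair (clinear_cst0 _ _) cA)) sf sa sb).
by apply: smooth_at_eq; apply: nearW => x; rewrite E.
Qed.

Lemma smooth_at_comp2 V W (f : R * R * V -> R) (a b : W -> R) (A : W -> V) w :
  clinear A -> smooth_at f ((a w, b w), A w) -> smooth_at a w -> smooth_at b w ->
  smooth_at (fun w => f ((a w, b w), A w)) w.
Proof.
move=> cA sf sa sb.
have E x : (0 : R * R, A x) + a x *: ((1 : R, 0 : R), 0 : V)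
    + b x *: ((0 : R, 1 : R), 0 : V) = ((a x, b x), A x).
  congr pair; rewrite /= ?scaler0 ?addr0//; congr pair => /=.
    by rewrite add0r scaler0 addr0 /GRing.scale/= mulr1.
  by rewrite add0r scaler0 add0r /GRing.scale/= mulr1.
have := @smooth_at_comp _ _ f (fun w => (0, A w)) a b ((1, 0), 0) ((0, 1), 0) w.
rewrite E => /(_ (clinear_pair (clinear_cst0 _ _) cA) sf sa sb).
by apply: smooth_at_eq; apply: nearW => x; rewrite E.
Qed.

Lemma near_sg V (f : V -> R) x : smooth_at f x -> f x != 0 ->
  \forall y \near x, Num.sg (f y) = Num.sg (f x).
Proof.
move=> sf; rewrite neq_lt => /orP[h|h].
  have := smooth_at_near_open sf (@open_lt _ (0 : R)) h.
  by apply: filterS => y /= y0; rewrite !ltr0_sg.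
have := smooth_at_near_open sf (@open_gt _ (0 : R)) h.
by apply: filterS => y /= y0; rewrite !gtr0_sg.
Qed.

End SmoothAt.

(** * Implicit functions *)

Section OneVariable.
Context {R : realType}.

Lemma mvt_open (f df : R -> R) (a b : R) : a < b ->
  (forall s, a <= s <= b -> is_derive s 1 f (df s)) ->
  exists2 c, a < c < b & f b - f a = df c * (b - a).
Proof.
move=> ab fd; have [||c + E] := @MVT R f df a b ab.
- by move=> x; rewrite in_itv/= => /andP[/ltW ax /ltW xb]; apply: fd; rewrite ax.
- apply: derivable_within_continuous => x; rewrite in_itv/= => /fd h.
  exact: ex_derive.
- by rewrite in_itv/= => acb; exists c.
Qed.

Lemma rolle_open (f df : R -> R) (a b : R) : a < b ->
  (forall s, a <= s <= b -> is_derive s 1 f (df s)) -> f a = f b ->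
  exists2 c, a < c < b & df c = 0.
Proof.
move=> ab fd fab; have [c acb] := mvt_open ab fd.
rewrite fab subrr => /esym/eqP; rewrite mulf_eq0 (gt_eqF (_ : 0 < b - a)) ?subr_gt0//.
by rewrite orbF => /eqP; exists c.
Qed.

Lemma pos_derive_lt (f df : R -> R) (a b : R) : a < b ->
  (forall s, a <= s <= b -> is_derive s 1 f (df s)) ->
  (forall s, a <= s <= b -> 0 < df s) -> f a < f b.
Proof.
move=> ab fd fp; have [c /andP[/ltW ac /ltW cb] E] := mvt_open ab fd.
by rewrite -subr_gt0 E mulr_gt0 ?subr_gt0// fp// ac.
Qed.

Lemma ivt_zero (f : R -> R) (a b v : R) : a <= b ->
  (forall s, a <= s <= b -> {for s, continuous f}) -> f a <= v <= f b ->
  exists2 c, a <= c <= b & f c = v.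
Proof.
move=> ab fc /andP[fav fvb]; have [||c + E] := @IVT R f a b v ab.
- apply: continuous_in_subspaceT => x.
  by rewrite inE/= in_itv/= => /fc.
- have fab := le_trans fav fvb.
  by rewrite (min_idPl fab) (max_idPr fab) fav.
- by rewrite in_itv/= => acb; exists c.
Qed.

End OneVariable.

Section Implicit.
Context {R : realType}.
Implicit Types (V W Q : normedModType R).

(* [a] need only be affine along [v], and no differentiability is required, so
   this covers slices and shears alike. *)
Lemma derive_affine V W (V' : normedModType R) (F : V -> V') (a : W -> V) w v u :
  (forall h : R, a (h *: v + w) = h *: u + a w) ->
  (derivable F (a w) u -> derivable (F \o a) w v) /\
  'D_v (F \o a) w = 'D_u F (a w).
Proof.
move=> aE.
have E : (fun h : R => h^-1 *: (((F \o a) \o shift w) (h *: v) - (F \o a) w)) =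
         (fun h : R => h^-1 *: ((F \o shift (a w)) (h *: u) - F (a w))).
  by apply/funext => h; rewrite /= aE.
by rewrite /derivable /derive E.
Qed.

Lemma slice_is_derive Q (V : normedModType R) (F : R * Q -> V) t q :
  derivable F (t, q) (1, 0) ->
  is_derive t 1 (fun s => F (s, q)) ('D_(1, 0) F (t, q)).
Proof.
have h (h : R) : (h *: 1 + t, q) = h *: ((1 : R), (0 : Q)) + (t, q).
  by congr pair; rewrite /= ?scaler0 ?add0r.
have [dE DE] := @derive_affine _ _ _ F (fun s => (s, q)) t 1 (1, 0) h.
by move=> /dE dF; split.
Qed.

Lemma clinear_bound V W (L : V -> W) : clinear L ->
  exists2 C, 0 < C & forall x, `|L x| <= C * `|x|.
Proof.
move=> [lL cL].
pose L' : {linear V -> W} := HB.pack L (GRing.isLinear.Build R V W *:%R L lL).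
have /linear_boundedP : bounded_near L' (nbhs (0 : V)).
  exact/linear_bounded_continuous.
by move=> /pinfty_ex_gt0[C C0 h]; exists C.
Qed.

Lemma near_pair_box (V' V : normedModType R) (t : V') (q : V) (P : V' * V -> Prop) :
  (\forall z \near (t, q), P z) ->
  exists2 r, 0 < r & forall s q', ball t r s -> ball q r q' -> P (s, q').
Proof.
move=> /nbhs_ballP[r /= r0 h]; exists r => // s q' bs bq; exact: h.
Qed.

Lemma near_box_pair (V' V : normedModType R) (t : V') (q : V) (P : V' * V -> Prop) r :
  0 < r -> (forall s q', ball t r s -> ball q r q' -> P (s, q')) ->
  \forall z \near (t, q), P z.
Proof.
by move=> r0 h; apply/nbhs_ballP; exists r => // -[s q'] /= [bs bq]; exact: h.
Qed.

Section PositiveDerivative.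
Variables (Q : normedModType R) (F : R * Q -> R) (t0 : R) (q0 : Q).
Hypotheses (sF : smooth_at F (t0, q0)) (F0 : F (t0, q0) = 0).
Hypothesis dF : 0 < 'D_(1, 0) F (t0, q0).

(** The unknown is one real number, so monotonicity in it and the intermediate value theorem replace
    a fixed point argument. Differentiability of [phi] comes from linearizing [F (phi q, q) = 0],
    and higher orders from the resulting formula for its differential. *)
Lemma smooth_implicit_pos : exists phi : Q -> R,
  [/\ smooth_at phi q0, phi q0 = t0, \forall q \near q0, F (phi q, q) = 0 &
      \forall z \near (t0, q0), F z = 0 -> z.1 = phi z.2].
Proof.
have [U [oU Uz CkF]] := sF.
pose Ft := 'D_(1, 0) F.
have sU z : U z -> smooth_at F z by exists U.
have : \forall z \near (t0, q0), U z /\ 0 < Ft z.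
  apply: filterI; first exact: open_nbhs_nbhs.
  have cFt := smooth_at_continuous (smooth_at_derive ((1, 0) : R * Q) sF).
  have nz : nbhs (Ft (t0, q0)) [set y : R | 0 < y].
    by apply: open_nbhs_nbhs; split => //; exact: open_gt.
  exact: (cFt _ nz).
move=> /near_pair_box[r r0 box].
have boxU s q : ball t0 r s -> ball q0 r q -> U (s, q) by move=> /box h /h [].
have boxF s q : ball t0 r s -> ball q0 r q -> 0 < Ft (s, q) by move=> /box h /h [].
have btE s : ball t0 r s <-> t0 - r < s < t0 + r.
  by rewrite -ball_normE/= ltr_distlC.
have bt_mid a b s : ball t0 r a -> ball t0 r b -> a <= s <= b -> ball t0 r s.
  move=> /btE/andP[a1 a2] /btE/andP[b1 b2] /andP[as_ sb]; apply/btE.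
  by rewrite (lt_le_trans a1 as_) (le_lt_trans sb b2).
have incr a b q : ball t0 r a -> ball t0 r b -> ball q0 r q -> a < b ->
    F (a, q) < F (b, q).
  move=> ba bb bq ab; apply: (@pos_derive_lt _ (fun s => F (s, q)) (fun s => Ft (s, q))) => //.
    move=> s /(bt_mid _ _ _ ba bb) bs; apply: slice_is_derive.
    by apply/smooth_at_derivable/sU/boxU.
  by move=> s /(bt_mid _ _ _ ba bb) bs; exact: boxF.
have inj a b q : ball t0 r a -> ball t0 r b -> ball q0 r q ->
    F (a, q) = F (b, q) -> a = b.
  move=> ba bb bq E; case: (ltgtP a b) => // h.
    by have := incr _ _ _ ba bb bq h; rewrite E ltxx.
  by have := incr _ _ _ bb ba bq h; rewrite E ltxx.
have cF s q : ball t0 r s -> ball q0 r q -> {for (s, q), continuous F}.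
  by move=> bs bq; apply/smooth_at_continuous/sU/boxU.
have cFq s q : ball t0 r s -> ball q0 r q -> {for q, continuous (fun q => F (s, q))}.
  move=> bs bq; apply: (@continuous_comp _ _ _ (fun q => (s, q)) F); last exact: cF.
  exact: (smooth_at_continuous (smooth_at_pair (smooth_at_cst s q)
    (smooth_at_clinear q (clinear_id Q)))).
have cFs s q : ball t0 r s -> ball q0 r q -> {for s, continuous (fun s => F (s, q))}.
  move=> bs bq; apply: (@continuous_comp _ _ _ (fun s => (s, q)) F); last exact: cF.
  exact: (smooth_at_continuous (smooth_at_pair (smooth_at_clinear s (clinear_id R))
    (smooth_at_cst q s))).
(* Strict signs at two fixed bracket ends survive small changes of [q]. This yields both the
   existence of the zero near [q0] and the continuity of [phi]. *)
have pers a b q1 : ball t0 r a -> ball t0 r b -> ball q0 r q1 ->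
    F (a, q1) < 0 < F (b, q1) ->
    \forall q \near q1, ball q0 r q /\ F (a, q) < 0 < F (b, q).
  move=> ba bb bq /andP[Fa Fb].
  have na : nbhs (F (a, q1)) [set y : R | y < 0].
    by apply: open_nbhs_nbhs; split => //; exact: open_lt.
  have nb : nbhs (F (b, q1)) [set y : R | 0 < y].
    by apply: open_nbhs_nbhs; split => //; exact: open_gt.
  have hb : \forall q \near q1, ball q0 r q.
    by apply: open_nbhs_nbhs; split => //; exact: ball_open.
  have ha := cFq _ _ ba bq _ na; have {}hb' := cFq _ _ bb bq _ nb.
  near=> q; split; first by near: q.
  by apply/andP; split; [near: q; exact: ha|near: q; exact: hb'].
have bt0 : ball t0 r t0 by exact: ballxx.
have bq0 : ball q0 r q0 by exact: ballxx.
have around s1 q1 e : ball t0 r s1 -> ball q0 r q1 -> F (s1, q1) = 0 -> 0 < e ->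
    exists a b, [/\ ball t0 r a, ball t0 r b, s1 - e < a, b < s1 + e &
      F (a, q1) < 0 < F (b, q1)].
  move=> bs1 bq1 Fs e0.
  have : \forall e' \near 0^'+, ball t0 r (s1 - e') /\ ball t0 r (s1 + e').
    have ob : nbhs s1 (ball t0 r) by apply: open_nbhs_nbhs; split => //; exact: ball_open.
    move: ob => /nbhs_ballP[d /= d0 hd]; near=> e'; split; apply: hd.
      rewrite -ball_normE/= opprB addrC subrK gtr0_norm//.
    by rewrite -ball_normE/= opprD addrA subrr add0r normrN gtr0_norm.
  move=> ne; have [e' [[b1 b2] [e'0 e'e]]] : exists e',
      (ball t0 r (s1 - e') /\ ball t0 r (s1 + e')) /\ (0 < e' /\ e' < e).
    by near (0:R)^'+ => e'; exists e'; split; [near: e'|split].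
  exists (s1 - e'), (s1 + e'); split => //.
  - by rewrite ltrD2l ltrN2.
  - by rewrite ltrD2l.
  - by rewrite -Fs !incr// ?ltrDl// ltrBlDr ltrDl.
have [a0 [b0 [ba0 bb0 _ _ /(pers _ _ _ ba0 bb0 bq0)]]] := around _ _ _ bt0 bq0 F0 ltr01.
move=> /nbhs_ballP[r2 /= r20 hr2].
pose O : set Q := ball q0 r2.
have oO : open O by exact: ball_open.
have Oq0 : O q0 by exact: ballxx.
(* On [O] the zero exists and is unique in the ball, so the default [t0] only matters elsewhere. *)
pose phi q := xget t0 [set s | ball t0 r s /\ F (s, q) = 0].
have phiP q : O q -> ball t0 r (phi q) /\ F (phi q, q) = 0.
  move=> /hr2[bq /andP[Fa Fb]]; rewrite /phi; case: xgetP => // H.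
  have ab : a0 <= b0.
    rewrite leNgt; apply/negP => ba.
    by have := incr _ _ _ bb0 ba0 bq ba; rewrite ltNge (ltW (lt_trans Fa Fb)).
  have [||c acb Fc] := @ivt_zero _ (fun s => F (s, q)) a0 b0 0 ab.
  - by move=> s /(bt_mid _ _ _ ba0 bb0) bs; exact: cFs.
  - by rewrite !ltW.
  - exfalso; apply: (H c); split => //; exact: bt_mid acb.
have Ob q : O q -> ball q0 r q by move=> /hr2[].
have phiU q : O q -> U (phi q, q) by move=> Oq; apply: boxU; [exact: (phiP q Oq).1|exact: Ob].
have phic q : O q -> {for q, continuous phi}.
  move=> Oq; apply/cvgrPdist_lt => e e0.
  have [bp Fp] := phiP _ Oq.
  have [a [b [ba bb pa pb /(pers _ _ _ ba bb (Ob _ Oq)) ab]]] := around _ _ _ bp (Ob _ Oq) Fp e0.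
  have nO : \forall q' \near q, O q' by exact: open_nbhs_nbhs.
  near=> q'.
  have Oq' : O q' by near: q'.
  have [bq' /andP[Fa Fb]] : ball q0 r q' /\ F (a, q') < 0 < F (b, q') by near: q'.
  have [bp' Fp'] := phiP _ Oq'.
  have ap : a < phi q'.
    rewrite ltNge; apply/negP; rewrite le_eqVlt => /predU1P[E|h].
      by move: Fa; rewrite -E Fp' ltxx.
    by have := incr _ _ _ bp' ba bq' h; rewrite Fp' ltNge (ltW Fa).
  have pb' : phi q' < b.
    rewrite ltNge; apply/negP; rewrite le_eqVlt => /predU1P[E|h].
      by move: Fb; rewrite E Fp' ltxx.
    by have := incr _ _ _ bb bp' bq' h; rewrite Fp' ltNge (ltW Fb).
  by rewrite ltr_distlC (lt_trans pa ap) (lt_trans pb' pb).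
have phid q : O q -> differentiable phi q /\
    'd phi q = (fun h => - (Ft (phi q, q))^-1 * 'd F (phi q, q) (0, h)) :> (Q -> R).
  move=> Oq; set z := (phi q, q).
  have [bp Fp] := phiP _ Oq.
  have dz : differentiable F z by apply/smooth_at_differentiable/sU/phiU.
  have a0' : 0 < Ft z by apply: boxF => //; exact: Ob.
  have cL : clinear (fun h => - (Ft z)^-1 * 'd F z ((0 : R), h)).
    split => [k x y|x].
      have -> : ((0 : R), k *: x + y) = k *: ((0 : R), x) + ((0 : R), y).
        by congr pair => /=; rewrite scaler0 addr0.
      by rewrite linearD linearZ /= mulrDr /GRing.scale/= mulrCA.
    apply: (@continuousM _ _ (fun=> _) (fun h => 'd F z ((0 : R), h))); first exact: cst_continuous.
    apply: (@continuous_comp _ _ _ (fun h => ((0:R), h)) ('d F z)).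
      exact: (clinear_pair (clinear_cst0 Q R) (clinear_id Q)).2.
    exact: diff_continuous.
  have [C C0 hC] := clinear_bound cL.
  apply: differentiable_eps; [by case: cL|by case: cL|move=> e e0].
  set a := Ft z in a0' cL hC *.
  (* [eta <= 2^-1] lets the error term be absorbed, giving [|x| <= (2 * C + 1) * |h|]; the second
     bound then turns the error [eta * (|x| + |h|)] into at most [e * |h|]. *)
  pose eta := Num.min (2^-1) (e / (2 * C + 2)).
  have C2 : 0 < 2 * C + 2 by rewrite addr_gt0// mulr_gt0.
  have eta0 : 0 < eta by rewrite /eta lt_min invr_gt0 ltr0n divr_gt0.
  have := differentiable_le_eps dz (mulr_gt0 eta0 a0') => nz.
  have cz : {for q, continuous (fun q => (phi q, q))}.
    by apply: (@continuous_pair _ _ _ _ phi id); [exact: phic|exact: cvg_id].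
  have {}nz := cz _ nz.
  have nO : \forall q' \near q, O q' by exact: open_nbhs_nbhs.
  near=> q'.
  have Oq' : O q' by near: q'.
  have : `|F (phi q', q') - F z - 'd F z ((phi q', q') - z)| <= eta * a * `|(phi q', q') - z|.
    by near: q'.
  have [bp' Fp'] := phiP _ Oq'.
  set x := phi q' - phi q; set h := q' - q.
  have -> : (phi q', q') - z = x *: ((1 : R), (0 : Q)) + ((0 : R), h).
    apply: injective_projections; rewrite /= ?scaler0 ?add0r//.
    by rewrite addr0 /GRing.scale/= mulr1.
  rewrite Fp' Fp subrr sub0r normrN linearD linearZ -deriveE//= -/Ft -/a.
  set D := 'd F z _; set N := (X in _ <= eta * a * X) => hN.
  have Nle : N <= `|x| + `|h|.
    rewrite /N (_ : _ + _ = (x, h)); last first.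
      apply: injective_projections; rewrite /= ?scaler0 ?add0r//.
      by rewrite addr0 /GRing.scale/= mulr1.
    by rewrite prod_normE/= ge_max lerDl lerDr !normr_ge0.
  have L : `|x - - a^-1 * D| <= eta * (`|x| + `|h|).
    have -> : x - - a^-1 * D = a^-1 * (x * a + D).
      by rewrite mulNr opprK mulrDr mulrCA mulVf ?mulr1//; exact: lt0r_neq0.
    rewrite normrM gtr0_norm ?invr_gt0// ler_pdivrMl//.
    by rewrite (le_trans hN)// [X in _ <= X]mulrA [a * eta]mulrC ler_pM2l ?mulr_gt0.
  have eta2 : eta <= 2^-1 by rewrite /eta ge_min lexx.
  have etae : eta * (2 * C + 2) <= e.
    by rewrite -ler_pdivlMr// /eta ge_min lexx orbT.
  have xle : `|x| <= (2 * C + 1) * `|h|.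
    have hD : `|- a^-1 * D| <= C * `|h| by exact: hC.
    have : `|x| <= `|x - - a^-1 * D| + `|- a^-1 * D|.
      by rewrite -{1}(subrK (- a^-1 * D) x) ler_normD.
    have : eta * (`|x| + `|h|) <= 2^-1 * (`|x| + `|h|).
      by rewrite ler_wpM2r ?addr_ge0.
    move: L hD; move: `|x| `|h| `|x - _| `|- _ * _| (eta * _) => u v w y zz; lra.
  apply: (le_trans L); apply: (@le_trans _ _ (eta * ((2 * C + 2) * `|h|))).
    by rewrite ler_pM2l//; move: xle; move: `|x| `|h| => u v; lra.
  by rewrite mulrA ler_wpM2r.
exists phi; split.
- exists O; split => // k.
  (* Bootstrapping: the derivatives of [phi] are expressed through derivatives of [F] at
     [(phi q, q)], which are [C^k] once [phi] is. *)
  elim: k => [|k IH]; first by move=> q Oq; exact: phic.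
  split; first by move=> q /phid[].
  move=> v.
  apply: (@Ck_on_eq _ _ _ _ _ (fun q => - (Ft (phi q, q))^-1 * 'D_(0, v) F (phi q, q))) => //.
    move=> q Oq; have [dq E] := phid q Oq.
    rewrite [RHS]deriveE// E; congr (_ * _); rewrite deriveE//.
    by apply/smooth_at_differentiable/sU/phiU.
  have CkFq (G : R * Q -> R) : Ck_on U k G -> Ck_on O k (fun q => G (phi q, q)).
    move=> CG.
    have E q : (0 : R, q) + phi q *: (1 : R, 0 : Q) + (0:R) *: (0 : R * Q) = (phi q, q).
      apply: injective_projections; rewrite /= !scaler0 !addr0//.
      by rewrite add0r /GRing.scale/= mulr1.
    have [lA cA] := clinear_pair (clinear_cst0 Q R) (clinear_id Q).
    apply: (@Ck_on_eq _ _ _ _ _ (fun q =>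
      G ((0 : R, q) + phi q *: (1 : R, 0 : Q) + (0:R) *: (0 : R * Q)))) => //.
      by move=> q Oq; rewrite E.
    apply: (Ck_on_comp (U' := U)) => //; last exact: Ck_on_cst.
    by move=> q Oq; rewrite E; exact: phiU.
  have CFt : Ck_on U k Ft by have [_] := CkF k.+1; exact.
  have CFv : Ck_on U k ('D_((0, v) : R * Q) F) by have [_] := CkF k.+1; exact.
  apply: Ck_onM => //; last exact: (CkFq ('D_((0, v) : R * Q) F)) .
  apply: (@Ck_on_eq _ _ _ _ _ (fun q => cst (-1) q * (Ft (phi q, q))^-1)) => //.
    by move=> q _; rewrite mulN1r.
  apply: Ck_onM => //; first exact: Ck_on_cst.
  apply: Ck_onV => //; last exact: CkFq.
  by move=> q Oq; apply/lt0r_neq0/boxF; [exact: (phiP q Oq).1|exact: Ob].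
- have [bp Fp] := phiP _ Oq0.
  by apply: inj bp bt0 bq0 _; rewrite Fp F0.
- have : \forall q \near q0, O q by exact: open_nbhs_nbhs.
  by apply: filterS => q /phiP[].
- have : \forall z \near (t0, q0), ball t0 r z.1 /\ O z.2.
    exists (ball t0 r, O) => /=; last by case=> s q [].
    by split; apply: open_nbhs_nbhs; split => //; exact: ball_open.
  apply: filterS => -[s q]/= [bs Oq] Fs; have [bp Fp] := phiP _ Oq.
  by apply: inj bs bp (Ob _ Oq) _; rewrite Fs Fp.
Unshelve. all: by end_near. Qed.
End PositiveDerivative.

Theorem smooth_implicit Q (F : R * Q -> R) t0 q0 :
  smooth_at F (t0, q0) -> F (t0, q0) = 0 -> 'D_(1, 0) F (t0, q0) != 0 ->
  exists phi : Q -> R,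
  [/\ smooth_at phi q0, phi q0 = t0, \forall q \near q0, F (phi q, q) = 0 &
      \forall z \near (t0, q0), F z = 0 -> z.1 = phi z.2].
Proof.
move=> sF F0; rewrite neq_lt => /orP[dF|]; last exact: smooth_implicit_pos.
have [|||phi [sphi phi0 h1 h2]] := @smooth_implicit_pos Q (fun z => - F z) t0 q0.
- exact: smooth_atN.
- by rewrite F0 oppr0.
- rewrite -oppr_lt0 (_ : - _ = 'D_(1, 0) F (t0, q0))//.
  rewrite (deriveN (f := F)) ?opprK//; exact: smooth_at_derivable.
exists phi; split => //.
  by apply: filterS h1 => q /eqP; rewrite oppr_eq0 => /eqP.
by apply: filterS h2 => z h Fz; apply: h; rewrite Fz oppr0.
Qed.

End Implicit.

(** * Hadamard's lemma *)

Section Schwarz.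
Context {R : realType} (V : normedModType R).
Implicit Types (F : V -> R) (x u v : V).

Lemma line_is_derive F (c u : V) (t : R) : smooth_at F (c + t *: u) ->
  is_derive t 1 (fun t => F (c + t *: u)) ('D_u F (c + t *: u)).
Proof.
move=> sF; have h (h : R) : c + (h *: 1 + t) *: u = h *: u + (c + t *: u).
  by rewrite scalerDl [h *: 1]mulr1 addrCA addrA.
have [dE DE] := @derive_affine _ _ R _ F (fun t : R => c + t *: u) t 1 u h.
by split; [exact/dE/smooth_at_derivable|].
Qed.

(** The mean value theorem along [u], then along [v], gives [h ^+ 2] times the mixed derivative at a
    nearby point. The second difference is symmetric in [u] and [v], whence Schwarz' theorem
    below. *)
Lemma second_difference F x u v e : smooth_at F x -> 0 < e ->
  \forall h \near 0^'+, `|(F (x + h *: v + h *: u) - F (x + h *: u)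
     - F (x + h *: v) + F x) - h ^+ 2 * 'D_v ('D_u F) x| <= e * h ^+ 2.
Proof.
move=> sF e0.
have cD := smooth_at_continuous (smooth_at_derive v (smooth_at_derive u sF)).
have /cvgrPdist_le/(_ _ e0) cDe := cD.
have /nbhs_ballP[r /= r0 hr] : \forall y \near x,
    smooth_at F y /\ `|'D_v ('D_u F) x - 'D_v ('D_u F) y| <= e.
  by apply: filterI => //; exact: smooth_at_near.
have box : \forall h \near 0^'+, forall s t, 0 <= s <= h -> 0 <= t <= h ->
    ball x r (x + s *: v + t *: u).
  (* The summand 1 keeps the divisor positive when [u] and [v] both vanish. *)
  have N0 : 0 < `|u| + `|v| + 1 by rewrite ltr_pwDr// addr_ge0.
  near=> h => s t /andP[s0 sh] /andP[t0 th].
  rewrite -ball_normE/= -addrA opprD addrA subrr add0r normrN.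
  apply: (le_lt_trans (ler_normD _ _)); rewrite !normrZ !ger0_norm//.
  apply: (@le_lt_trans _ _ (h * (`|u| + `|v| + 1))).
    rewrite !mulrDr mulr1 -addrA [h * `|u| + _]addrC.
    have h0 : 0 <= h by exact: le_trans sh.
    by rewrite -addrA lerD ?ler_wpM2r// (le_trans (ler_wpM2r (normr_ge0 u) th))// lerDr.
  by rewrite -ltr_pdivlMr//; near: h; apply: nbhs_right_lt; rewrite divr_gt0.
near=> h.
have boxh : forall s t, 0 <= s <= h -> 0 <= t <= h -> ball x r (x + s *: v + t *: u).
  by near: h; exact: box.
have h0 : 0 < h by [].
have sFb s t : 0 <= s <= h -> 0 <= t <= h -> smooth_at F (x + s *: v + t *: u).
  by move=> hs ht; have [] := hr _ (boxh _ _ hs ht).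
have hh : 0 <= h <= h by rewrite ltW/=.
have h00 : 0 <= (0:R) <= h by rewrite lexx ltW.
have x0 : x = x + 0 *: v by rewrite scale0r addr0.
pose phi t := F (x + h *: v + t *: u) - F (x + 0 *: v + t *: u).
have [|c /andP[/ltW c0 /ltW ch] E1] := @mvt_open R phi
    (fun t => 'D_u F (x + h *: v + t *: u) - 'D_u F (x + 0 *: v + t *: u)) 0 h h0.
  by move=> s sh; apply: is_deriveB; apply: line_is_derive; exact: sFb.
have hc : 0 <= c <= h by rewrite c0.
have lineE t : x + t *: v + c *: u = x + c *: u + t *: v by rewrite addrAC.
have [|d /andP[/ltW d0 /ltW dh] E2] := @mvt_open R (fun t => 'D_u F (x + c *: u + t *: v))
    (fun t => 'D_v ('D_u F) (x + c *: u + t *: v)) 0 h h0.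
  move=> s sh; apply: line_is_derive; rewrite -lineE.
  by apply: smooth_at_derive; exact: sFb.
have hd : 0 <= d <= h by rewrite d0.
have [_] := hr _ (boxh _ _ hd hc).
have -> : F (x + h *: v + h *: u) - F (x + h *: u) - F (x + h *: v) + F x =
    phi h - phi 0.
  by rewrite /phi !scale0r !addr0 opprB addrA addrAC.
rewrite E1 !lineE E2 subr0.
set A := 'D_v _ x; set B := 'D_v _ _ => AB.
have -> : B * h * h - h ^+ 2 * A = - (h ^+ 2 * (A - B)) by ring.
rewrite normrN normrM ger0_norm ?sqr_ge0// mulrC.
by rewrite ler_pM2r// exprn_gt0.
Unshelve. all: by end_near. Qed.

Lemma abs_le_of_second_differences (a b c d g A B e : R) : 0 < g ->
  `|a - b - c + d - g * A| <= e / 2 * g -> `|a - c - b + d - g * B| <= e / 2 * g ->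
  `|A - B| <= e.
Proof.
move=> g0; rewrite -(ler_pM2r g0 `|A - B|).
have -> : `|A - B| * g = `|g * A - g * B|.
  by rewrite -mulrBr normrM (gtr0_norm g0) mulrC.
move: (g * A) (g * B) => u v; rewrite !ler_norml => /andP[a1 a2] /andP[b1 b2].
by apply/andP; split; lra.
Qed.

Lemma derive_comm F x u v : smooth_at F x ->
  'D_v ('D_u F) x = 'D_u ('D_v F) x.
Proof.
move=> sF; apply/eqP; rewrite -subr_eq0 -normr_le0; apply/ler_addgt0Pr => e.
rewrite add0r.
move=> e0; have e2 : 0 < e / 2 by rewrite divr_gt0.
have /filterI := second_difference u v sF e2.
move=> /(_ _ (second_difference v u sF e2)) n.
near (0:R)^'+ => h.
have h2 : 0 < h ^+ 2 by rewrite exprn_gt0.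
have [] : `|(F (x + h *: v + h *: u) - F (x + h *: u)
     - F (x + h *: v) + F x) - h ^+ 2 * 'D_v ('D_u F) x| <= e / 2 * h ^+ 2 /\
 `|(F (x + h *: u + h *: v) - F (x + h *: v)
     - F (x + h *: u) + F x) - h ^+ 2 * 'D_u ('D_v F) x| <= e / 2 * h ^+ 2 by near: h.
rewrite [x + h *: u + _]addrAC.
set A := 'D_v _ x; set B := 'D_u _ x; set a := F _; set b := F _; set c := F _.
exact: abs_le_of_second_differences.
Unshelve. all: by end_near. Qed.

End Schwarz.

(** * Smooth division by a real variable, without integrals *)

Section Hadamard.
Context {R : realType} (Q : normedModType R) (q0 : Q) (r : R).
Implicit Types (K Pi : R * Q -> R) (j k : nat).

Let B : set (R * Q) := ball (0, q0) r.
Let D K : R * Q -> R := 'D_(1, 0) K.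

Definition smooth_box K := forall z, B z -> smooth_at K z.

(* [Pi (s, q)] is the integral of [t ^+ j * K (t, q)] over [0 <= t <= s], and
   [moment j Pi K (s, q)] that of [t ^+ j * K (s * t, q)] over [0 <= t <= 1]. *)
Definition primitive_pair j Pi K :=
  [/\ smooth_box Pi, smooth_box K, forall q, B (0, q) -> Pi (0, q) = 0 &
      forall z, B z -> D Pi z = z.1 ^+ j * K z].

Definition moment j Pi K : R * Q -> R := fun z =>
  if z.1 == 0 then K z / j.+1%:R else Pi z / z.1 ^+ j.+1.

(** Integration by parts: the integral of [t ^+ j.+1 * D K] in terms of that of [t ^+ j * K]. *)
Definition next_primitive j Pi K : R * Q -> R :=
  fun z => z.1 ^+ j.+1 * K z - j.+1%:R * Pi z.

Let openB : open B. Proof. exact: ball_open. Qed.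

Lemma box_scale s q c : B (s, q) -> `|c| <= `|s| -> B (c, q).
Proof.
move=> [/= bs bq] cs; split => //; move: bs.
by rewrite -!ball_normE/= !sub0r !normrN; exact: le_lt_trans.
Qed.

Lemma smooth_at_fst (z : R * Q) : smooth_at (fun z : R * Q => z.1) z.
Proof. exact/smooth_at_clinear/clinear_fst/clinear_id. Qed.

Lemma smooth_at_fstX n (z : R * Q) : smooth_at (fun z : R * Q => z.1 ^+ n) z.
Proof.
elim: n => [|n IH].
  by apply: smooth_at_ext (smooth_at_cst (1 : R) z) => y; rewrite expr0.
by apply: smooth_at_ext (smooth_atM (smooth_at_fst z) IH) => y; rewrite exprS.
Qed.

Lemma derive_fstX n (z w : R * Q) :
  'D_w (fun z : R * Q => z.1 ^+ n) z = n%:R * z.1 ^+ n.-1 * w.1.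
Proof.
have E (h : R) : (h *: w + z).1 = h *: w.1 + z.1 by [].
have [_ ->] := @derive_affine _ _ _ _ (fun t : R => t ^+ n) _ z w w.1 E.
by rewrite exp_derive.
Qed.

Lemma D_fstXM n K z : smooth_at K z ->
  D (fun z => z.1 ^+ n * K z) z = n%:R * z.1 ^+ n.-1 * K z + z.1 ^+ n * D K z.
Proof.
move=> sK; rewrite /D (deriveM (f := fun z : R * Q => z.1 ^+ n)).
- by rewrite derive_fstX/= mulr1 addrC; congr (_ + _); rewrite [LHS]mulrC.
- exact: (smooth_at_derivable (smooth_at_fstX _ _)).
- exact/smooth_at_derivable.
Qed.

Lemma smooth_box_next j Pi K : smooth_box Pi -> smooth_box K ->
  smooth_box (next_primitive j Pi K).
Proof.
move=> sP sK z Bz; apply: smooth_atB.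
  by apply: smooth_atM; [exact: smooth_at_fstX|exact: sK].
by apply: smooth_atM; [exact: smooth_at_cst|exact: sP].
Qed.

Lemma next_primitiveP j Pi K : primitive_pair j Pi K ->
  primitive_pair j.+1 (next_primitive j Pi K) (D K).
Proof.
move=> [sP sK P0 DP]; split.
- exact: smooth_box_next.
- by move=> z Bz; apply/smooth_at_derive/sK.
- by move=> q Bq; rewrite /next_primitive P0//= expr0n/= mul0r mulr0 subrr.
- move=> z Bz; have sPz := sP z Bz; have sKz := sK z Bz.
  have sXz := smooth_at_fstX j.+1 z.
  rewrite /D /next_primitive (deriveB (f := fun z : R * Q => z.1 ^+ j.+1 * K z)
    (g := fun z : R * Q => j.+1%:R * Pi z)).
  + have := D_fstXM j.+1 sKz; rewrite /D => ->.
    rewrite (deriveMl (f := Pi)); last exact: smooth_at_derivable.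
    have := DP z Bz; rewrite /D => ->; rewrite /= /GRing.scale/=; ring.
  + by apply: smooth_at_derivable; exact: smooth_atM.
  + by apply: smooth_at_derivable; apply: smooth_atM => //; exact: smooth_at_cst.
Qed.

(** Differentiation under the integral sign; here it is Schwarz' theorem, as derivatives along [Q]
    must commute with [D]. *)
Lemma derive_primitive_pair j Pi K v : primitive_pair j Pi K ->
  primitive_pair j ('D_(0, v) Pi) ('D_(0, v) K).
Proof.
move=> [sP sK P0 DP]; split.
- by move=> z Bz; apply/smooth_at_derive/sP.
- by move=> z Bz; apply/smooth_at_derive/sK.
- move=> q Bq.
  have E (h : R) : (0 : R, h *: v + q) = h *: ((0 : R), v) + (0, q).
    by apply: injective_projections; rewrite /= ?scaler0 ?addr0.
  have [_ <-] := @derive_affine _ _ _ _ Pi (fun q => (0, q)) q v (0, v) E.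
  rewrite (near_eq_derive (g := fun=> 0)) ?derive_cst//.
  have c0 : {for q, continuous (fun q => (0 : R, q))}.
    exact: (clinear_pair (clinear_cst0 Q R) (clinear_id Q)).2.
  have : \forall q' \near q, B (0, q') by apply: (c0 B); exact: open_nbhs_nbhs.
  by apply: filterS => q' /P0.
- move=> z Bz; rewrite /D derive_comm; last exact: sP.
  have -> : 'D_(0, v) ('D_(1, 0) Pi) z = 'D_(0, v) (fun z : R * Q => z.1 ^+ j * K z) z.
    apply: near_eq_derive; have : \forall z \near z, B z by exact: open_nbhs_nbhs.
    by apply: filterS => y /DP.
  rewrite (deriveM (f := fun z : R * Q => z.1 ^+ j)).
  + by rewrite derive_fstX/= mulr0 scaler0 addr0.
  + exact: (smooth_at_derivable (smooth_at_fstX _ _)).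
  + exact/smooth_at_derivable/sK.
Qed.

Lemma slice_is_derive_box K s q : smooth_box K -> B (s, q) ->
  is_derive s 1 (fun s => K (s, q)) (D K (s, q)).
Proof. by move=> sK Bz; apply/slice_is_derive/smooth_at_derivable/sK. Qed.

(** Cauchy's mean value theorem for [Pi] against [t ^+ j.+1], in the role of the mean value theorem
    for integrals. It controls the moment as [s] tends to 0. *)
Lemma moment_mean j Pi K s q : primitive_pair j Pi K -> B (s, q) ->
  exists2 c, `|c| <= `|s| & moment j Pi K (s, q) = K (c, q) / j.+1%:R.
Proof.
move=> [sP sK P0 DP] Bz; rewrite /moment/=; case: eqVneq => [->|s0].
  by exists 0.
(* [psi] vanishes at 0 and at [s]. Rolle's point lies strictly between them, so [c != 0] and
   [c ^+ j] can be cancelled at the end. *)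
pose psi t := s ^+ j.+1 * Pi (t, q) - Pi (s, q) * t ^+ j.+1.
pose dpsi t := s ^+ j.+1 * D Pi (t, q) - Pi (s, q) * (j.+1%:R * t ^+ j).
have psid (t : R) : `|t| <= `|s| -> is_derive t 1 psi (dpsi t).
  move=> ts; have Bt := box_scale Bz ts; apply: is_deriveB.
    have dP := slice_is_derive_box sP Bt.
    exact: (is_deriveZ (s ^+ j.+1) dP).
  have dX : is_derive t 1 (fun t : R => t ^+ j.+1) (j.+1%:R * t ^+ j).
    by apply: DeriveDef; [exact: exprn_derivable|rewrite exp_derive /GRing.scale/= mulr1].
  exact: (is_deriveZ (Pi (s, q)) dX).
have psi0 : psi 0 = 0.
  rewrite /psi P0 ?expr0n/= ?mulr0 ?subrr//; apply: box_scale Bz _.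
  by rewrite normr0.
have psis : psi s = 0 by rewrite /psi mulrC subrr.
have [c [cs c0 E]] : exists c, [/\ `|c| <= `|s|, c != 0 & dpsi c = 0].
  have [sn|sp|/eqP] := ltgtP s 0; last by rewrite (negPf s0).
    have [||c /andP[c1 c2] E] := @rolle_open R psi dpsi s 0 sn.
    - by move=> t /andP[t1 t2]; apply: psid; rewrite !ler0_norm ?lerN2// ltW.
    - by rewrite psi0.
    - exists c; split => //; last by rewrite lt_eqF.
      by rewrite !ler0_norm ?lerN2// ltW.
  have [||c /andP[c1 c2] E] := @rolle_open R psi dpsi 0 s sp.
  - by move=> t /andP[t1 t2]; apply: psid; rewrite !ger0_norm// ltW.
  - by rewrite psi0.
  - exists c; split => //; last by rewrite gt_eqF.
    by rewrite !ger0_norm// ltW.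
exists c => //; move: E; rewrite /dpsi DP/=; last exact: box_scale cs.
have sX0 : s ^+ j.+1 != 0 by rewrite expf_neq0.
have cX0 : c ^+ j != 0 by rewrite expf_neq0.
have jn : j.+1%:R != 0 :> R by rewrite pnatr_eq0.
move=> /eqP; rewrite subr_eq0 => /eqP E.
apply/eqP; rewrite eqr_div// -(inj_eq (mulfI cX0)); apply/eqP.
by move: E; move: (s ^+ _) (c ^+ _) (K _) (Pi _) (j.+1%:R) => a b k p n E; lra.
Qed.

Lemma derive_split K z w : smooth_at K z ->
  'D_w K z = w.1 * D K z + 'D_(0, w.2) K z.
Proof.
move=> /smooth_at_differentiable dK; rewrite /D !deriveE//.
have {1}-> : w = w.1 *: ((1 : R), (0 : Q)) + (0, w.2).
  by apply: injective_projections; rewrite /= ?scaler0 ?add0r// addr0 [RHS]mulr1.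
by rewrite linearD linearZ.
Qed.

Lemma moment_quotient j Pi K (z : R * Q) : z.1 != 0 ->
  \forall y \near z, Pi y * (y.1 ^+ j.+1)^-1 = moment j Pi K y.
Proof.
move=> z0; have nz := smooth_at_near_open (smooth_at_fst z) (@open_neq _ (0 : R)) z0.
by apply: filterS nz => y /= y0; rewrite /moment (negPf y0).
Qed.

Lemma smooth_at_moment j Pi K z : smooth_at Pi z -> z.1 != 0 ->
  smooth_at (moment j Pi K) z.
Proof.
move=> sP z0; apply: (smooth_at_eq (moment_quotient j Pi K z0)).
apply: smooth_atM => //; apply: smooth_atV; last exact: smooth_at_fstX.
by rewrite expf_neq0.
Qed.

Lemma derive_moment_off j Pi K z w : primitive_pair j Pi K -> B z -> z.1 != 0 ->
  'D_w (moment j Pi K) z = w.1 * moment j.+1 (next_primitive j Pi K) (D K) z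
    + moment j ('D_(0, w.2) Pi) ('D_(0, w.2) K) z.
Proof.
move=> [sP sK P0 DP] Bz z0.
have X0 n : z.1 ^+ n != 0 by rewrite expf_neq0.
rewrite -(near_eq_derive _ (moment_quotient j Pi K z0)).
have sX := smooth_at_fstX j.+1 z.
rewrite (deriveM (f := Pi)); last 2 first.
- exact/smooth_at_derivable/sP.
- by apply: smooth_at_derivable; exact: smooth_atV.
rewrite (deriveV (f := fun z : R * Q => z.1 ^+ j.+1))//; last exact: smooth_at_derivable.
rewrite derive_fstX (derive_split _ (sP _ Bz)) DP//.
rewrite /moment (negPf z0) /next_primitive /GRing.scale/=.
have := X0 j; rewrite !exprS; move: (_ ^+ j) => p p0.
field; by rewrite z0 p0.
Qed.

Lemma slice_moment_off j Pi K s q : primitive_pair j Pi K -> B (s, q) -> s != 0 ->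
  is_derive s 1 (fun s => moment j Pi K (s, q))
    (moment j.+1 (next_primitive j Pi K) (D K) (s, q)).
Proof.
move=> PK Bz s0; have [sP sK P0 DP] := PK.
have := @slice_is_derive _ _ _ (moment j Pi K) s q
  (smooth_at_derivable (smooth_at_moment j K (sP _ Bz) s0)).
rewrite (derive_moment_off _ PK Bz s0)/= mul1r.
rewrite [X in _ + X](_ : _ = 0) ?addr0//.
by rewrite /moment/= (negPf s0) derive0 mul0r.
Qed.

Lemma moment_continuous j Pi K z : primitive_pair j Pi K -> B z ->
  {for z, continuous (moment j Pi K)}.
Proof.
move=> PK Bz; have [sP sK P0 DP] := PK.
have [z0|z0] := eqVneq z.1 0; last first.
  by apply: smooth_at_continuous; apply: smooth_at_moment => //; exact: sP.
case: z => s q /= in Bz z0 *; rewrite {}z0 in Bz *.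
apply/cvgrPdist_le => e e0.
have cK := smooth_at_continuous (sK _ Bz).
have /cvgrPdist_le/(_ _ e0) nK := cK.
have nB : \forall y \near ((0 : R), q), B y by exact: open_nbhs_nbhs.
have /near_pair_box[d d0 hd] := near_and nB nK.
apply: (near_box_pair d0) => s' q' bs bq.
have [Bz' _] := hd _ _ bs bq.
have [c cs ->] := moment_mean PK Bz'.
rewrite /moment/= eqxx -mulrBl normrM [`|_^-1|]gtr0_norm ?invr_gt0//.
rewrite ler_pdivrMr//.
have [|_ h] := hd c q' _ bq.
  by move: bs; rewrite -!ball_normE/= !sub0r !normrN; exact: le_lt_trans.
by apply: (le_trans h); rewrite ler_peMr ?ler1n// ltW.
Qed.

(** Differentiability at the end point 0 is still to be proved, so [MVT] is applied with continuity
    alone at that end. *)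
Lemma moment_increment j Pi K s q : primitive_pair j Pi K -> B (s, q) ->
  exists2 c, `|c| <= `|s| & moment j Pi K (s, q) - moment j Pi K (0, q) =
    s * moment j.+1 (next_primitive j Pi K) (D K) (c, q).
Proof.
move=> PK Bz; set T := moment j Pi K; set T' := moment _ _ _.
have cT (t : R) : `|t| <= `|s| -> {for t, continuous (fun t => T (t, q))}.
  move=> ts; apply: (@continuous_comp _ _ _ (fun t => (t, q)) T).
    by apply: (@continuous_pair _ _ _ _ id (fun=> q)); [exact: cvg_id|exact: cvg_cst].
  by apply: (moment_continuous PK); exact: box_scale ts.
have dT (t : R) : `|t| <= `|s| -> t != 0 -> is_derive t 1 (fun t => T (t, q)) (T' (t, q)).
  by move=> ts t0; apply: slice_moment_off => //; exact: box_scale ts.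
have [sn|sp|->] := ltgtP s 0; last by exists 0; rewrite ?subrr ?mul0r.
- have [||c] := @MVT R (fun t => T (t, q)) (fun t => T' (t, q)) s 0 sn.
  + move=> t; rewrite in_itv/= => /andP[t1 t2]; apply: dT; last by rewrite lt_eqF.
    by rewrite !ltr0_norm ?lerN2 ?ltW.
  + apply: continuous_in_subspaceT => t; rewrite inE/= in_itv/= => /andP[t1 t2].
    by have sn' := ltW sn; apply: cT; rewrite !ler0_norm ?lerN2.
  + rewrite in_itv/= => /andP[c1 c2] E; exists c.
      by rewrite !ltr0_norm ?lerN2 ?ltW.
    by rewrite -opprB E sub0r mulrN opprK mulrC.
- have [||c] := @MVT R (fun t => T (t, q)) (fun t => T' (t, q)) 0 s sp.
  + move=> t; rewrite in_itv/= => /andP[t1 t2]; apply: dT; last by rewrite gt_eqF.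
    by rewrite !gtr0_norm// ltW.
  + apply: continuous_in_subspaceT => t; rewrite inE/= in_itv/= => /andP[t1 t2].
    by have sp' := ltW sp; apply: cT; rewrite !ger0_norm.
  + rewrite in_itv/= => /andP[c1 c2] E; exists c.
      by rewrite !gtr0_norm// ltW.
    by rewrite E subr0 mulrC.
Qed.

(** At [s = 0] the quotient formula is of no help. The increment is split into a move along [s],
    governed by the next moment and its continuity, and a move along [Q] inside [s = 0], where the
    moment is [K / j.+1]. *)
Lemma diff_moment0 j Pi K q : primitive_pair j Pi K -> B (0, q) ->
  differentiable (moment j Pi K) (0, q) /\
  'd (moment j Pi K) (0, q) = (fun w : R * Q =>
     w.1 * (D K (0, q) / j.+2%:R) + 'd K (0, q) (0, w.2) / j.+1%:R) :> (R * Q -> R).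
Proof.
move=> PK Bz; have [sP sK P0 DP] := PK.
have dK : differentiable K (0, q) by exact/smooth_at_differentiable/sK.
pose A2 (w : R * Q) : R * Q := (0, w.2).
have [lA cA] : clinear A2.
  by apply: clinear_pair; [exact: clinear_cst0|exact/clinear_snd/clinear_id].
have cf : continuous (fun w : R * Q => w.1).
  by move=> w; apply: smooth_at_continuous; exact: smooth_at_fst.
have cdK : continuous ('d K (0, q)) by exact: diff_continuous.
apply: differentiable_eps.
- move=> a x y /=.
  have := lA a x y; rewrite /A2 => ->; rewrite linearD linearZ /GRing.scale/=.
  by rewrite !mulrDl !mulrDr !mulrA addrACA.
- move=> w; apply: smooth_at_continuous; apply: smooth_atD.
    by apply: smooth_atM; [exact: smooth_at_fst|exact: smooth_at_cst].
  apply: smooth_atM; last exact: smooth_at_cst.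
  apply: smooth_at_clinear; split => [a x y|x].
    by have := lA a x y; rewrite /A2 => ->; rewrite linearD linearZ.
  by apply: (@continuous_comp _ _ _ A2 ('d K (0, q))); [exact: cA|exact: cdK].
move=> e e0; have e2 : 0 < e / 2 by rewrite divr_gt0.
set M0 := D K _ / _.
have cM := moment_continuous (next_primitiveP PK) Bz.
have /cvgrPdist_le/(_ _ e2) nM := cM.
have nB : \forall y \near ((0 : R), q), B y by exact: open_nbhs_nbhs.
have nK := differentiable_le_eps dK e2.
have /near_pair_box[d d0 hd] := near_and nB (near_and nM nK).
apply: (near_box_pair d0) => s q' bs bq.
have [Bz' _] := hd _ _ bs bq.
have [c cs E] := moment_increment PK Bz'.
have b0 : ball (0 : R) d 0 by exact: ballxx.
have [_ [_ hK]] := hd _ _ b0 bq.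
have [|_ [hM _]] := hd c q' _ bq.
  by move: bs; rewrite -!ball_normE/= !sub0r !normrN; exact: le_lt_trans.
rewrite (_ : moment _ _ _ _ =
  s * moment j.+1 (next_primitive j Pi K) (D K) (c, q') + K (0, q') / j.+1%:R); last first.
  by rewrite -E /moment/= eqxx subrK.
rewrite {2}/moment/= eqxx subr0.
move: hM; rewrite {1}/moment/= eqxx -/M0.
set m := moment _ _ _ _ => hM.
have -> : (s, q') - (0, q) = (s, q' - q) by apply: injective_projections; rewrite /= ?subr0.
move: hK; have -> : (0 : R, q') - (0, q) = (0, q' - q).
  by apply: injective_projections; rewrite /= ?subr0.
rewrite /= !prod_normE/= normr0 (max_idPr (normr_ge0 _)).
set h := `|q' - q|; set a := K _; set b := K _; set dk := 'd K _ _ => hK.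
have n1 : (j.+1%:R : R)^-1 <= 1 by rewrite invf_le1 ?ler1n.
have n0 : 0 < (j.+1%:R : R)^-1 by rewrite invr_gt0.
have -> : s * m + a / j.+1%:R - b / j.+1%:R - (s * M0 + dk / j.+1%:R) =
  - (s * (M0 - m)) + (a - b - dk) * j.+1%:R^-1 by ring.
apply: (le_trans (ler_normD _ _)); rewrite normrN !normrM (gtr0_norm n0).
have [h1 h2] : `|s| <= Num.max `|s| h /\ h <= Num.max `|s| h by rewrite !le_max !lexx orbT.
apply: (@le_trans _ _ (Num.max `|s| h * (e / 2) + e / 2 * Num.max `|s| h)); last first.
  by rewrite [X in X + _]mulrC -mulrDl -splitr.
apply: lerD; first by rewrite ler_pM.
apply: (@le_trans _ _ (e / 2 * h * 1)); first by rewrite ler_pM// ltW.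
by rewrite mulr1 ler_pM2l.
Qed.

Lemma derive_moment j Pi K z w : primitive_pair j Pi K -> B z ->
  differentiable (moment j Pi K) z /\
  'D_w (moment j Pi K) z = w.1 * moment j.+1 (next_primitive j Pi K) (D K) z
    + moment j ('D_(0, w.2) Pi) ('D_(0, w.2) K) z.
Proof.
move=> PK Bz; have [sP sK P0 DP] := PK.
have [z0|z0] := eqVneq z.1 0; last first.
  split; last exact: derive_moment_off.
  by apply: smooth_at_differentiable; apply: smooth_at_moment => //; exact: sP.
case: z => s q /= in Bz z0 *; rewrite {}z0 in Bz *.
have [dM E] := diff_moment0 PK Bz; split => //.
rewrite deriveE// E /moment/= eqxx; congr (_ + _ / _).
by rewrite deriveE//; exact/smooth_at_differentiable/sK.
Qed.

(** Moments are closed under differentiation: along [s] the index rises by one, along [Q] the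
    derivative passes to the pair. Continuity of all moments therefore gives every order. *)
Lemma Ck_on_moment k j Pi K : primitive_pair j Pi K -> Ck_on B k (moment j Pi K).
Proof.
elim: k j Pi K => [|k IH] j Pi K PK; first by move=> z; exact: moment_continuous.
split; first by move=> z /(derive_moment 0 PK)[].
move=> w.
apply: (@Ck_on_eq _ _ _ _ _ (fun z => cst w.1 z * moment j.+1 (next_primitive j Pi K) (D K) z
    + moment j ('D_(0, w.2) Pi) ('D_(0, w.2) K) z)) => //.
  by move=> z /(derive_moment w PK)[_ ->].
apply: Ck_onD => //; last by apply/IH/derive_primitive_pair.
by apply: Ck_onM => //; [exact: Ck_on_cst|exact/IH/next_primitiveP].
Qed.

End Hadamard.

Section HadamardLemma.
Context {R : realType} (Q : normedModType R).
Implicit Types (F : R * Q -> R).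

Theorem hadamard F (q0 : Q) : smooth_at F (0, q0) ->
  (\forall q \near q0, F (0, q) = 0) ->
  exists H : R * Q -> R, [/\ smooth_at H (0, q0),
    \forall z \near (0, q0), F z = z.1 * H z &
    \forall q \near q0, H (0, q) = 'D_(1, 0) F (0, q)].
Proof.
move=> sF F0; have sF' := smooth_at_near sF.
have /nbhs_ballP[d1 /= d10 h1] := F0.
have /near_pair_box[d2 d20 h2] := sF'.
pose r := Num.min d1 d2.
have r0 : 0 < r by rewrite lt_min d10.
have le1 : r <= d1 by rewrite ge_min lexx.
have le2 : r <= d2 by rewrite ge_min lexx orbT.
(* For [j = 0], [F] is itself the primitive of its derivative, and the moment is [F] divided by the
   real variable. *)
have PK : primitive_pair q0 r 0 F ('D_((1, 0) : R * Q) F).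
  split.
  - by move=> [s q] [/= bs bq]; apply: h2; [exact: le_ball bs|exact: le_ball bq].
  - move=> [s q] [/= bs bq]; apply: smooth_at_derive.
    by apply: h2; [exact: le_ball bs|exact: le_ball bq].
  - by move=> q [/= _ bq]; apply: h1; exact: le_ball bq.
  - by move=> z _; rewrite expr0 mul1r.
have Bq0 : ball ((0 : R), q0) r ((0 : R), q0) by exact: ballxx.
exists (moment 0 F ('D_((1, 0) : R * Q) F)); split.
- exists (ball ((0 : R), q0) r); split => //; first exact: ball_open.
  by move=> k; exact: Ck_on_moment.
- apply: (near_box_pair r0) => s q bs bq.
  rewrite /moment/=; case: eqVneq => [->|s0]; last by rewrite expr1 mulrC divfK.
  by rewrite mul0r; apply: h1; exact: le_ball bq.
- by apply: nearW => q; rewrite /moment/= eqxx divr1.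
Qed.

(** Two successive divisions. The last clause, obtained by differentiating [z.1 * L z], lets a
    nonzero second derivative pass to [H]. *)
Theorem hadamard2 F (q0 : Q) : smooth_at F (0, q0) ->
  (\forall q \near q0, F (0, q) = 0) ->
  (\forall q \near q0, 'D_(1, 0) F (0, q) = 0) ->
  exists H : R * Q -> R, [/\ smooth_at H (0, q0),
    \forall z \near (0, q0), F z = z.1 ^+ 2 * H z &
    'D_(1, 0) ('D_(1, 0) F) (0, q0) = H (0, q0) *+ 2].
Proof.
move=> sF F0 dF0; have [L [sL FL L0]] := hadamard sF F0.
have L00 : \forall q \near q0, L (0, q) = 0.
  by apply: filterS2 L0 dF0 => q -> ->.
have [H [sH LH H0]] := hadamard sL L00.
exists H; split => //.
  by apply: filterS2 FL LH => z -> ->; rewrite mulrA.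
have DM (K : R * Q -> R) z : smooth_at K z ->
    'D_(1, 0) (fun z : R * Q => z.1 * K z) z = K z + z.1 * 'D_(1, 0) K z.
  by move=> sK; have := D_fstXM 1 sK; rewrite mul1r mul1r.
have DF : \forall z \near ((0 : R), q0),
    L z + z.1 * 'D_(1, 0) L z = 'D_(1, 0) F z.
  apply: filterS2 (near_join FL) (smooth_at_near sL) => z FLz sLz.
  by rewrite -DM//; apply: near_eq_derive; apply: filterS FLz => y ->.
have sDL := smooth_at_derive ((1, 0) : R * Q) sL.
rewrite -(near_eq_derive _ DF) (deriveD (f := L)); last 2 first.
- exact: smooth_at_derivable.
- by apply: smooth_at_derivable; apply: smooth_atM => //; exact: smooth_at_fst.
rewrite DM//= mul0r addr0 -mulr2n; congr (_ *+ 2).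
have LH' : \forall z \near ((0 : R), q0), L z = z.1 * H z by [].
by rewrite (near_eq_derive _ LH') DM//= mul0r addr0.
Qed.
End HadamardLemma.

(** * Bump functions and compactness *)

Section Bump.
Context {R : realType}.

(** The powers of [t^-1] make the family stable under differentiation, up to linear combinations. *)
Definition flat_exp n (t : R) : R := if 0 < t then t^-1 ^+ n * expR (- t^-1) else 0.

Lemma flat_exp_ge0 n t : 0 <= flat_exp n t.
Proof.
rewrite /flat_exp; case: ifP => // t0.
by rewrite mulr_ge0 ?expR_ge0// exprn_ge0// invr_ge0 ltW.
Qed.

Lemma expR_ge_pow n (u : R) : 0 < u -> (u / n.+1%:R) ^+ n.+1 <= expR u.
Proof.
move=> u0; have n0 : 0 < n.+1%:R :> R by [].
have -> : expR u = expR (u / n.+1%:R) ^+ n.+1.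
  by rewrite -expRM_natl [_%:R * _]mulrC divfK ?lt0r_neq0.
rewrite lerXn2r ?nnegrE ?expR_ge0 ?divr_ge0 ?ltW//.
by apply: (lt_le_trans _ (expR_ge1Dx _)); rewrite ltrDr.
Qed.

Lemma flat_exp_le n (t : R) : flat_exp n t <= n.+1%:R ^+ n.+1 * `|t|.
Proof.
rewrite /flat_exp; case: ifPn => [t0|_]; last by rewrite mulr_ge0// exprn_ge0.
have u0 : 0 < t^-1 by rewrite invr_gt0.
have := expR_ge_pow n u0; rewrite expr_div_n ler_pdivrMr ?exprn_gt0// => h.
rewrite expRN ler_pdivrMr ?expR_gt0// gtr0_norm//.
rewrite mulrAC [_ * expR _]mulrC -ler_pdivrMr//.
by rewrite -exprSr.
Qed.

Lemma flat_exp_derive n (x : R) :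
  is_derive x 1 (flat_exp n) (flat_exp n.+2 x - n%:R * flat_exp n.+1 x).
Proof.
have [x0|x0|->] := ltgtP x 0.
- have E : \forall y \near x, 0 = flat_exp n y.
    have : \forall y \near x, y < 0 by exact: lt_nbhsl.
    by apply: filterS => y y0; rewrite /flat_exp ltNge ltW.
  apply: (near_eq_is_derive E).
  rewrite {1 2}/flat_exp ltNge (ltW x0)/= mulr0 subrr; exact: is_derive_cst.
- have E : \forall y \near x, y^-1 ^+ n * expR (- y^-1) = flat_exp n y.
    have : \forall y \near x, 0 < y by exact: lt_nbhsr.
    by apply: filterS => y y0; rewrite /flat_exp y0.
  apply: (near_eq_is_derive E).
  have dV : is_derive x 1 (fun y : R => y^-1) (- x ^- 2).
    split; first by apply: derivableV => //; exact: lt0r_neq0.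
    by rewrite deriveV ?lt0r_neq0// derive_id /GRing.scale/= mulr1.
  have dVN : is_derive x 1 (fun y : R => - y^-1) (x ^- 2).
    by rewrite -[X in is_derive _ _ _ X]opprK; exact: is_deriveN.
  have de : is_derive x 1 (fun y : R => expR (- y^-1)) (x ^- 2 * expR (- x^-1)).
    have dE : is_derive (- x^-1) 1 (@expR R) (expR (- x^-1)) by exact: is_derive_expR.
    rewrite mulrC.
    exact: (@is_derive1_comp R expR (fun y => - y^-1) x _ _ dE dVN).
  have dX : is_derive x 1 (fun y : R => y^-1 ^+ n) (n%:R * x^-1 ^+ n.-1 * - x ^- 2).
    have dn : is_derive x^-1 1 (fun t : R => t ^+ n) (n%:R * x^-1 ^+ n.-1).
      by split; [exact: exprn_derivable|rewrite exp_derive /GRing.scale/= mulr1].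
    exact: (@is_derive1_comp R (fun t : R => t ^+ n) (fun y => y^-1) x _ _ dn dV).
  have := is_deriveM dX de.
  rewrite /flat_exp x0 /GRing.scale/= => h; apply: is_derive_eq h _.
  rewrite -!exprVn; case: (n) => [|m].
    by rewrite !mul0r mulr0 subr0 addr0 expr0 mul1r.
  by rewrite /= !exprS; ring.
- have -> : flat_exp n.+2 0 - n%:R * flat_exp n.+1 0 = 0 by rewrite /flat_exp ltxx mulr0 subrr.
  have [||e e0|d E] := @differentiable_eps R R R (flat_exp n) (fun=> 0) 0.
  + by move=> a u v; rewrite /= scaler0 addr0.
  + by move=> u; exact: cst_continuous.
  (* For [y > 0], [flat_exp n y = flat_exp n.+1 y * y], so the linear bound at index [n.+1] becomes
     the quadratic bound [C * y ^+ 2], and the derivative at 0 is 0. *)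
  + pose C : R := n.+2%:R ^+ n.+2.
    have C0 : 0 < C by rewrite exprn_gt0.
    have : \forall y \near (0 : R), `|y| <= e / C.
      by apply/nbhs0_le; rewrite divr_gt0.
    apply: filterS => y ye; rewrite {2}/flat_exp ltxx !subr0.
    rewrite ger0_norm ?flat_exp_ge0//.
    have [y0|y0] := ltP 0 y; last by rewrite /flat_exp ltNge y0/= mulr_ge0// ltW.
    rewrite (_ : flat_exp n y = flat_exp n.+1 y * y).
      rewrite (gtr0_norm y0) ler_pM2r//; apply: (le_trans (flat_exp_le _ _)).
      by rewrite -ler_pdivlMl// mulrC.
    by rewrite /flat_exp y0 exprS; field; exact: lt0r_neq0.
  + by split; [exact: diff_derivable|rewrite deriveE// E].
Qed.

Lemma derive_real (f : R -> R) x v : derivable f x 1 -> 'D_v f x = v * 'D_1 f x.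
Proof.
move=> /derivable1_diffP df; rewrite !deriveE//.
by rewrite -{1}[v]mulr1 -[_ * 1]/(v *: (1 : R)) linearZ.
Qed.

Lemma Ck_on_flat_exp k n (U : set R) : open U -> Ck_on U k (flat_exp n).
Proof.
move=> oU; elim: k n => [|k IH] n.
  move=> x _; apply/differentiable_continuous/derivable1_diffP.
  by have [] := flat_exp_derive n x.
split => [x _|v]; first by apply/derivable1_diffP; have [] := flat_exp_derive n x.
apply: (@Ck_on_eq _ _ _ _ _ (fun x => cst v x *
    (flat_exp n.+2 x + cst (- n%:R) x * flat_exp n.+1 x))) => //.
  move=> x _; have [d1 d2] := flat_exp_derive n x.
  by rewrite derive_real// d2 /cst mulNr.
apply: Ck_onM => //; first exact: Ck_on_cst.
by apply: Ck_onD => //; apply: Ck_onM => //; exact: Ck_on_cst.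
Qed.

Lemma smooth_at_flat_exp n x : smooth_at (flat_exp n) x.
Proof.
by exists setT; split => // [|k]; [exact: openT|exact/Ck_on_flat_exp/openT].
Qed.

Theorem bump_function : exists b : R -> R, [/\ forall x, smooth_at b x,
  forall x, `|x| <= 1 -> b x = 1 & forall x, 2 <= `|x| -> b x = 0].
Proof.
pose f : R -> R := flat_exp 0.
have f0 x : x <= 0 -> f x = 0 by move=> x0; rewrite /f /flat_exp ltNge x0.
have fp x : 0 < x -> 0 < f x.
  by move=> x0; rewrite /f /flat_exp x0 expr0 mul1r expR_gt0.
have fge x : 0 <= f x by exact: flat_exp_ge0.
have sid (x : R) : smooth_at (@id R) x by apply: smooth_at_clinear; exact: clinear_id.
have ssq (x : R) : smooth_at (fun x : R => x * x) x by exact: smooth_atM.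
have s1 (x : R) : smooth_at (fun x : R => f (4 - x * x)) x.
  apply: (smooth_at_comp_real (f := f)); first exact: smooth_at_flat_exp.
  by apply: smooth_atB => //; exact: smooth_at_cst.
have s2 (x : R) : smooth_at (fun x : R => f (x * x - 1)) x.
  apply: (smooth_at_comp_real (f := f)); first exact: smooth_at_flat_exp.
  by apply: smooth_atB => //; exact: smooth_at_cst.
have sqE (x : R) : x * x = `|x| * `|x| by rewrite -normrM ger0_norm// -expr2 sqr_ge0.
(* Either [x * x < 4] or [x * x > 1], so one of the two terms is positive. *)
have den (x : R) : 0 < f (4 - x * x) + f (x * x - 1).
  have [h|h] := ltP (x * x) 4.
    by rewrite ltr_wpDr// fp// subr_gt0.
  by rewrite ltr_wpDl// fp//; lra.
exists (fun x => f (4 - x * x) * (f (4 - x * x) + f (x * x - 1))^-1); split.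
- move=> x; apply: smooth_atM => //; apply: smooth_atV; first exact: lt0r_neq0.
  exact: smooth_atD.
- move=> x x1; have h : x * x - 1 <= 0 by rewrite sqE subr_le0 mulr_ile1.
  by have := den x; rewrite (f0 _ h) addr0 => d; rewrite divff// lt0r_neq0.
- by move=> x x2; rewrite (f0 (4 - _)) ?mul0r// sqE subr_le0 (_ : 4 = 2 * 2) ?ler_pM// -natrM.
Qed.

End Bump.

(** * Uniformity from compactness *)

Section Compactness.
Context {R : realType}.
Implicit Types (V P : normedModType R).

(** Asking for every [r' <= r] is what lets the finitely many local radii be replaced by a common
    one. *)
Lemma compact_small V (K : set V) (Q : R -> V -> Prop) : compact K ->
  (forall x, K x -> exists2 r, 0 < r &
     \forall x' \near x, forall r', 0 < r' <= r -> Q r' x') ->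
  exists2 r, 0 < r & forall x, K x -> Q r x.
Proof.
move=> /compact_near_coveringP cK KQ.
have : \forall i \near (0:R)^'+, K `<=` Q i.
  apply: cK => x /KQ[r r0 nQ].
  exists ([set x' | forall r', 0 < r' <= r -> Q r' x'], [set r' | 0 < r' <= r]) => /=.
    split => //; near=> e; apply/andP; split.
      by near: e; exact: nbhs_right_gt.
    by near: e; exact: nbhs_right_le.
  by move=> [x' r'] /= [h1 h2]; exact: h1.
move=> n; near (0:R)^'+ => r; exists r.
  by near: r; exact: nbhs_right_gt.
by near: r.
Unshelve. all: by end_near. Qed.

(** The tube also covers points [x'] outside [K], as is needed for smoothness on an open
    neighbourhood. Half of a local radius is spent on reaching the point of [K], half on [x']. *)
Lemma compact_tube V P (K : set V) (good : V * P -> Prop) : compact K ->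
  (forall x, K x -> \forall z \near (x, 0), good z) ->
  exists2 r, 0 < r & forall x, K x -> forall x' l,
    ball x r x' -> ball 0 r l -> good (x', l).
Proof.
move=> cK KQ; apply: compact_small => // x /KQ /near_pair_box[r r0 h].
have r2 : 0 < r / 2 by rewrite divr_gt0.
exists (r / 2) => //; apply/nbhs_ballP; exists (r / 2) => // y xy r' /andP[r'0 r'r] x' l yx' l0.
apply: h; last by apply: le_ball l0; rewrite (le_trans r'r)// ler_pdivrMr// ler_peMr ?ler1n// ltW.
rewrite [r]splitr; apply: ball_triangle xy _; exact: le_ball yx'.
Qed.

(** Each covering set meets [S] at most in its centre, so the centres of a finite subcover exhaust
    [S]. *)
Lemma isolated_finite V (K S : set V) : compact K -> S `<=` K ->
  (forall x, K x -> \forall x' \near x, S x' -> x' = x) ->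
  exists s : seq V, forall x, S x <-> x \in s.
Proof.
rewrite compact_cover => cK SK iso.
pose f x := [set x' | S x' -> x' = x]°.
have [||D DK Df] := @cK V K f.
- by move=> i _; exact: open_interior.
- by move=> x Kx; exists x => //; exact: iso.
exists [seq x <- finmap.enum_fset D | `[< S x >]] => x.
rewrite mem_filter; split=> [Sx|/andP[/asboolP]//].
rewrite (asboolT Sx)/=; have [y yD /interior_subset/(_ Sx) ->] := Df _ (SK _ Sx).
exact: yD.
Qed.

Lemma seq_small (T : eqType) (s : seq T) (Q : T -> R -> Prop) :
  (forall x r r', x \in s -> 0 < r' <= r -> Q x r -> Q x r') ->
  (forall x, x \in s -> exists2 r, 0 < r & Q x r) ->
  exists2 r, 0 < r & forall x, x \in s -> Q x r.
Proof.
elim: s => [|x s IH] mon sQ; first by exists 1.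
have [||r r0 hr] := IH; first by move=> y r r' ys; apply: mon; rewrite in_cons ys orbT.
  by move=> y ys; apply: sQ; rewrite in_cons ys orbT.
have [r1 r10 h1] := sQ x (mem_head _ _).
have m0 : 0 < Num.min r r1 by rewrite lt_min r0.
exists (Num.min r r1) => // y; rewrite in_cons => /predU1P[->|ys].
  by apply: mon h1; rewrite ?mem_head// m0 ge_min lexx orbT.
by apply: mon (hr _ ys); rewrite ?in_cons ?ys ?orbT// m0 ge_min lexx.
Qed.

Lemma open_norm_lt (e : R) : open [set u : R | `|u| < e].
Proof.
have : open ((fun u : R => `|u|) @^-1` [set u : R | u < e]); last exact.
by apply: open_comp; [move=> x _; exact: norm_continuous|exact: open_lt].
Qed.

Lemma open_norm_gt (e : R) : open [set u : R | e < `|u|].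
Proof.
have : open ((fun u : R => `|u|) @^-1` [set u : R | e < u]); last exact.
by apply: open_comp; [move=> x _; exact: norm_continuous|exact: open_gt].
Qed.

End Compactness.

(** * Gluing reparametrizations of the slow variable *)

Section GlueLevels.
Context {R : realType} (P : normedModType R).
Variables (c d : R) (s : seq R) (Yf : R -> R * P -> R).
Hypotheses (us : uniq s) (scd : forall y, y \in s -> c < y < d).
Hypothesis sYf : forall y, y \in s -> smooth_at (Yf y) (y, 0).
Hypothesis Yf0 : forall y, y \in s -> \forall t \near y, Yf y (t, 0) = t.

(** [Y] is the identity plus, for each level, a cut-off multiple of [Yf y q - q.1]. These
    corrections vanish at parameter 0, so the cut-offs leave [Y (y, 0) = y] intact. *)
Lemma glue_levels : exists Y : R * P -> R,
  [/\ forall y, smooth_at Y (y, 0), forall y, Y (y, 0) = y,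
      forall y, y \in s -> \forall q \near (y, 0), Y q = Yf y q &
      forall y, y = c \/ y = d -> \forall q \near (y, 0), Y q = q.1].
Proof.
have [beta [sb b1 b0]] := @bump_function R.
(* The cut-off has support radius [2 * r]; with data on [3 * r], every [t] either has smooth data or
   has a neighbourhood where the correction vanishes. It also keeps [c] and [d] off the supports. *)
have [||r r0 hr] := @seq_small R _ s (fun y r => forall t, `|t - y| <= 3 * r ->
    [/\ smooth_at (Yf y) (t, 0), Yf y (t, 0) = t & c < t < d]).
- move=> y r r' _ /andP[r'0 r'r] h t ht; apply: h.
  by apply: (le_trans ht); rewrite ler_pM2l.
- move=> y ys.
  have n1 : \forall t \near y, smooth_at (Yf y) (t, 0).
    have ct : {for y, continuous (fun t : R => (t, 0 : P))}.
      by apply: clinear_continuous; apply: clinear_pair; [exact: clinear_id|exact: clinear_cst0].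
    exact: (near_comp ct (smooth_at_near (sYf ys))).
  have n2 : \forall t \near y, c < t < d.
    have [cy yd] := andP (scd ys).
    by have := near_and (lt_nbhsr cy) (lt_nbhsl yd); apply: filterS => t [-> ->].
  have /nbhs_ballP[r /= r0 h] := near_and n1 (near_and (Yf0 ys) n2).
  exists (r / 4); first by rewrite divr_gt0.
  move=> t ht; have [|h1 [h2 h3]] := h t; last by split.
  by rewrite -ball_normE/= distrC; apply: (le_lt_trans ht); lra.
(* At distance [4 * r], supports of radius [2 * r] around different levels do not overlap. *)
have [||r' r'0 hr'] := @seq_small R _ s (fun y r => forall y', y' \in s -> y' != y ->
    4 * r <= `|y' - y|).
- move=> y r1 r2 _ /andP[r20 r21] h y' y's /(h _ y's); apply: le_trans.
  by rewrite ler_pM2l.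
- move=> y ys; apply: seq_small.
    move=> y' r1 r2 _ /andP[r20 r21] h /h; apply: le_trans.
    by rewrite ler_pM2l.
  move=> y' y's; case: (eqVneq y' y) => [->|ne]; first by exists 1.
  exists (`|y' - y| / 4); first by rewrite divr_gt0// normr_gt0 subr_eq0.
  by move=> _; rewrite mulrC divfK.
pose e := Num.min r r'.
have e0 : 0 < e by rewrite lt_min r0.
have er : e <= r by rewrite ge_min lexx.
have er' : e <= r' by rewrite ge_min lexx orbT.
have {}hr y t : y \in s -> `|t - y| <= 3 * e ->
    [/\ smooth_at (Yf y) (t, 0), Yf y (t, 0) = t & c < t < d].
  by move=> ys ht; apply: hr => //; apply: (le_trans ht); rewrite ler_pM2l.
have {}hr' y y' : y \in s -> y' \in s -> y' != y -> 4 * e <= `|y' - y|.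
  by move=> ys y's ne; apply: le_trans (hr' _ ys _ y's ne); rewrite ler_pM2l.
pose B y (q : R * P) := beta ((q.1 - y) / e).
have nB0 y t : 2 * e < `|t - y| -> \forall q \near (t, (0 : P)), B y q = 0.
  move=> ht.
  have sq : smooth_at (fun q : R * P => q.1 - y) (t, 0).
    by apply: smooth_atB; [exact/smooth_at_clinear/clinear_fst/clinear_id|exact: smooth_at_cst].
  have := smooth_at_near_open sq (@open_norm_gt R (2 * e)) ht; apply: filterS => q /= hq.
  by rewrite /B b0// normrM normfV (gtr0_norm e0) ler_pdivlMr// ltW.
have sB y t : smooth_at (B y) (t, 0).
  apply: (smooth_at_comp_real (f := beta)) => //.
  apply: smooth_atM; last exact: smooth_at_cst.
  by apply: smooth_atB; [exact/smooth_at_clinear/clinear_fst/clinear_id|exact: smooth_at_cst].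
have sfst t : smooth_at (fun q : R * P => q.1) (t, 0).
  exact/smooth_at_clinear/clinear_fst/clinear_id.
pose T y (q : R * P) := B y q * (Yf y q - q.1).
have nT0 y t : 2 * e < `|t - y| -> \forall q \near (t, (0 : P)), T y q = 0.
  by move=> /nB0; apply: filterS => q h; rewrite /T h mul0r.
have sT y t : y \in s -> smooth_at (T y) (t, 0).
  move=> ys; case: (leP `|t - y| (3 * e)) => ht.
    by have [h _ _] := hr _ _ ys ht; apply: smooth_atM => //; exact: smooth_atB.
  have ht2 : 2 * e < `|t - y| by apply: le_lt_trans ht; rewrite ler_pM2r// ler_nat.
  by apply: smooth_at_eq (smooth_at_cst (0 : R) _); apply: filterS (nT0 _ _ ht2) => q ->.
have nsum t (u : seq R) : {subset u <= s} -> (forall y, y \in u -> 2 * e < `|t - y|) ->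
    \forall q \near (t, (0 : P)), \sum_(y <- u) T y q = 0.
  elim: u => [|y u IH] us' hu.
    by apply: filterS filterT => q _; rewrite big_nil.
  have n1 : \forall q \near (t, (0 : P)), \sum_(y <- u) T y q = 0.
    apply: IH; first by move=> z zu; apply: us'; rewrite in_cons zu orbT.
    by move=> z zu; apply: hu; rewrite in_cons zu orbT.
  have := near_and n1 (nT0 _ _ (hu _ (mem_head _ _))); apply: filterS => q [h1 h2].
  by rewrite big_cons h1 h2 addr0.
exists (fun q => q.1 + \sum_(y <- s) T y q); split.
- move=> t; apply: smooth_atD => //.
  have : {subset s <= s} by [].
  elim: {1 3}s => [|y u IH] us'.
    by apply: smooth_at_ext (smooth_at_cst (0 : R) _) => q; rewrite big_nil.
  have sy : smooth_at (T y) (t, 0) by apply: sT; apply: us'; exact: mem_head.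
  have {}IH := IH (fun z zu => us' z (mem_behead (s := y :: u) zu)).
  by apply: smooth_at_ext (smooth_atD sy IH) => q; rewrite big_cons.
- move=> t /=; rewrite big_seq big1 ?addr0// => y ys; rewrite /T.
  case: (leP `|t - y| (3 * e)) => ht.
    by have [_ -> _] := hr _ _ ys ht; rewrite subrr mulr0.
  rewrite /B b0 ?mul0r//= normrM normfV (gtr0_norm e0) ler_pdivlMr//.
  by apply: le_trans (ltW ht); rewrite ler_pM2r// ler_nat.
- move=> y ys.
  have n1 : \forall q \near (y, (0 : P)), \sum_(y' <- rem y s) T y' q = 0.
    apply: nsum; first exact: mem_rem.
    move=> y'; rewrite mem_rem_uniq// inE => /andP[/= ne y's].
    rewrite distrC; apply: lt_le_trans (hr' _ _ ys y's ne).
    by rewrite ltr_pM2r// ltr_nat.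
  have n2 : \forall q \near (y, (0 : P)), B y q = 1.
    have sq : smooth_at (fun q : R * P => q.1 - y) (y, 0).
      by apply: smooth_atB => //; exact: smooth_at_cst.
    have h0 : [set u : R | `|u| < e] ((y, (0 : P)).1 - y) by rewrite /= subrr normr0.
    have := smooth_at_near_open sq (@open_norm_lt R e) h0; apply: filterS => q /= hq.
    by rewrite /B b1// normrM normfV (gtr0_norm e0) ler_pdivrMr// mul1r ltW.
  have := near_and n1 n2; apply: filterS => q [h1 h2].
  by rewrite (perm_big _ (perm_to_rem ys)) big_cons h1 Monoid.mulm1 /T h2 mul1r addrC subrK.
- move=> t tcd.
  have n1 : \forall q \near (t, (0 : P)), \sum_(y' <- s) T y' q = 0.
    apply: nsum => // y ys; rewrite ltNge; apply/negP => ht.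
    have [|_ _] := hr y t ys; first by apply: (le_trans ht); rewrite ler_pM2r// ler_nat.
    by case: tcd => ->; rewrite ltxx ?andbF.
  by apply: filterS n1 => q h; rewrite h addr0.
Qed.

End GlueLevels.

(** * Charts near the critical set *)

Section LocalCharts.
Context {R : realType} (P : normedModType R).
Variables (F : R * R * P -> R) (x0 y0 : R).

Let ex : R * R * P := ((1, 0), 0).
Let ey : R * R * P := ((0, 1), 0).
Let Fx : R * R * P -> R := 'D_ex F.
Let Fxx : R * R * P -> R := 'D_ex Fx.
Let Fy : R * R * P -> R := 'D_ey F.
Let p0 : R * R * P := ((x0, y0), 0).
(** The implicit function theorem and Hadamard's lemma single out one real variable, here [x], with
    [Q] equal to [R * P]. *)
Let asc (z : R * (R * P)) : R * R * P := ((z.1, z.2.1), z.2.2).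

Hypothesis sF : smooth_at F p0.

Let clin_asc : clinear asc.
Proof.
have id1 := clinear_id (R * (R * P))%type.
apply: clinear_pair; first apply: clinear_pair.
- exact: clinear_fst.
- exact/clinear_fst/clinear_snd.
- exact/clinear_snd/clinear_snd.
Qed.

Let sFx : smooth_at Fx p0. Proof. exact: smooth_at_derive. Qed.
Let sFxx : smooth_at Fxx p0. Proof. exact: smooth_at_derive. Qed.

Let derive_asc (K : R * R * P -> R) z : 'D_(1, 0) (K \o asc) z = 'D_ex K (asc z).
Proof.
have E (h : R) : asc (h *: (1, 0) + z) = h *: ex + asc z.
  by rewrite /asc /ex; congr pair; rewrite /= ?scaler0 ?add0r//; congr pair;
    rewrite /= scaler0 add0r.
by have [_ ->] := @derive_affine _ _ _ _ K asc z (1, 0) ex E.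
Qed.

Lemma critical_point : Fx p0 = 0 -> Fxx p0 != 0 ->
  exists xs : R * P -> R, [/\ smooth_at xs (y0, 0), xs (y0, 0) = x0,
    \forall q \near (y0, 0), Fx ((xs q, q.1), q.2) = 0 &
    \forall z \near p0, Fx z = 0 -> z.1.1 = xs (z.1.2, z.2)].
Proof.
move=> Fx0 Fxx0.
have sG : smooth_at (Fx \o asc) (x0, (y0, 0)) by exact: smooth_at_comp_clinear.
have [|xs [sxs xs0 h1 h2]] := smooth_implicit sG Fx0; first by rewrite derive_asc.
exists xs; split => //.
pose c (z : R * R * P) := (z.1.1, (z.1.2, z.2)).
have cc : {for p0, continuous c}.
  have id1 := clinear_id (R * R * P)%type.
  apply: clinear_continuous; apply: clinear_pair; first exact/clinear_fst/clinear_fst.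
  by apply: clinear_pair; [exact/clinear_snd/clinear_fst|exact: clinear_snd].
by have := near_comp cc h2; apply: filterS => -[[x y] l].
Qed.

Section Fold.
Hypotheses (F0 : F p0 = 0) (Fx0 : Fx p0 = 0) (Fxx0 : Fxx p0 != 0) (Fy0 : Fy p0 != 0).
Variable xs : R * P -> R.
Hypotheses (sxs : smooth_at xs (y0, 0)) (xs0 : xs (y0, 0) = x0).
Hypothesis xs_crit : \forall q \near (y0, 0), Fx ((xs q, q.1), q.2) = 0.
Hypothesis xs_uniq : \forall z \near p0, Fx z = 0 -> z.1.1 = xs (z.1.2, z.2).

Definition critical_value (q : R * P) : R := F ((xs q, q.1), q.2).
Local Notation c := critical_value.

Let E1 (q : R * P) : ((0 : R, q.1), q.2) + xs q *: ex + (0 : R) *: (0 : R * R * P)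
  = ((xs q, q.1), q.2).
Proof.
rewrite /ex; congr pair; rewrite /= ?scaler0 ?addr0//.
by congr pair; rewrite /= ?scaler0 ?addr0// add0r /GRing.scale/= mulr1.
Qed.

Let clinE1 : clinear (fun q : R * P => ((0 : R, q.1), q.2)).
Proof.
have id1 := clinear_id (R * P)%type.
apply: clinear_pair; last exact: clinear_snd.
by apply: clinear_pair; [exact: clinear_cst0|exact: clinear_fst].
Qed.

Lemma smooth_at_critical_value : smooth_at c (y0, 0).
Proof.
have := @smooth_at_comp _ _ _ F (fun q : R * P => ((0 : R, q.1), q.2)) xs (fun=> 0)
  ex 0 (y0, 0) clinE1.
rewrite E1 /= xs0 => /(_ sF sxs (smooth_at_cst _ _)).
by apply: smooth_at_ext => q; rewrite E1.
Qed.

(** Envelope argument: the variation of [xs] is multiplied by [Fx p0 = 0]. *)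
Lemma critical_value_derive : 'D_(1, 0) c (y0, 0) = Fy p0.
Proof.
have [lA cA] := clinE1.
have := @derive_comp _ _ _ F _ xs (fun=> 0) ex 0 (y0, 0) lA cA
  (smooth_at_differentiable sxs) (differentiable_cst _ _).
rewrite E1 /= xs0 => /(_ (smooth_at_differentiable sF))[_ /(_ (1, 0))].
rewrite (_ : (fun _ => _) = c); last by apply/funext => q; rewrite E1.
by move=> ->; rewrite -/(Fx _) Fx0 derive_cst mulr0 mul0r !addr0.
Qed.

(* [c] has nonzero [y]-derivative at a fold, so critical values can be matched
   by reparametrizing the slow variable. *)
Lemma critical_level : exists Y : R * P -> R,
  [/\ smooth_at Y (y0, 0), Y (y0, 0) = y0,
    \forall q \near (y0, 0), c (Y q, q.2) = c (q.1, 0),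
    \forall y \near y0, Y (y, 0) = y &
    \forall p \near (x0, y0), F (p, 0) = 0 -> Fx (p, 0) = 0 -> p = (x0, y0)].
Proof.
have sc := smooth_at_critical_value.
pose A1 (z : R * (R * P)) : R * P := (z.1, z.2.2).
pose A2 (z : R * (R * P)) : R * P := (z.2.1, 0).
have id1 := clinear_id (R * (R * P))%type.
have clA1 : clinear A1.
  by apply: clinear_pair; [exact: clinear_fst|exact/clinear_snd/clinear_snd].
have clA2 : clinear A2.
  by apply: clinear_pair; [exact/clinear_fst/clinear_snd|exact: clinear_cst0].
pose G z := c (A1 z) - c (A2 z).
have s1 : smooth_at (fun z => c (A1 z)) (y0, (y0, 0)) by exact: smooth_at_comp_clinear.
have s2 : smooth_at (fun z => c (A2 z)) (y0, (y0, 0)) by exact: smooth_at_comp_clinear.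
have sG : smooth_at G (y0, (y0, 0)) by exact: smooth_atB.
have G0 : G (y0, (y0, 0)) = 0 by rewrite /G subrr.
have DG : 'D_(1, 0) G (y0, (y0, 0)) != 0.
  rewrite /G (deriveB (f := fun z => c (A1 z))); [|exact: smooth_at_derivable..].
  have EA1 (h : R) : A1 (h *: (1, 0) + (y0, (y0, 0))) = h *: (1, 0) + A1 (y0, (y0, 0)).
    by congr pair => /=.
  have EA2 (h : R) : A2 (h *: (1, 0) + (y0, (y0, 0))) = h *: 0 + A2 (y0, (y0, 0)).
    by rewrite scaler0 add0r; congr pair; rewrite /= scaler0 add0r.
  have [_] := @derive_affine _ _ _ _ c A1 _ _ _ EA1; rewrite /comp => ->.
  have [_] := @derive_affine _ _ _ _ c A2 _ _ _ EA2; rewrite /comp => ->.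
  by rewrite derive0 subr0 critical_value_derive.
have [Y [sY Y0 h1 h2]] := smooth_implicit sG G0 DG.
exists Y; split => //.
- by apply: filterS h1 => q /eqP; rewrite subr_eq0 => /eqP.
(* At parameter 0, [y] itself solves the equation, so uniqueness identifies it with [Y (y, 0)]. *)
- pose a (y : R) : R * (R * P) := (y, (y, 0)).
  have ca : {for y0, continuous a}.
    apply: clinear_continuous; apply: clinear_pair; first exact: clinear_id.
    by apply: clinear_pair; [exact: clinear_id|exact: clinear_cst0].
  have := near_comp ca h2; apply: filterS => y /= h.
  by apply/esym/h; rewrite /G /A1 /A2 /= subrr.
(* A nearby fold lies on [xs] and has critical value 0, as at [y0]; the nonzero derivative of the
   critical value then forces its level to be [y0]. *)
- pose a (p : R * R) : R * R * P := (p, 0).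
  pose b (p : R * R) : R * (R * P) := (p.2, (y0, 0)).
  have ca : {for (x0, y0), continuous a}.
    by apply: clinear_continuous; apply: clinear_pair; [exact: clinear_id|exact: clinear_cst0].
  have cb : {for (x0, y0), continuous b}.
    apply: smooth_at_continuous; apply: smooth_at_pair; last exact: smooth_at_cst.
    exact/smooth_at_clinear/clinear_snd/clinear_id.
  have n1 := near_comp ca xs_uniq; have n2 := near_comp cb h2.
  have := near_and n1 n2; apply: filterS => -[x y] /= [hx hy] Fp Fxp.
  have xE := hx Fxp.
  have cy : c (y, 0) = 0 by rewrite /c -xE.
  have c0 : c (y0, 0) = 0 by rewrite /c /= xs0.
  have yE : y = y0 by rewrite hy ?Y0// /G /A1 /A2 /= cy c0 subrr.
  by rewrite xE yE xs0.
Qed.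

Variable Y : R * P -> R.
Hypotheses (sY : smooth_at Y (y0, 0)) (Y0 : Y (y0, 0) = y0).
Hypothesis Yc : \forall q \near (y0, 0), c (Y q, q.2) = c (q.1, 0).

Definition recenter (z : R * (R * P)) : R * R * P :=
  ((xs z.2 + z.1, z.2.1), z.2.2).

Let E2 (z : R * (R * P)) : asc z + xs z.2 *: ex + (0 : R) *: (0 : R * R * P) = recenter z.
Proof.
rewrite /ex /asc /recenter; congr pair; rewrite /= ?scaler0 ?addr0//.
by congr pair; rewrite /= ?scaler0 ?addr0// addrC /GRing.scale/= mulr1.
Qed.

Let sxs2 : smooth_at (fun z : R * (R * P) => xs z.2) (0, (y0, 0)).
Proof.
exact: (smooth_at_comp_clinear (A := snd) (clinear_snd (clinear_id (R * (R * P))%type))).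
Qed.

Let rec0 : recenter (0, (y0, 0)) = p0.
Proof. by rewrite /recenter /= xs0 addr0. Qed.

Let smooth_recenter (K : R * R * P -> R) : smooth_at K p0 ->
  smooth_at (K \o recenter) (0, (y0, 0)).
Proof.
move=> sK; have := @smooth_at_comp _ _ _ K asc (fun z => xs z.2) (fun=> 0) ex 0
  (0, (y0, 0)) clin_asc.
rewrite E2 rec0 => /(_ sK sxs2 (smooth_at_cst _ _)).
by apply: smooth_at_ext => z; rewrite E2.
Qed.

Let derive_recenter (K : R * R * P -> R) z :
  'D_(1, 0) (K \o recenter) z = 'D_ex K (recenter z).
Proof.
have E (h : R) : recenter (h *: (1, 0) + z) = h *: ex + recenter z.
  rewrite /recenter /ex; congr pair; rewrite /= ?scaler0 ?add0r//.
  congr pair; rewrite /= ?scaler0 ?add0r//.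
  by rewrite addrCA.
by have [_ ->] := @derive_affine _ _ _ _ K recenter z (1, 0) ex E.
Qed.

(** After recentring, [F - c] vanishes to second order at [z.1 = 0] for all nearby levels and
    parameters, and [Fxx p0] is twice the quotient at the centre. *)
Lemma fold_normal_form : exists H : R * (R * P) -> R,
  [/\ smooth_at H (0, (y0, 0)), H (0, (y0, 0)) != 0 &
    \forall z \near (0, (y0, 0)), F (recenter z) = c z.2 + z.1 ^+ 2 * H z].
Proof.
have sc := smooth_at_critical_value.
pose G z := F (recenter z) - c z.2.
have s1 : smooth_at (F \o recenter) (0, (y0, 0)) by exact: smooth_recenter.
have s2 : smooth_at (fun z : R * (R * P) => c z.2) (0, (y0, 0)).
  exact: (smooth_at_comp_clinear (A := snd) (clinear_snd (clinear_id (R * (R * P))%type))).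
have sG : smooth_at G (0, (y0, 0)) by exact: smooth_atB.
have DG : \forall z \near (0, (y0, 0)), Fx (recenter z) = 'D_(1, 0) G z.
  have := near_and (smooth_at_near s1) (smooth_at_near s2); apply: filterS => z [s1z s2z].
  rewrite /G (deriveB (f := F \o recenter)); [|exact: smooth_at_derivable..].
  rewrite derive_recenter.
  have E (h : R) : (h *: (1, 0) + z).2 = h *: 0 + z.2 by rewrite /= scaler0.
  have [_] := @derive_affine _ _ _ _ c snd z (1, 0) 0 E; rewrite /comp => ->.
  by rewrite derive0 subr0.
pose a (q : R * P) : R * (R * P) := (0, q).
have ca : {for (y0, 0), continuous a}.
  by apply: clinear_continuous; apply: clinear_pair; [exact: clinear_cst0|exact: clinear_id].
have [||H [sH GH H2]] := hadamard2 sG.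
- have n0 : \forall q \near (y0, (0 : P)), True by exact: filterT.
  by apply: filterS n0 => q _; rewrite /G /recenter /= addr0 subrr.
- have := near_and (near_comp ca DG) xs_crit; apply: filterS => q [<- h].
  by rewrite /recenter /= addr0.
exists H; split => //.
- apply: contra Fxx0 => /eqP h; move: H2; rewrite h mul0rn.
  rewrite -(near_eq_derive _ DG) derive_recenter rec0 => E.
  by apply/eqP.
- by apply: filterS GH => z /eqP; rewrite /G subr_eq addrC => /eqP.
Qed.

(** [Fx] is divisible by [z.1], with quotient [Fxx p0] at the centre. So the sign of [Fx] tells on
    which side of the critical point one is, and thus identifies the branch. *)
Lemma recenter_sg : \forall z \near (0, (y0, 0)),
  Num.sg (Fx (recenter z)) = Num.sg z.1 * Num.sg (Fxx p0).
Proof.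
have sG : smooth_at (Fx \o recenter) (0, (y0, 0)) by exact: smooth_recenter.
have [|L [sL GL L0]] := hadamard sG.
  by apply: filterS xs_crit => q; rewrite /recenter /= addr0.
have LE : L (0, (y0, 0)) = Fxx p0.
  by rewrite (nbhs_singleton L0) derive_recenter rec0.
have L00 : L (0, (y0, 0)) != 0 by rewrite LE.
have := near_and GL (near_sg sL L00); apply: filterS => z [/= -> h].
by rewrite sgrM h LE.
Qed.

(* With [F (xs q + s, q) = c q + s ^+ 2 * H (s, q)] on both sides, [X = xs + s * W]
   where [W ^+ 2 * H (s * W, (Y, l)) = H (s, (y, 0))] is solved for [W] near 1. *)
Lemma fold_chart : exists X : R * R * P -> R,
  [/\ smooth_at X p0, X p0 = x0,
    \forall z \near p0, F ((X z, Y (z.1.2, z.2)), z.2) = F (z.1, 0) &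
    \forall z \near p0, Num.sg (Fx ((X z, Y (z.1.2, z.2)), z.2)) = Num.sg (Fx (z.1, 0))].
Proof.
have [H [sH H0 FH]] := fold_normal_form.
have id1 := clinear_id (R * (R * (R * P)))%type.
pose o : R * (R * (R * P)) := (1, (0, (y0, 0))).
pose A3 (u : R * (R * (R * P))) : R * (R * P) := (u.2.1, (u.2.2.1, 0)).
have clA3 : clinear A3.
  apply: clinear_pair; first exact/clinear_fst/clinear_snd.
  by apply: clinear_pair; [exact/clinear_fst/clinear_snd/clinear_snd|exact: clinear_cst0].
have sw : smooth_at (fun u : R * (R * (R * P)) => u.1) o.
  exact/smooth_at_clinear/clinear_fst.
have ss : smooth_at (fun u : R * (R * (R * P)) => u.2.1) o.
  exact/smooth_at_clinear/clinear_fst/clinear_snd.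
pose H1 (u : R * (R * (R * P))) : R := H (u.2.1 * u.1, (Y u.2.2, u.2.2.2)).
have sYu : smooth_at (fun u : R * (R * (R * P)) => Y u.2.2) o.
  apply: (smooth_at_comp_clinear (A := fun u : R * (R * (R * P)) => u.2.2)) => //.
  exact/clinear_snd/clinear_snd.
have sH1 : smooth_at H1 o.
  apply: (@smooth_at_comp_pair _ _ _ H (fun u : R * (R * (R * P)) => u.2.1 * u.1)
    (fun u : R * (R * (R * P)) => Y u.2.2) (fun u => u.2.2.2) o) => //.
  - exact/clinear_snd/clinear_snd/clinear_snd.
  - by rewrite /= mul0r Y0.
  - exact: smooth_atM.
pose G u := u.1 * u.1 * H1 u - H (A3 u).
have sG : smooth_at G o.
  apply: smooth_atB; last exact: smooth_at_comp_clinear.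
  by apply: smooth_atM => //; exact: smooth_atM.
have G0 : G o = 0 by rewrite /G /H1 /= mul0r Y0 !mul1r subrr.
(* At [s = 0] the equation for [w] is [w * w * h - h = 0], with derivative [h + h] at the solution
   [w = 1]. *)
have DG : 'D_(1, 0) G o != 0.
  have [_] := slice_is_derive (smooth_at_derivable (v := (1, 0) : R * (R * (R * P))) sG) => <-.
  set h := H (0, (y0, 0)) in H0.
  have -> : (fun s => G (s, (0, (y0, 0)))) = (fun s => s * s * h - h).
    by apply/funext => s; rewrite /G /H1 /A3 /= mul0r Y0.
  have -> : 'D_1 (fun s : R => s * s * h - h) 1 = h + h.
    have d1 : is_derive (1 : R) 1 (fun s : R => s) 1 by exact: is_derive_id.
    have dh := is_derive_cst h (1 : R) (1 : R).
    have := is_deriveB (is_deriveM (is_deriveM d1 d1) dh) dh.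
    by move=> [_ ->]; rewrite /GRing.scale/=; ring.
  by rewrite -mulr2n mulrn_eq0.
have [W [sW W0 GW _]] := smooth_implicit sG G0 DG.
(* The distance is measured from the unperturbed critical point, while [X] starts from the perturbed
   one, [xs (q' z)]. *)
pose s (z : R * R * P) := z.1.1 - xs (z.1.2, 0).
have id2 := clinear_id (R * R * P)%type.
have clq : clinear (fun z : R * R * P => (z.1.2, z.2)).
  by apply: clinear_pair; [exact/clinear_snd/clinear_fst|exact: clinear_snd].
have clq0 : clinear (fun z : R * R * P => (z.1.2, 0 : P)).
  by apply: clinear_pair; [exact/clinear_snd/clinear_fst|exact: clinear_cst0].
have sx : smooth_at (fun z : R * R * P => z.1.1) p0.
  exact/smooth_at_clinear/clinear_fst/clinear_fst.
have s_s : smooth_at s p0.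
  apply: smooth_atB => //.
  exact: (smooth_at_comp_clinear (A := fun z : R * R * P => (z.1.2, 0 : P))).
have s0 : s p0 = 0 by rewrite /s /= xs0 subrr.
have sYz : smooth_at (fun z : R * R * P => Y (z.1.2, z.2)) p0.
  exact: (smooth_at_comp_clinear (A := fun z : R * R * P => (z.1.2, z.2))).
pose Wz (z : R * R * P) := W (s z, (z.1.2, z.2)).
have sWz : smooth_at Wz p0.
  apply: (smooth_at_comp1 (f := W) (A := fun z : R * R * P => (z.1.2, z.2))) => //.
  by rewrite s0.
have Wz0 : Wz p0 = 1 by rewrite /Wz s0 W0.
pose q' (z : R * R * P) := (Y (z.1.2, z.2), z.2).
have q'0 : q' p0 = (y0, 0) by rewrite /q' /= Y0.
have sxq : smooth_at (fun z => xs (q' z)) p0.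
  apply: (smooth_at_comp1 (f := xs) (a := fun z => Y (z.1.2, z.2)) (A := snd)) => //.
  - exact: clinear_snd.
  - by rewrite /= Y0.
exists (fun z => xs (q' z) + s z * Wz z).
have cz' : {for p0, continuous (fun z => (s z * Wz z, q' z))}.
  apply: smooth_at_continuous; apply: smooth_at_pair; first exact: smooth_atM.
  by apply: smooth_at_pair => //; apply/smooth_at_clinear/clinear_snd.
have cz : {for p0, continuous (fun z => (s z, (z.1.2, (0 : P))))}.
  by apply: smooth_at_continuous; apply: smooth_at_pair => //; exact/smooth_at_clinear.
have cW : {for p0, continuous (fun z => (s z, (z.1.2, z.2)))}.
  by apply: smooth_at_continuous; apply: smooth_at_pair => //; exact/smooth_at_clinear.
have cq : {for p0, continuous (fun z : R * R * P => (z.1.2, z.2))} by exact: clinear_continuous.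
have e0 : (0, (y0, 0)) = (s p0 * Wz p0, q' p0) by rewrite s0 mul0r q'0.
have e1 : (0, (y0, 0)) = (s p0, (p0.1.2, (0 : P))) by rewrite s0.
have e2 : (0, (y0, 0)) = (s p0, (p0.1.2, p0.2)) by rewrite s0.
have recE z : recenter (s z, (z.1.2, 0)) = (z.1, 0).
  by case: z => -[x y] l; rewrite /recenter /s /= addrC subrK.
have recE' z : recenter (s z * Wz z, q' z) = ((xs (q' z) + s z * Wz z, Y (z.1.2, z.2)), z.2) by [].
split.
- by apply: smooth_atD => //; exact: smooth_atM.
- by rewrite q'0 s0 mul0r addr0 xs0.
- have n1 : \forall z \near p0, F (recenter (s z * Wz z, q' z)) =
      c (q' z) + (s z * Wz z) ^+ 2 * H (s z * Wz z, q' z).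
    by move: FH; rewrite e0; exact: (near_comp cz').
  have n2 : \forall z \near p0, F (recenter (s z, (z.1.2, 0))) =
      c (z.1.2, 0) + s z ^+ 2 * H (s z, (z.1.2, 0)).
    by move: FH; rewrite e1; exact: (near_comp cz).
  have n3 : \forall z \near p0, G (Wz z, (s z, (z.1.2, z.2))) = 0.
    by move: GW; rewrite e2; exact: (near_comp cW).
  have n4 : \forall z \near p0, c (q' z) = c (z.1.2, 0).
    exact: (near_comp cq Yc).
  have := near_and (near_and n1 n2) (near_and n3 n4).
  apply: filterS => z [[E1z E2z] [E3z E4z]].
  rewrite -recE' E1z E4z -recE E2z; congr (_ + _).
  move: E3z; rewrite /G /H1 /A3 /= => /eqP; rewrite subr_eq0 => /eqP <-.
  by rewrite /q' /Wz; ring.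
- have n1 : \forall z \near p0, Num.sg (Fx (recenter (s z * Wz z, q' z))) =
      Num.sg (s z * Wz z) * Num.sg (Fxx p0).
    by move: recenter_sg; rewrite e0; exact: (near_comp cz').
  have n2 : \forall z \near p0, Num.sg (Fx (recenter (s z, (z.1.2, 0)))) =
      Num.sg (s z) * Num.sg (Fxx p0).
    by move: recenter_sg; rewrite e1; exact: (near_comp cz).
  have n3 : \forall z \near p0, Num.sg (Wz z) = Num.sg (Wz p0).
    by apply: near_sg => //; rewrite Wz0 oner_neq0.
  have := near_and (near_and n1 n2) n3.
  apply: filterS => z [[E1z E2z] E3z].
  by rewrite -recE' E1z -recE E2z sgrM E3z Wz0 sgr1 mulr1.
Qed.

End Fold.
End LocalCharts.

Lemma sg_opp_neq (R : realDomainType) (a b c d k : R) :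
  Num.sg a = k -> Num.sg b = k -> k != 0 -> 0 < c -> 0 < d ->
  Num.sg (- (a * c)) <> Num.sg (b * d).
Proof.
move=> ak bk k0 c0 d0 /eqP.
by rewrite sgrN !sgrM ak bk !gtr0_sg// !mulr1 eqNr (negPf k0).
Qed.

Section LocalUniqueness.
Context {R : realType} (P : normedModType R).
Variables (F : R * R * P -> R) (x0 y0 : R).

Let ex : R * R * P := ((1, 0), 0).
Let Fx : R * R * P -> R := 'D_ex F.
Let Fxx : R * R * P -> R := 'D_ex Fx.
Let p0 : R * R * P := ((x0, y0), 0).

Hypothesis sF : smooth_at F p0.

Lemma slice_x_is_derive (K : R * R * P -> R) (s y : R) (l : P) :
  smooth_at K ((s, y), l) ->
  is_derive s 1 (fun s => K ((s, y), l)) ('D_ex K ((s, y), l)).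
Proof.
move=> sK; have h (h : R) : ((h *: 1 + s, y), l) = h *: ex + ((s, y), l).
  by congr pair; rewrite /= ?scaler0 ?add0r//; congr pair; rewrite /= ?scaler0 ?add0r.
have [dE DE] := @derive_affine _ _ _ _ K (fun s => ((s, y), l)) s 1 ex h.
by split; [apply: dE; exact: smooth_at_derivable|].
Qed.

(** Away from folds no critical value has to be matched: for any [Y] through [y0], [F] is solved for
    [x] directly, and both signs are that of [Fx p0]. *)
Lemma regular_chart (Y : R * P -> R) : Fx p0 != 0 ->
  smooth_at Y (y0, 0) -> Y (y0, 0) = y0 ->
  exists X : R * R * P -> R, [/\ smooth_at X p0, X p0 = x0,
    \forall z \near p0, F ((X z, Y (z.1.2, z.2)), z.2) = F (z.1, 0) &
    \forall z \near p0, Num.sg (Fx ((X z, Y (z.1.2, z.2)), z.2)) = Num.sg (Fx (z.1, 0))].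
Proof.
move=> Fx0 sY Y0.
have id1 := clinear_id (R * (R * R * P))%type.
have id2 := clinear_id (R * R * P)%type.
pose A1 (u : R * (R * R * P)) : R * R * P := (u.2.1, 0).
have clA1 : clinear A1.
  by apply: clinear_pair; [exact/clinear_fst/clinear_snd|exact: clinear_cst0].
have clA2 : clinear (fun u : R * (R * R * P) => (u.2.1.2, u.2.2)).
  apply: clinear_pair; last exact/clinear_snd/clinear_snd.
  exact/clinear_snd/clinear_fst/clinear_snd.
pose F1 (u : R * (R * R * P)) : R := F ((u.1, Y (u.2.1.2, u.2.2)), u.2.2).
pose o : R * (R * R * P) := (x0, p0).
have sF1 : smooth_at F1 o.
  apply: (@smooth_at_comp2 _ _ _ F (fun u : R * (R * R * P) => u.1)
    (fun u : R * (R * R * P) => Y (u.2.1.2, u.2.2)) (fun u => u.2.2) o) => //.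
  - exact/clinear_snd/clinear_snd.
  - by rewrite /= Y0.
  - exact/smooth_at_clinear/clinear_fst.
  - exact: (smooth_at_comp_clinear (A := fun u : R * (R * R * P) => (u.2.1.2, u.2.2))).
pose G u := F1 u - F (A1 u).
have sG : smooth_at G o by apply: smooth_atB => //; exact: smooth_at_comp_clinear.
have G0 : G o = 0 by rewrite /G /F1 /A1 /= Y0 subrr.
have DG : 'D_(1, 0) G o != 0.
  have [_] := slice_is_derive (smooth_at_derivable (v := (1, 0) : R * (R * R * P)) sG) => <-.
  have -> : (fun s => G (s, p0)) = (fun s => F ((s, y0), 0) - F p0).
    by apply/funext => s; rewrite /G /F1 /A1 /= Y0.
  have dF := slice_x_is_derive sF.
  by have [_ ->] := is_deriveB dF (is_derive_cst (F p0) (x0 : R) (1 : R)); rewrite subr0.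
have [X [sX X0 GX _]] := smooth_implicit sG G0 DG.
exists X; split => //.
  by apply: filterS GX => z /eqP; rewrite /G subr_eq0 => /eqP.
have sFx : smooth_at Fx p0 by exact: smooth_at_derive.
have n0 := near_sg sFx Fx0.
pose c1 (z : R * R * P) : R * R * P := ((X z, Y (z.1.2, z.2)), z.2).
pose c2 (z : R * R * P) : R * R * P := (z.1, 0).
have cc1 : {for p0, continuous c1}.
  apply: smooth_at_continuous; apply: smooth_at_pair; last exact/smooth_at_clinear/clinear_snd.
  apply: smooth_at_pair => //.
  apply: (smooth_at_comp_clinear (A := fun z : R * R * P => (z.1.2, z.2))) => //.
  by apply: clinear_pair; [exact/clinear_snd/clinear_fst|exact: clinear_snd].
have cc2 : {for p0, continuous c2}.
  by apply: clinear_continuous; apply: clinear_pair; [exact: clinear_fst|exact: clinear_cst0].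
have e1 : p0 = c1 p0 by rewrite /c1 /= X0 Y0.
have n1 : \forall z \near p0, Num.sg (Fx (c1 z)) = Num.sg (Fx p0).
  by move: n0; rewrite {1}e1; exact: near_comp.
have n2 : \forall z \near p0, Num.sg (Fx (c2 z)) = Num.sg (Fx p0).
  exact: (near_comp cc2 n0).
by have := near_and n1 n2; apply: filterS => z [-> ->].
Qed.

(** Equal values at [x1 < x2] produce a zero of [Fx] in between. If [Fx] is nonzero this is absurd;
    if [Fxx] has constant sign, [Fx] takes opposite signs at [x1] and [x2]. *)
Lemma chart_unique : Fx p0 != 0 \/ Fxx p0 != 0 ->
  exists2 r, 0 < r & forall x1 x2 y l, ball x0 r x1 -> ball x0 r x2 ->
    ball y0 r y -> ball 0 r l -> F ((x1, y), l) = F ((x2, y), l) ->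
    Num.sg (Fx ((x1, y), l)) = Num.sg (Fx ((x2, y), l)) -> x1 = x2.
Proof.
move=> nondeg.
have sFx : smooth_at Fx p0 by exact: smooth_at_derive.
have sFxx : smooth_at Fxx p0 by exact: smooth_at_derive.
suff : exists2 r, 0 < r & forall x1 x2 y l, ball x0 r x1 -> ball x0 r x2 ->
    ball y0 r y -> ball 0 r l -> x1 < x2 -> F ((x1, y), l) = F ((x2, y), l) ->
    Num.sg (Fx ((x1, y), l)) <> Num.sg (Fx ((x2, y), l)).
  move=> [r r0 h]; exists r => // x1 x2 y l b1 b2 by_ bl FE SE.
  case: (ltgtP x1 x2) => // x12; exfalso; first exact: (h x1 x2 y l).
  by apply: (h x2 x1 y l) => //; exact: esym.
have bs r s x1 x2 : ball x0 r x1 -> ball x0 r x2 -> x1 <= s <= x2 -> ball x0 r s.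
  rewrite -!ball_normE/= !ltr_distlC => /andP[a1 a2] /andP[c1 c2].
  by move=> /andP[h1 h2]; rewrite (lt_le_trans a1 h1) (le_lt_trans h2 c2).
case: nondeg => h0.
  have := near_and (smooth_at_near sF) (near_sg sFx h0).
  move=> /near_pair_box[r r0 hr]; exists r => // x1 x2 y l b1 b2 by_ bl x12 FE _.
  have box s : x1 <= s <= x2 -> smooth_at F ((s, y), l) /\
      Num.sg (Fx ((s, y), l)) = Num.sg (Fx p0).
    by move=> hs; apply: hr => //; split => //; exact: bs hs.
  have [|c /andP[x1c cx2] Fc] := rolle_open (f := fun s => F ((s, y), l))
     (df := fun s => Fx ((s, y), l)) x12 _ FE.
    by move=> s /box[sFs _]; exact: slice_x_is_derive.
  have [|_] := box c; first by rewrite !ltW.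
  by rewrite Fc sgr0 => /esym/eqP; rewrite sgr_eq0 (negPf h0).
have := near_and (smooth_at_near sF) (near_sg sFxx h0).
move=> /near_pair_box[r r0 hr]; exists r => // x1 x2 y l b1 b2 by_ bl x12 FE.
have box s : x1 <= s <= x2 -> smooth_at F ((s, y), l) /\
    Num.sg (Fxx ((s, y), l)) = Num.sg (Fxx p0).
  by move=> hs; apply: hr => //; split => //; exact: bs hs.
have [|c /andP[x1c cx2] Fc] := rolle_open (f := fun s => F ((s, y), l))
   (df := fun s => Fx ((s, y), l)) x12 _ FE.
  by move=> s /box[sFs _]; exact: slice_x_is_derive.
have dFx s : x1 <= s <= x2 -> is_derive s 1 (fun s => Fx ((s, y), l)) (Fxx ((s, y), l)).
  by move=> /box[sFs _]; apply: slice_x_is_derive; exact: smooth_at_derive.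
have [|d1 /andP[/ltW e1 /ltW e2] E1] := mvt_open (f := fun s => Fx ((s, y), l))
    (df := fun s => Fxx ((s, y), l)) x1c.
  by move=> s /andP[h1 h2]; apply: dFx; rewrite h1 (le_trans h2 (ltW cx2)).
have [|d2 /andP[/ltW f1 /ltW f2] E2] := mvt_open (f := fun s => Fx ((s, y), l))
    (df := fun s => Fxx ((s, y), l)) cx2.
  by move=> s /andP[h1 h2]; apply: dFx; rewrite h2 (le_trans (ltW x1c) h1).
have [|_ g1] := box d1; first by rewrite e1 (le_trans e2 (ltW cx2)).
have [|_ g2] := box d2; first by rewrite f2 (le_trans (ltW x1c) f1).
move: E1 E2; rewrite Fc sub0r subr0 => /eqP; rewrite eqr_oppLR => /eqP -> ->.
have p1 : 0 < c - x1 by rewrite subr_gt0; exact: x1c.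
have p2 : 0 < x2 - c by rewrite subr_gt0; exact: cx2.
have k0 : Num.sg (Fxx p0) != 0 by rewrite sgr_eq0; exact: h0.
exact: (sg_opp_neq g1 g2 k0 p1 p2).
Qed.
End LocalUniqueness.

(** * Global maps *)

Section GlobalChart.
Context {R : realType} (P : normedModType R).
Variables (F : R * R * P -> R) (a b c d : R).

Let K : set (R * R) := `[a, b]%classic `*` `[c, d]%classic.
Let Fx : R * R * P -> R := 'D_((1, 0), 0) F.
Let Fxx : R * R * P -> R := 'D_((1, 0), 0) Fx.
Let Fy : R * R * P -> R := 'D_((0, 1), 0) F.
Let fold (p : R * R) : Prop := [/\ K p, F (p, 0) = 0 & Fx (p, 0) = 0].

Hypothesis sF : forall p, K p -> smooth_at F (p, 0).
Hypothesis edge : forall p, K p -> p.1 = a \/ p.1 = b -> F (p, 0) != 0.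
Hypothesis fold_nondeg : forall p, fold p ->
  [/\ c < p.2 < d, Fy (p, 0) != 0 & Fxx (p, 0) != 0].
Hypothesis fold_single : forall p p', fold p -> fold p' -> p.2 = p'.2 -> p = p'.

Let compactK : compact K.
Proof. by apply: compact_setX; exact: segment_compact. Qed.

Let sFx p : K p -> smooth_at Fx (p, 0).
Proof. by move=> /sF; exact: smooth_at_derive. Qed.

Let near_slice (Q : R * R * P -> Prop) (p : R * R) :
  (\forall z \near (p, 0), Q z) -> \forall p' \near p, Q (p', 0).
Proof.
apply: (near_comp (f := fun p : R * R => (p, 0 : P))).
by apply: clinear_continuous; apply: clinear_pair; [exact: clinear_id|exact: clinear_cst0].
Qed.

(** Near a point that is not a fold there are none, by continuity; near a fold, [critical_level]
    isolates it. *)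
Lemma finite_folds : exists s : seq (R * R), forall p, fold p <-> p \in s.
Proof.
apply: (isolated_finite compactK); first by move=> p [].
move=> p Kp; case: (eqVneq (F (p, 0)) 0) => [F0|F0]; last first.
  have := smooth_at_near_open (sF Kp) (@open_neq _ (0 : R)) F0.
  by move=> /near_slice; apply: filterS => p' /= + [_ h]; rewrite h eqxx.
case: (eqVneq (Fx (p, 0)) 0) => [Fx0|Fx0]; last first.
  have := smooth_at_near_open (sFx Kp) (@open_neq _ (0 : R)) Fx0.
  by move=> /near_slice; apply: filterS => p' /= + [_ _ h]; rewrite h eqxx.
have [pcd Fy0 Fxx0] : [/\ c < p.2 < d, Fy (p, 0) != 0 & Fxx (p, 0) != 0].
  exact: fold_nondeg.
case: p Kp F0 Fx0 pcd Fy0 Fxx0 => x0 y0 Kp F0 Fx0 pcd Fy0 Fxx0.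
have [xs [sxs xs0 h1 h2]] := critical_point (sF Kp) Fx0 Fxx0.
have [_ [_ _ _ _ iso]] := critical_level (sF Kp) F0 Fx0 Fy0 sxs xs0 h2.
by apply: filterS iso => p h [_]; exact: h.
Qed.

Lemma slow_map : exists Y : R * P -> R,
  [/\ forall y, smooth_at Y (y, 0), forall y, Y (y, 0) = y,
    forall y, y = c \/ y = d -> \forall q \near (y, 0), Y q = q.1 &
    forall p, fold p -> exists xs : R * P -> R,
      [/\ smooth_at xs (p.2, 0), xs (p.2, 0) = p.1,
        \forall q \near (p.2, 0), Fx ((xs q, q.1), q.2) = 0 &
        \forall q \near (p.2, 0),
          critical_value F xs (Y q, q.2) = critical_value F xs (q.1, 0)]].
Proof.
have [s sE] := finite_folds.
(* The choice is made per level, as [glue_levels] requires; [fold_single] allows only one fold on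
   it. *)
have : forall y, exists Yp : R * P -> R, forall x, fold (x, y) ->
  [/\ smooth_at Yp (y, 0), \forall t \near y, Yp (t, 0) = t &
    exists xs : R * P -> R,
      [/\ smooth_at xs (y, 0), xs (y, 0) = x,
        \forall q \near (y, 0), Fx ((xs q, q.1), q.2) = 0 &
        \forall q \near (y, 0),
          critical_value F xs (Yp q, q.2) = critical_value F xs (q.1, 0)]].
  move=> y; case: (pselect (exists x, fold (x, y))) => [[x fx]|nf]; last first.
    by exists (fun=> 0) => x fx; exfalso; apply: nf; exists x.
  have [Kp F0 Fx0] := fx; have [pcd Fy0 Fxx0] := fold_nondeg fx.
  have [xs [sxs xs0 h1 h2]] := critical_point (sF Kp) Fx0 Fxx0.
  have [Yp [sY Y0 Yc Yid _]] := critical_level (sF Kp) F0 Fx0 Fy0 sxs xs0 h2.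
  exists Yp => x' fx'; have [->] := fold_single fx' fx erefl.
  by split => //; exists xs.
move=> /choice[Yf Yfp].
pose lev := undup [seq p.2 | p <- s].
have levP y : y \in lev -> exists x, fold (x, y).
  rewrite mem_undup => /mapP[[x y'] ps ->]; exists x.
  exact/sE.
have [||||Y [Y1 Y2 Y3 Y4]] := @glue_levels R P c d lev Yf.
- exact: undup_uniq.
- by move=> y /levP[x /fold_nondeg[]].
- by move=> y /levP[x /Yfp[]].
- by move=> y /levP[x /Yfp[]].
exists Y; split => // -[x y] fp /=.
have [_ _ [xs [h1 h2 h3 h4]]] := Yfp _ _ fp.
have ylev : y \in lev.
  by rewrite mem_undup; apply/mapP; exists (x, y) => //; exact/sE.
exists xs; split => //.
by have := near_and (Y3 _ ylev) h4; apply: filterS => q [-> ->].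
Qed.

Section FastMap.
Variable Y : R * P -> R.
Hypotheses (sY : forall y, smooth_at Y (y, 0)) (Y0 : forall y, Y (y, 0) = y).
Hypothesis Yfold : forall p, fold p -> exists xs : R * P -> R,
      [/\ smooth_at xs (p.2, 0), xs (p.2, 0) = p.1,
        \forall q \near (p.2, 0), Fx ((xs q, q.1), q.2) = 0 &
        \forall q \near (p.2, 0),
          critical_value F xs (Y q, q.2) = critical_value F xs (q.1, 0)].

Let T (z : R * R * P) (X : R) : R * R * P := ((X, Y (z.1.2, z.2)), z.2).

Let matches (z : R * R * P) (X : R) : Prop :=
  F (T z X) = F (z.1, 0) /\ Num.sg (Fx (T z X)) = Num.sg (Fx (z.1, 0)).

Lemma local_match p : K p -> F (p, 0) = 0 -> exists X : R * R * P -> R,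
  [/\ smooth_at X (p, 0), X (p, 0) = p.1 & \forall z \near (p, 0), matches z (X z)].
Proof.
case: p => x0 y0 Kp F0; case: (eqVneq (Fx ((x0, y0), 0)) 0) => [Fx0|Fx0].
  have fp : fold (x0, y0) by [].
  have [_ _ Fxx0] := fold_nondeg fp; have [xs [h1 h2 h3 h4]] := Yfold fp.
  have [X [sX X0 n1 n2]] := fold_chart (sF Kp) Fxx0 h1 h2 h3 (sY y0) (Y0 y0) h4.
  by exists X; split => //; have := near_and n1 n2; apply: filterS.
have [X [sX X0 n1 n2]] := regular_chart (sF Kp) Fx0 (sY y0) (Y0 y0).
by exists X; split => //; have := near_and n1 n2; apply: filterS.
Qed.

Let unique_within (r : R) (z : R * R * P) : Prop := forall X1 X2,
  `|X1 - z.1.1| < r -> `|X2 - z.1.1| < r -> matches z X1 -> matches z X2 -> X1 = X2.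

Let clin_yl : clinear (fun z : R * R * P => (z.1.2, z.2)).
Proof.
have id1 := clinear_id (R * R * P)%type.
by apply: clinear_pair; [exact/clinear_snd/clinear_fst|exact: clinear_snd].
Qed.

Let smooth_x z : smooth_at (fun z : R * R * P => z.1.1) z.
Proof. exact/smooth_at_clinear/clinear_fst/clinear_fst/clinear_id. Qed.

Let smooth_Yz (p : R * R) : smooth_at (fun z : R * R * P => Y (z.1.2, z.2)) (p, 0).
Proof. exact: (smooth_at_comp_clinear (A := fun z : R * R * P => (z.1.2, z.2))). Qed.

Lemma local_unique p : K p -> F (p, 0) = 0 -> exists2 r, 0 < r &
  \forall z \near (p, 0), unique_within r z.
Proof.
case: p => x0 y0 Kp F0.
have nondeg : Fx ((x0, y0), 0) != 0 \/ Fxx ((x0, y0), 0) != 0.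
  case: (eqVneq (Fx ((x0, y0), 0)) 0) => [Fx0|]; last by left.
  by right; have [] := fold_nondeg (And3 Kp F0 Fx0).
have [r r0 hr] := chart_unique (sF Kp) nondeg.
(* One half for the distance from [x0] to [z.1.1], the other for that from [z.1.1] to a
   candidate. *)
have r2 : 0 < r / 2 by rewrite divr_gt0.
exists (r / 2) => //.
have n1 : \forall z \near ((x0, y0), (0 : P)), `|z.1.1 - x0| < r / 2.
  have s1 : smooth_at (fun z : R * R * P => z.1.1 - x0) ((x0, y0), 0).
    by apply: smooth_atB => //; exact: smooth_at_cst.
  by apply: (smooth_at_near_open s1 (@open_norm_lt R (r / 2))); rewrite /= subrr normr0.
have n2 : \forall z \near ((x0, y0), (0 : P)), `|Y (z.1.2, z.2) - y0| < r.
  have s1 : smooth_at (fun z : R * R * P => Y (z.1.2, z.2) - y0) ((x0, y0), 0).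
    by apply: smooth_atB => //; exact: smooth_at_cst.
  by apply: (smooth_at_near_open s1 (@open_norm_lt R r)); rewrite /= Y0 subrr normr0.
have n3 : \forall z \near ((x0, y0), (0 : P)), ball 0 r z.2.
  have s1 : smooth_at (fun z : R * R * P => z.2) ((x0, y0), 0).
    exact/smooth_at_clinear/clinear_snd/clinear_id.
  by apply: (smooth_at_near_open s1 (@ball_open _ _ (0 : P) r)); exact: ballxx.
have := near_and n1 (near_and n2 n3); apply: filterS => z [h1 [h2 h3]] X1 X2 hX1 hX2.
move=> [e1 s1] [e2 s2].
have tri X : `|X - z.1.1| < r / 2 -> ball x0 r X.
  move=> hX; rewrite -ball_normE/= distrC [r]splitr.
  by rewrite -[X](subrK z.1.1) -addrA (le_lt_trans (ler_normD _ _))// ltrD.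
apply: (hr X1 X2 (Y (z.1.2, z.2)) z.2) => //.
- exact: tri.
- exact: tri.
- by rewrite -ball_normE/= distrC.
- by rewrite -/(T z X1) e1 -e2.
- by rewrite -/(T z X1) -/Fx s1 -s2.
Qed.

(** A common radius allows [matching_map] to define [X] globally by a single choice. *)
Lemma uniform_unique : exists2 r, 0 < r & forall p, K p -> F (p, 0) = 0 ->
  \forall z \near (p, 0), unique_within r z.
Proof.
apply: (compact_small (Q := fun r p => F (p, 0) = 0 ->
  \forall z \near (p, 0), unique_within r z) compactK).
move=> p Kp; case: (eqVneq (F (p, 0)) 0) => [F0|F0]; last first.
  exists 1 => //; have := smooth_at_near_open (sF Kp) (@open_neq _ (0 : R)) F0.
  by move=> /near_slice; apply: filterS => p' /= h r _ F0'; rewrite F0' eqxx in h.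
have [r r0 n] := local_unique Kp F0; exists r => //.
have := near_slice (near_join n); apply: filterS => p' n' r' /andP[r'0 r'r] _.
apply: filterS n' => z h X1 X2 h1 h2.
by apply: h; [exact: lt_le_trans h1 r'r|exact: lt_le_trans h2 r'r].
Qed.

(** Staying off the vertical sides is part of [good] so that [good_level] extends it from the
    critical set to a whole band around it. *)
Let good (X : R * R * P -> R) (p : R * R) : Prop :=
  [/\ p.1 != a, p.1 != b, smooth_at X (p, 0),
    \forall z \near (p, 0), F (T z (X z)) = F (z.1, 0) &
    \forall p' \near p, X (p', 0) = p'.1].

Let good_near X p : good X p -> \forall p' \near p, good X p'.
Proof.
move=> [pa pb sX n1 n2].
have sx : smooth_at (fun p : R * R => p.1) p.
  exact/smooth_at_clinear/clinear_fst/clinear_id.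
have na := smooth_at_near_open sx (@open_neq _ a) pa.
have nb := smooth_at_near_open sx (@open_neq _ b) pb.
have := near_and (near_and na nb) (near_and (near_slice (smooth_at_near sX))
  (near_and (near_slice (near_join n1)) (near_join n2))).
by apply: filterS => p' [[h1 h2] [h3 [h4 h5]]]; split.
Qed.

(* The sign condition in [matches] selects one of the two solutions that are
   close to each other near a fold; uniqueness then patches the local charts. *)
Lemma matching_map : exists X : R * R * P -> R,
  forall p, K p -> F (p, 0) = 0 -> good X p.
Proof.
have [r r0 uniq_r] := uniform_unique.
pose rel z X := `|X - z.1.1| < r /\ matches z X.
(* Close to the critical set and to [l = 0], a match exists and is unique, so this choice agrees
   with every local chart there. *)
pose X z := xget z.1.1 [set x | rel z x].
have XE z x : unique_within r z -> rel z x -> X z = x.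
  move=> uz hx; rewrite /X; case: xgetP => [y -> hy|h]; last by have := h x.
  by apply: uz; [exact: hy.1|exact: hx.1|exact: hy.2|exact: hx.2].
exists X => p Kp F0.
have [Xp [sXp Xp0 mXp]] := local_match Kp F0.
have nr : \forall z \near (p, 0), `|Xp z - z.1.1| < r.
  have s1 : smooth_at (fun z : R * R * P => Xp z - z.1.1) (p, 0) by exact: smooth_atB.
  by apply: (smooth_at_near_open s1 (@open_norm_lt R r)); rewrite /= Xp0 subrr normr0.
have XXp : \forall z \near (p, 0), Xp z = X z.
  have := near_and (uniq_r _ Kp F0) (near_and nr mXp).
  by apply: filterS => z [h1 [h2 h3]]; rewrite (XE z (Xp z)).
split.
- by apply/negP => /eqP pa; have := edge Kp (or_introl pa); rewrite F0 eqxx.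
- by apply/negP => /eqP pb; have := edge Kp (or_intror pb); rewrite F0 eqxx.
- exact: smooth_at_eq XXp sXp.
- by have := near_and XXp mXp; apply: filterS => z [<- []].
- have := near_slice (uniq_r _ Kp F0); apply: filterS => p' h.
  apply: (XE _ _ h); split; first by rewrite /= subrr normr0.
  by rewrite /matches /T /= Y0; case: p' {h}.
Qed.

(** [2 * e] is the value of [|F|] beyond which the cut-off in [fast_map] vanishes. *)
Lemma good_level X : (forall p, K p -> F (p, 0) = 0 -> good X p) ->
  exists2 e, 0 < e & forall p, K p -> `|F (p, 0)| <= 2 * e -> good X p.
Proof.
move=> gX; apply: (compact_small (Q := fun e p => `|F (p, 0)| <= 2 * e -> good X p) compactK).
move=> p Kp; case: (eqVneq (F (p, 0)) 0) => [F0|F0].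
  exists 1 => //; have := good_near (gX _ Kp F0).
  by apply: filterS => p' h r _ _.
(* With [r] at most a quarter of the value at [p], nearby values exceed [2 * r] and the claim is
   vacuous. *)
have e0 : 0 < `|F (p, 0)| / 4 by rewrite divr_gt0// normr_gt0.
exists (`|F (p, 0)| / 4) => //.
have h0 : `|F (p, 0)| / 2 < `|F (p, 0)| by lra.
have := smooth_at_near_open (sF Kp) (@open_norm_gt R (`|F (p, 0)| / 2)) h0.
move=> /near_slice; apply: filterS => p' /= h r /andP[_ r1] h2.
by exfalso; lra.
Qed.

Let smooth_F0 p : K p -> smooth_at (fun z : R * R * P => F (z.1, 0)) (p, 0).
Proof.
move=> Kp; apply: (smooth_at_comp_clinear (A := fun z : R * R * P => (z.1, 0))); last exact: sF.
have id1 := clinear_id (R * R * P)%type.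
by apply: clinear_pair; [exact: clinear_fst|exact: clinear_cst0].
Qed.

Lemma fast_map : exists X S : R * R * P -> R, forall p, K p ->
  [/\ smooth_at X (p, 0), smooth_at S (p, 0),
    \forall z \near (p, 0), 0 < S z /\ F (z.1, 0) = S z * F (T z (X z)),
    \forall p' \near p, X (p', 0) = p'.1 &
    p.1 = a \/ p.1 = b -> \forall z \near (p, 0), X z = z.1.1].
Proof.
have [XX /good_level[e e0 gXX]] := matching_map.
have [beta [sb b1 b0]] := @bump_function R.
pose cut (z : R * R * P) := beta (F (z.1, 0) / e).
pose X z := z.1.1 + cut z * (XX z - z.1.1).
(* Smooth because it is constantly 1 near the critical set. *)
pose S z := if F (z.1, 0) == 0 then 1 else F (z.1, 0) / F (T z (X z)).
exists X, S => p Kp; have sF0 := smooth_F0 Kp.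
have scut : smooth_at cut (p, 0).
  apply: (smooth_at_comp_real (f := beta)) => //.
  by apply: smooth_atM => //; exact: smooth_at_cst.
have far : 2 * e < `|F (p, 0)| -> \forall z \near (p, 0), z.1.1 = X z.
  move=> h; have := smooth_at_near_open sF0 (@open_norm_gt R (2 * e)) h.
  apply: filterS => z /= hz; rewrite /X /cut b0 ?mul0r ?addr0//.
  by rewrite normrM normfV (gtr0_norm e0) ler_pdivlMr// ltW.
have sX : smooth_at X (p, 0).
  case: (leP `|F (p, 0)| (2 * e)) => h; last by apply: smooth_at_eq (far h) _.
  have [_ _ sXX _ _] := gXX p Kp h.
  by apply: smooth_atD => //; apply: smooth_atM => //; exact: smooth_atB.
have Xp' : \forall p' \near p, X (p', 0) = p'.1.
  case: (leP `|F (p, 0)| (2 * e)) => h; last first.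
    by have := near_slice (far h); apply: filterS => p' <-.
  have [_ _ _ _] := gXX p Kp h; apply: filterS => p' h'.
  by rewrite /X h' subrr mulr0 addr0.
have Xp : X (p, 0) = p.1 := nbhs_singleton Xp'.
have sFT : smooth_at (fun z => F (T z (X z))) (p, 0).
  apply: (@smooth_at_comp2 _ _ _ F X (fun z => Y (z.1.2, z.2)) (fun z => z.2)) => //.
  - exact/clinear_snd/clinear_id.
  - by rewrite Xp /= Y0; case: (p) Kp => x y Kp /=; exact: sF.
have FTp : F (T (p, 0) (X (p, 0))) = F (p, 0) by rewrite /T Xp /= Y0; case: (p).
have nE : \forall z \near (p, 0), F (z.1, 0) = S z * F (T z (X z)).
  case: (eqVneq (F (p, 0)) 0) => [F0|F0].
    have h : `|F (p, 0)| <= 2 * e by rewrite F0 normr0 mulr_ge0// ltW.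
    have [_ _ _ n1 _] := gXX p Kp h.
    have he : `|F (p, 0)| < e by rewrite F0 normr0.
    have := near_and n1 (smooth_at_near_open sF0 (@open_norm_lt R e) he).
    apply: filterS => z /= [h1 h2].
    have XE : X z = XX z.
      rewrite /X /cut b1 ?mul1r 1?addrC ?subrK//.
      by rewrite normrM normfV (gtr0_norm e0) ler_pdivrMr// mul1r ltW.
    by rewrite XE h1 /S XE h1; case: eqVneq => [->|n]; rewrite ?mulr0 ?divff ?mul1r.
  have FT0 : F (T (p, 0) (X (p, 0))) != 0 by rewrite FTp.
  have := near_and (smooth_at_near_open sF0 (@open_neq _ (0 : R)) F0)
    (smooth_at_near_open sFT (@open_neq _ (0 : R)) FT0).
  by apply: filterS => z /= [h1 h2]; rewrite /S (negPf h1) divfK.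
have sS : smooth_at S (p, 0).
  case: (ltP `|F (p, 0)| e) => he.
    have h : `|F (p, 0)| <= 2 * e by lra.
    have [_ _ _ n1 _] := gXX p Kp h.
    apply: smooth_at_eq (smooth_at_cst (1 : R) _).
    have := near_and n1 (smooth_at_near_open sF0 (@open_norm_lt R e) he).
    apply: filterS => z /= [h1 h2].
    have XE : X z = XX z.
      rewrite /X /cut b1 ?mul1r 1?addrC ?subrK//.
      by rewrite normrM normfV (gtr0_norm e0) ler_pdivrMr// mul1r ltW.
    by rewrite /S XE h1; case: eqVneq => // n; rewrite divff.
  have F0 : F (p, 0) != 0 by rewrite -normr_gt0 (lt_le_trans e0).
  have FT0 : F (T (p, 0) (X (p, 0))) != 0 by rewrite FTp.
  apply: smooth_at_eq (smooth_atM sF0 (smooth_atV FT0 sFT)).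
  have := smooth_at_near_open sF0 (@open_neq _ (0 : R)) F0.
  by apply: filterS => z /= h; rewrite /S (negPf h).
have Sp : 0 < S (p, 0).
  by rewrite /S FTp /=; case: eqVneq => // n; rewrite divff.
split => //.
- by apply: near_and => //; exact: (smooth_at_near_open sS (@open_gt _ (0 : R)) Sp).
(* On the vertical sides [good] fails, so [|F|] exceeds [2 * e] there and [X] is the identity
   nearby. *)
- move=> pab; case: (leP `|F (p, 0)| (2 * e)) => h.
    by have [h1 h2 _ _ _] := gXX p Kp h; case: pab => E; move: h1 h2; rewrite E eqxx.
  by apply: filterS (far h) => z <-.
Qed.

End FastMap.
End GlobalChart.

(** * Diffeomorphisms of a rectangle *)

Section PlanarDiffeo.
Context {R : realType}.

(** The implicit function theorem yields a smooth local solution [xi] of [X (xi, q) = u], and the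
    left inverse property forces [Xi] to coincide with it; no continuity of [Xi] is assumed
    beforehand. *)
Lemma smooth_at_left_inverse (Q : normedModType R) (X Xi : R * Q -> R) (x0 r : R) (q0 : Q) :
  0 < r -> smooth_at X (x0, q0) -> 'D_(1, 0) X (x0, q0) != 0 ->
  (forall x q, ball x0 r x -> ball q0 r q -> Xi (X (x, q), q) = x) ->
  smooth_at Xi (X (x0, q0), q0).
Proof.
move=> r0 sX dX XiX; set u0 := X (x0, q0).
have id1 := clinear_id (R * (R * Q))%type.
have id2 := clinear_id (R * Q)%type.
pose Gp (z : R * (R * Q)) : R * Q := (z.1, z.2.2).
have clG : clinear Gp.
  by apply: clinear_pair; [exact: clinear_fst|exact/clinear_snd/clinear_snd].
have s1 : smooth_at (fun z => X (Gp z)) (x0, (u0, q0)) by exact: smooth_at_comp_clinear.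
have s2 : smooth_at (fun z : R * (R * Q) => z.2.1) (x0, (u0, q0)).
  exact/smooth_at_clinear/clinear_fst/clinear_snd.
pose G z := X (Gp z) - z.2.1.
have sG : smooth_at G (x0, (u0, q0)) by exact: smooth_atB.
have G0 : G (x0, (u0, q0)) = 0 by rewrite /G /Gp /= subrr.
have DG : 'D_(1, 0) G (x0, (u0, q0)) != 0.
  rewrite /G (deriveB (f := fun z => X (Gp z))); [|exact: smooth_at_derivable..].
  have E1 (h : R) : Gp (h *: (1, 0) + (x0, (u0, q0))) = h *: (1, 0) + Gp (x0, (u0, q0)).
    by congr pair.
  have [_] := @derive_affine _ _ _ _ X Gp _ _ _ E1; rewrite /comp => ->.
  have [l3 c3] := clinear_fst (clinear_snd id1).
  by rewrite (linear_derive _ _ l3 c3) subr0.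
have [xi [sxi xi0 Gxi _]] := smooth_implicit sG G0 DG.
apply: (smooth_at_eq _ sxi).
have n1 : \forall w \near (u0, q0), ball x0 r (xi w).
  apply: (smooth_at_near_open sxi (@ball_open _ _ (x0 : R) r)).
  by rewrite xi0; exact: ballxx.
have n2 : \forall w \near (u0, q0), ball q0 r w.2.
  have s3 : smooth_at (fun w : R * Q => w.2) (u0, q0) by exact/smooth_at_clinear/clinear_snd.
  by apply: (smooth_at_near_open s3 (@ball_open _ _ q0 r)); exact: ballxx.
have := near_and Gxi (near_and n1 n2); apply: filterS => -[u q] /= [h1 [h2 h3]].
move: h1; rewrite /G /Gp /= => /eqP; rewrite subr_eq0 => /eqP E.
by rewrite -{2}E XiX.
Qed.

Lemma smooth_at_comp_plane (W : normedModType R) (f : R * R -> R) (u v : W -> R) w :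
  smooth_at f (u w, v w) -> smooth_at u w -> smooth_at v w ->
  smooth_at (fun w => f (u w, v w)) w.
Proof.
move=> sf su sv.
have E x : 0 + u x *: ((1, 0) : R * R) + v x *: ((0, 1) : R * R) = (u x, v x).
  congr pair; rewrite /= ?add0r ?scaler0 ?addr0 ?add0r /GRing.scale/= ?mulr1//.
have := @smooth_at_comp _ _ W f (fun=> 0) u v (1, 0) (0, 1) w (clinear_cst0 _ _).
by rewrite E => /(_ sf su sv); apply: smooth_at_ext => x; rewrite E.
Qed.

Variables (a b c d e : R) (X : R * R -> R) (Y : R -> R).
Hypotheses (ab : a <= b) (cd : c <= d) (e0 : 0 < e).
Hypothesis sX : forall x y, a - e < x < b + e -> c - e < y < d + e ->
  smooth_at X (x, y) /\ 0 < 'D_(1, 0) X (x, y).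
Hypothesis sY : forall y, c - e < y < d + e -> smooth_at Y y /\ 0 < 'D_1 Y y.
Hypotheses (Xa : forall y, c <= y <= d -> X (a, y) = a)
  (Xb : forall y, c <= y <= d -> X (b, y) = b) (Yc : Y c = c) (Yd : Y d = d).

Let X_incr x1 x2 y : a - e < x1 -> x2 < b + e -> c - e < y < d + e -> x1 < x2 ->
  X (x1, y) < X (x2, y).
Proof.
move=> h1 h2 hy x12.
have bx s : x1 <= s <= x2 -> a - e < s < b + e.
  by move=> /andP[s1 s2]; rewrite (lt_le_trans h1 s1) (le_lt_trans s2 h2).
apply: (@pos_derive_lt _ (fun s => X (s, y)) (fun s => 'D_(1, 0) X (s, y))) => // s /bx hs.
  by apply: slice_is_derive; apply: smooth_at_derivable; exact: (sX hs hy).1.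
exact: (sX hs hy).2.
Qed.

Let Y_incr y1 y2 : c - e < y1 -> y2 < d + e -> y1 < y2 -> Y y1 < Y y2.
Proof.
move=> h1 h2 y12.
have bx s : y1 <= s <= y2 -> c - e < s < d + e.
  by move=> /andP[s1 s2]; rewrite (lt_le_trans h1 s1) (le_lt_trans s2 h2).
apply: (@pos_derive_lt _ Y (fun s => 'D_1 Y s)) => // s /bx hs; last exact: (sY hs).2.
by split => //; apply: smooth_at_derivable; exact: (sY hs).1.
Qed.

Let X_inj x1 x2 y : a - e < x1 < b + e -> a - e < x2 < b + e -> c - e < y < d + e ->
  X (x1, y) = X (x2, y) -> x1 = x2.
Proof.
move=> /andP[h1 h1'] /andP[h2 h2'] hy E; case: (ltgtP x1 x2) => // h.
  by have := X_incr h1 h2' hy h; rewrite E ltxx.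
by have := X_incr h2 h1' hy h; rewrite E ltxx.
Qed.

Let Y_inj y1 y2 : c - e < y1 < d + e -> c - e < y2 < d + e -> Y y1 = Y y2 -> y1 = y2.
Proof.
move=> /andP[h1 h1'] /andP[h2 h2'] E; case: (ltgtP y1 y2) => // h.
  by have := Y_incr h1 h2' h; rewrite E ltxx.
by have := Y_incr h2 h1' h; rewrite E ltxx.
Qed.

(** The map is triangular and increasing in each variable, and fixes the sides, so the intermediate
    value theorem makes it onto. The inverse recovers [y] first, then [x] on that level. *)
Lemma planar_diffeo :
  diffeo_on (`[a, b]%classic `*` `[c, d]%classic) (fun p => (X p, Y p.2)).
Proof.
set K := _ `*` _.
have KE x y : K (x, y) <-> a <= x <= b /\ c <= y <= d.
  by rewrite /K /setX /= !in_itv/=.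
have wx x : a <= x <= b -> a - e < x < b + e.
  by move=> /andP[h1 h2]; rewrite (le_lt_trans h2) ?ltrDl// (lt_le_trans _ h1)// ltrBlDr ltrDl.
have wy y : c <= y <= d -> c - e < y < d + e.
  by move=> /andP[h1 h2]; rewrite (le_lt_trans h2) ?ltrDl// (lt_le_trans _ h1)// ltrBlDr ltrDl.
have XK x y : a <= x <= b -> c <= y <= d -> a <= X (x, y) <= b.
  move=> hx hy; have hy' := wy _ hy; have /andP[x1 x2] := wx _ hx.
  have /andP[a1 _] : a - e < a < b + e by apply: wx; rewrite lexx.
  have /andP[_ b2] : a - e < b < b + e by apply: wx; rewrite ab lexx.
  have /andP[hax hxb] := hx; rewrite -{1}(Xa hy) -{1}(Xb hy).
  apply/andP; split; last first.
    by move: hxb; rewrite le_eqVlt => /predU1P[->//|h]; exact/ltW/X_incr.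
  by move: hax; rewrite le_eqVlt => /predU1P[<-//|h]; exact/ltW/X_incr.
have YK y : c <= y <= d -> c <= Y y <= d.
  move=> hy; have /andP[y1 y2] := wy _ hy.
  have /andP[c1 _] : c - e < c < d + e by apply: wy; rewrite lexx.
  have /andP[_ d2] : c - e < d < d + e by apply: wy; rewrite cd lexx.
  have /andP[hcy hyd] := hy; rewrite -{1}Yc -{1}Yd.
  apply/andP; split; last first.
    by move: hyd; rewrite le_eqVlt => /predU1P[->//|h]; exact/ltW/Y_incr.
  by move: hcy; rewrite le_eqVlt => /predU1P[<-//|h]; exact/ltW/Y_incr.
have Xsurj u y : a <= u <= b -> c <= y <= d -> exists2 x, a <= x <= b & X (x, y) = u.
  move=> hu hy; apply: (@ivt_zero _ (fun s => X (s, y))) => //; last by rewrite Xa ?Xb.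
  move=> s hs; have [sXs _] := sX (wx _ hs) (wy _ hy).
  exact: (smooth_at_continuous (smooth_at_slice sXs)).
have Ysurj v : c <= v <= d -> exists2 y, c <= y <= d & Y y = v.
  move=> hv; apply: ivt_zero => //; last by rewrite Yc Yd.
  by move=> s hs; have [sYs _] := sY (wy _ hs); exact: smooth_at_continuous.
(* Preimages are sought in the box enlarged by [e], so that the inverse is a left inverse on a full
   neighbourhood of boundary points too. *)
pose Xi (w : R * R) := xget 0 [set x | a - e < x < b + e /\ X (x, w.2) = w.1].
pose Yi (v : R) := xget 0 [set y | c - e < y < d + e /\ Y y = v].
have XiX x y : a - e < x < b + e -> c - e < y < d + e -> Xi (X (x, y), y) = x.
  move=> hx hy; rewrite /Xi; case: xgetP => [x' _ /= [hx' E]|h]; first exact: X_inj E.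
  by have := h x; case; split.
have YiY y : c - e < y < d + e -> Yi (Y y) = y.
  move=> hy; rewrite /Yi; case: xgetP => [y' _ /= [hy' E]|h]; first exact: Y_inj E.
  by have := h y; case; split.
have nball (s t x0 x : R) : s <= x0 <= t -> ball x0 e x -> s - e < x < t + e.
  move=> /andP[h1 h2]; rewrite -ball_normE/= ltr_distlC => /andP[h3 h4].
  apply/andP; split; first by apply: le_lt_trans h3; rewrite lerD2r.
  by apply: (lt_le_trans h4); rewrite lerD2r.
have sYi v : c <= v <= d -> smooth_at Yi v.
  move=> hv; have [y hy <-] := Ysurj v hv.
  have [sYy dYy] := sY (wy _ hy).
  (* A dummy second variable reduces the one-variable inverse to [smooth_at_left_inverse]. *)
  have sY1 : smooth_at (fun z : R * R => Y z.1) (y, 0).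
    exact: (smooth_at_comp_clinear (A := fst) (clinear_fst (clinear_id (R * R)%type))).
  have := @smooth_at_left_inverse R (fun z => Y z.1) (fun z => Yi z.1) y e 0 e0 sY1.
  have E (h : R) : (h *: ((1, 0) : R * R) + (y, 0)).1 = h *: 1 + (y, (0 : R)).1 by [].
  have [_] := @derive_affine _ _ _ _ Y fst (y, (0 : R)) (1, 0) 1 E; rewrite /comp => ->.
  rewrite lt0r_neq0//= => /(_ isT) h.
  apply: (smooth_at_slice (f := fun z : R * R => Yi z.1) (w := 0)); apply: h.
  by move=> y' _ hy' _; apply: YiY; exact: nball hy'.
have sXi u y : a <= u <= b -> c <= y <= d -> smooth_at Xi (u, y).
  move=> hu hy; have [x hx <-] := Xsurj _ _ hu hy.
  have [sXx dXx] := sX (wx _ hx) (wy _ hy).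
  apply: (smooth_at_left_inverse e0 sXx); first exact: lt0r_neq0.
  by move=> x' y' hx' hy'; apply: XiX; [exact: nball hx'|exact: nball hy'].
have id2 := clinear_id (R * R)%type.
have sfst (p : R * R) : smooth_at (fun p : R * R => p.1) p by exact/smooth_at_clinear/clinear_fst.
split.
- apply: (smooth_on_smooth_at (F := fun p => (X p, Y p.2))) => // -[x y] /KE[hx hy].
  apply: smooth_at_pair; first exact: (sX (wx _ hx) (wy _ hy)).1.
  apply: (smooth_at_comp_clinear (A := snd) (clinear_snd id2)).
  exact: (sY (wy _ hy)).1.
- split.
  + by move=> [x y] /KE[hx hy]; apply/KE; split; [exact: XK|exact: YK].
  + move=> [x y] [x' y'] /set_mem/KE[hx hy] /set_mem/KE[hx' hy'] [].
    move=> EX /Y_inj EY; have {}EY : y = y' by apply: EY; exact: wy.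
    rewrite -EY in EX *; congr pair; apply: X_inj EX; exact: wx || exact: wy.
  + move=> [u v] /KE[hu hv]; have [y hy Ey] := Ysurj _ hv.
    have [x hx Ex] := Xsurj _ _ hu hy.
    by exists (x, y); [exact/KE|rewrite /= Ex Ey].
- exists (fun w => (Xi (w.1, Yi w.2), Yi w.2)); split.
    apply: (smooth_on_smooth_at (F := fun w => (Xi (w.1, Yi w.2), Yi w.2))) => // -[u v] /KE[hu hv].
    have s2 : smooth_at (fun w : R * R => Yi w.2) (u, v).
      by apply: (smooth_at_comp_clinear (A := snd) (clinear_snd id2)); exact: sYi.
    apply: smooth_at_pair => //.
    apply: smooth_at_comp_plane => //=; apply: sXi => //.
    by have [y hy <-] := Ysurj _ hv; rewrite YiY//; exact: wy.
  move=> [x y] /set_mem/KE[hx hy] /=.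
  by rewrite YiY ?XiX//; [exact: wx|exact: wy|exact: wy].
Qed.

End PlanarDiffeo.

(** * The equivalence *)

Section GlobalEquivalence.
Context {R : realType} (P : normedModType R).
Variables (F : R * R * P -> R) (a b c d : R).

Let K : set (R * R) := `[a, b]%classic `*` `[c, d]%classic.
Let Fx : R * R * P -> R := 'D_((1, 0), 0) F.
Let Fxx : R * R * P -> R := 'D_((1, 0), 0) Fx.
Let Fy : R * R * P -> R := 'D_((0, 1), 0) F.
Let fold (p : R * R) : Prop := [/\ K p, F (p, 0) = 0 & Fx (p, 0) = 0].

Hypotheses (ab : a <= b) (cd : c <= d).
Hypothesis sF : forall p, K p -> smooth_at F (p, 0).
Hypothesis edge : forall p, K p -> p.1 = a \/ p.1 = b -> F (p, 0) != 0.
Hypothesis fold_nondeg : forall p, fold p ->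
  [/\ c < p.2 < d, Fy (p, 0) != 0 & Fxx (p, 0) != 0].
Hypothesis fold_single : forall p p', fold p -> fold p' -> p.2 = p'.2 -> p = p'.

(** Translates between the enlarged intervals of [planar_diffeo] and the balls of [compact_tube]. *)
Let clamp (s t r x : R) : 0 < r -> s <= t -> s - r < x < t + r ->
  exists2 x0, s <= x0 <= t & ball x0 r x.
Proof.
move=> r0 st /andP[h1 h2].
have [xs|sx] := leP x s.
  exists s; first by rewrite lexx.
  by rewrite -ball_normE/= ltr_distlC h1 (le_lt_trans xs)// ltrDl.
have [xt|tx] := leP x t.
  by exists x; [rewrite ltW|exact: ballxx].
exists t; first by rewrite lexx st.
by rewrite -ball_normE/= ltr_distlC h2 andbT (lt_trans _ tx)// ltrBlDr ltrDl.
Qed.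

(** The unperturbed function is expressed through the perturbed one; [persistent] asks for this very
    direction, so the equivalence is never inverted. *)
Lemma equiv_near : \forall l \near (0 : P),
  exists (X : R * R -> R) (Y : R -> R) (S : R * R -> R),
  [/\ smooth_on K S, forall p, K p -> 0 < S p,
      forall x y, K (x, y) -> F ((x, y), 0) = S (x, y) * F ((X (x, y), Y y), l) &
      diffeo_on K (fun p => (X p, Y p.2))].
Proof.
have [Y [sY Y0 Yedge Yfold]] := slow_map sF fold_nondeg fold_single.
have [X [S XS]] := fast_map sF edge fold_nondeg sY Y0 Yfold.
have KE x y : K (x, y) <-> a <= x <= b /\ c <= y <= d.
  by rewrite /K /setX /= !in_itv/=.
have cK : compact K by apply: compact_setX; exact: segment_compact.
have id1 := clinear_id (R * R * P)%type.
have clq : clinear (fun z : R * R * P => (z.1.2, z.2)).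
  by apply: clinear_pair; [exact/clinear_snd/clinear_fst|exact: clinear_snd].
pose good (z : R * R * P) := [/\ smooth_at X z, smooth_at S z, smooth_at Y (z.1.2, z.2),
  0 < S z /\ F (z.1, 0) = S z * F ((X z, Y (z.1.2, z.2)), z.2) &
  0 < 'D_((1, 0), 0) X z /\ 0 < 'D_(1, 0) Y (z.1.2, z.2)].
have [r r0 hr] : exists2 r, 0 < r & forall p, K p -> forall p' l,
    ball p r p' -> ball 0 r l -> good (p', l).
  apply: (compact_tube (good := good) cK) => p Kp.
  have [sX sS nS Xp _] := XS p Kp.
  have nY (Q : R * P -> Prop) : (\forall q \near (p.2, (0 : P)), Q q) ->
      \forall z \near (p, (0 : P)), Q (z.1.2, z.2).
    move=> h; have cq : {for (p, 0), continuous (fun z : R * R * P => (z.1.2, z.2))}.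
      exact: clinear_continuous.
    exact: (near_comp cq h).
  (* At [l = 0] both maps are the identity, [X] near [p] and [Y] everywhere, so their derivatives
     are 1 and stay positive nearby. *)
  have DX : 'D_((1, 0), 0) X (p, 0) = 1.
    have E (h : R) : (h *: ((1, 0) : R * R) + p, 0 : P) = h *: ((1, 0), 0) + (p, 0).
      by congr pair; rewrite /= ?scaler0 ?addr0.
    have [_ <-] := @derive_affine _ _ _ _ X (fun p => (p, 0)) p (1, 0) ((1, 0), 0) E.
    rewrite (near_eq_derive (g := fun p => p.1)) //.
    have [lA cA] := clinear_fst (clinear_id (R * R)%type).
    by rewrite (linear_derive _ _ lA cA).
  have DY : 'D_(1, 0) Y (p.2, 0) = 1.
    have E (h : R) : (h *: (1 : R) + p.2, 0 : P) = h *: (1, 0) + (p.2, 0).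
      by congr pair; rewrite /= ?scaler0 ?addr0.
    have [_ <-] := @derive_affine _ _ _ _ Y (fun y => (y, 0)) p.2 1 (1, 0) E.
    have -> : Y \o (fun y => (y, 0)) = id by apply/funext => y; exact: Y0.
    by rewrite derive_id.
  have sDX := smooth_at_derive (((1, 0), 0) : R * R * P) sX.
  have sDY := smooth_at_derive ((1, 0) : R * P) (sY p.2).
  have nX : \forall z \near (p, (0 : P)), 0 < 'D_((1, 0), 0) X z.
    by apply: (smooth_at_near_open sDX (@open_gt _ (0 : R))); rewrite /= DX.
  have nDY : \forall q \near (p.2, (0 : P)), 0 < 'D_(1, 0) Y q.
    by apply: (smooth_at_near_open sDY (@open_gt _ (0 : R))); rewrite /= DY.
  have := near_and (near_and (smooth_at_near sX) (smooth_at_near sS))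
    (near_and (nY _ (smooth_at_near (sY p.2))) (near_and nS (near_and nX (nY _ nDY)))).
  by apply: filterS => z [[h1 h2] [h3 [h4 [h5 h6]]]]; split.
have edgeX s : s = a \/ s = b -> exists2 r, 0 < r & forall y l, c <= y <= d ->
    ball 0 r l -> X ((s, y), l) = s.
  (* A vertical side is a product with the degenerate segment from [s] to [s], so [compact_tube]
     applies to it as well. *)
  move=> sab; have cKs : compact (`[s, s]%classic `*` `[c, d]%classic).
    by apply: compact_setX; exact: segment_compact.
  have KsE x y : (`[s, s]%classic `*` `[c, d]%classic) (x, y) <-> x = s /\ c <= y <= d.
    rewrite /setX /= !in_itv/= -eq_le; split; first by move=> [/eqP -> ->].
    by move=> [-> ->].
  have [|r1 r10 h] := compact_tube (P := P) (good := fun z => X z = z.1.1) cKs.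
    move=> [x y] /KsE[-> hy].
    have Ks : K (s, y).
      by apply/KE; split => //; case: sab => ->; rewrite lexx ab.
    by have [_ _ _ _ /(_ sab)] := XS _ Ks.
  exists r1 => // y l hy hl; apply: (h (s, y)) => //; last exact: ballxx.
  exact/KsE.
have edgeY s : s = c \/ s = d -> exists2 r, 0 < r & forall l, ball 0 r l -> Y (s, l) = s.
  move=> /Yedge /near_pair_box[r1 r10 h]; exists r1 => // l hl; apply: h => //.
  exact: ballxx.
have [ra ra0 ha] := edgeX a (or_introl erefl).
have [rb rb0 hb] := edgeX b (or_intror erefl).
have [rc rc0 hc] := edgeY c (or_introl erefl).
have [rd rd0 hd] := edgeY d (or_intror erefl).
have nb e : 0 < e -> \forall l \near (0 : P), ball 0 e l by exact: nbhsx_ballx.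
have := near_and (near_and (nb _ r0) (near_and (nb _ ra0) (nb _ rb0)))
  (near_and (nb _ rc0) (nb _ rd0)).
apply: filterS => l [[lr [la lb]] [lc ld]].
have goodK p : K p -> good (p, l) by move=> Kp; apply: (hr p) => //; exact: ballxx.
exists (fun p => X (p, l)), (fun y => Y (y, l)), (fun p => S (p, l)); split.
- apply: (smooth_on_smooth_at (F := fun p => S (p, l))) => // p /goodK[_ sS _ _ _].
  exact: smooth_at_slice.
- by move=> p /goodK[_ _ _ []].
- by move=> x y /goodK[_ _ _ []].
apply: (@planar_diffeo R a b c d r (fun p => X (p, l)) (fun y => Y (y, l)) ab cd r0).
- move=> x y hx hy.
  have [x0 hx0 bx] := clamp r0 ab hx; have [y0 hy0 by_] := clamp r0 cd hy.
  have K0 : K (x0, y0) by exact/KE.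
  have [sX _ _ _ [dX _]] : good ((x, y), l) by apply: (hr _ K0).
  split; first exact: smooth_at_slice.
  have E (h : R) : (h *: ((1, 0) : R * R) + (x, y), l) = h *: ((1, 0), 0) + ((x, y), l).
    by congr pair; rewrite /= ?scaler0 ?add0r.
  by have [_] := @derive_affine _ _ _ _ X (fun p => (p, l)) (x, y) (1, 0) ((1, 0), 0) E;
    rewrite /comp => ->.
- move=> y hy; have [y0 hy0 by_] := clamp r0 cd hy.
  have K0 : K (a, y0) by apply/KE; rewrite lexx ab.
  have [_ _ sYy _ [_ dY]] : good ((a, y), l).
    by apply: (hr _ K0) => //; split => //; exact: ballxx.
  split; first exact: smooth_at_slice.
  have E (h : R) : (h *: (1 : R) + y, l) = h *: (1, 0) + (y, l).
    by congr pair; rewrite /= ?scaler0 ?add0r.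
  by have [_] := @derive_affine _ _ _ _ Y (fun y => (y, l)) y 1 (1, 0) E;
    rewrite /comp => ->.
- by move=> y hy; exact: ha.
- by move=> y hy; exact: hb.
- exact: hc.
- exact: hd.
Qed.

End GlobalEquivalence.

(** * Compact intervals and the theorem *)

Section CompactIntervals.
Context {R : realType}.
Implicit Types (M : set R).

(** The end points are the extreme values of the identity on [M]; the interior point keeps them
    apart. *)
Lemma compact_interval M : compact M -> is_interval M -> M° !=set0 ->
  exists a b, a < b /\ M = `[a, b]%classic.
Proof.
move=> cM iM [x0 Mx0].
have M0 : M !=set0 by exists x0; exact: interior_subset Mx0.
have cid : {within M, continuous (@id R)}.
  by apply: continuous_subspaceT => x; exact: cvg_id.
have [a /set_mem Ma ha] := compact_EVT_min M0 cM cid.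
have [b /set_mem Mb hb] := compact_EVT_max M0 cM cid.
exists a, b; split; last first.
  apply/seteqP; split => x /=; rewrite in_itv/=.
    by move=> Mx; rewrite ha ?hb ?inE.
  by move=> axb; exact: iM axb.
have /nbhs_ballP[e /= e0 hM] := Mx0.
have M1 : M (x0 + e / 2).
  apply: hM; rewrite -ball_normE/= opprD addrA subrr add0r normrN.
  by rewrite gtr0_norm ?divr_gt0// ltr_pdivrMr// ltr_pMr// ltr1n.
have h1 := ha _ (mem_set (interior_subset Mx0)); have h2 := hb _ (mem_set M1).
by apply: (le_lt_trans h1); apply: lt_le_trans h2; rewrite ltrDl divr_gt0.
Qed.

Lemma boundary_itv (a b : R) : a < b ->
  boundary `[a, b]%classic a /\ boundary `[a, b]%classic b.
Proof.
move=> ab; split; split; try by apply: subset_closure; rewrite /= in_itv/= lexx ltW.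
- move=> /nbhs_ballP[e /= e0 h]; have := h (a - e / 2).
  rewrite -ball_normE/= opprB addrC subrK gtr0_norm ?divr_gt0//.
  rewrite ltr_pdivrMr// ltr_pMr// ltr1n => /(_ isT); rewrite in_itv/= => /andP[+ _].
  by rewrite leNgt ltrBlDr ltrDl divr_gt0.
- move=> /nbhs_ballP[e /= e0 h]; have := h (b + e / 2).
  rewrite -ball_normE/= opprD addrA subrr add0r normrN gtr0_norm ?divr_gt0//.
  rewrite ltr_pdivrMr// ltr_pMr// ltr1n => /(_ isT); rewrite in_itv/= => /andP[_].
  by rewrite leNgt ltrDl divr_gt0.
Qed.

Lemma card_ge2 (T : Type) (S : set T) (p q : T) : S p -> S q -> p <> q ->
  (`I_2 #<= S)%card.
Proof.
move=> Sp Sq pq; apply: (card_le_trans _ (subset_card_le (A := [set p; q]) _)); last first.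
  by move=> x [->|->].
suff fs : set_surj [set p; q] `I_2 (fun x => if `[< x = p >] then 0%N else 1%N).
  exact: (surj_card_ge (surjection_of_surj fs)).
case=> [|[|//]] _; first by exists p; [left|rewrite asboolT].
by exists q; [right|rewrite asboolF// => qp; apply: pq].
Qed.

End CompactIntervals.

Theorem proposition1 (R : realType) (M N : set R) (m : R -> R)
    (g : R * R -> R)
    (M_compact : compact M) (M_itv : is_interval M) (M_int : interior M !=set0)
    (N_compact : compact N) (N_itv : is_interval N) (N_int : interior N !=set0)
    (m_normal : forall x, boundary M x -> outward_normal M x (m x))
    (g_Vf : g \in Vf M N m)
    (g_nondeg : degenerate_folds M N g = set0) :
  persistent M N g.
Proof.
move=> r G /smooth_on_ext[F [sF GF]] Gg.
have [a [b [ab ME]]] := compact_interval M_compact M_itv M_int.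
have [c [d [cd NE]]] := compact_interval N_compact N_itv N_int.
have [ba bb] := boundary_itv ab; have [bc bd] := boundary_itv cd.
move: g_Vf => /set_mem[_ gedge gfold].
rewrite {M_compact M_itv M_int N_compact N_itv N_int m_normal}ME NE
  in sF GF Gg gedge gfold g_nondeg *.
set M' := `[a, b]%classic in sF GF Gg gedge gfold g_nondeg ba bb *.
set N' := `[c, d]%classic in sF GF Gg gedge gfold g_nondeg bc bd *.
have KE x y : (M' `*` N') (x, y) <-> a <= x <= b /\ c <= y <= d.
  by rewrite /M' /N' /setX /= !in_itv/=.
have gF p : (M' `*` N') p -> g p = F (p, 0).
  by move=> Kp; rewrite -Gg// GF.
have edge p : (M' `*` N') p -> p.1 = a \/ p.1 = b -> F (p, 0) != 0.
  case: p => x y Kp /= xab; rewrite -gF//; apply/eqP => g0.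
  have [_ hy] := Kp.
  have /(gedge x y) : (boundary M' `*` N') (x, y) by split => //; case: xab => ->.
  by rewrite g0 mul0r ltxx.
have inner p : (M' `*` N') p -> F (p, 0) = 0 -> a < p.1 < b.
  case: p => x y Kp F0; have [/andP[ax xb] _] := (KE _ _).1 Kp.
  rewrite /= !lt_neqAle ax xb !andbT; apply/andP; split; apply/eqP => E.
    by have := edge _ Kp (or_introl (esym E)); rewrite F0 eqxx.
  by have := edge _ Kp (or_intror E); rewrite F0 eqxx.
have affx (l : 'rV[R]_r) (p : R * R) (h : R) :
    (h *: ((1, 0) : R * R) + p, l) = h *: ((1, 0), 0) + (p, l).
  by congr pair; rewrite /= ?scaler0 ?add0r.
have affy (l : 'rV[R]_r) (p : R * R) (h : R) :
    (h *: ((0, 1) : R * R) + p, l) = h *: ((0, 1), 0) + (p, l).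
  by congr pair; rewrite /= ?scaler0 ?add0r.
have DxE (H : R * R * 'rV[R]_r -> R) p :
    'D_(1, 0) (fun p => H (p, 0)) p = 'D_((1, 0), 0) H (p, 0).
  by have [_] := @derive_affine _ _ _ _ H (fun p => (p, 0)) p _ _ (affx 0 p).
have DyE (H : R * R * 'rV[R]_r -> R) p :
    'D_(0, 1) (fun p => H (p, 0)) p = 'D_((0, 1), 0) H (p, 0).
  by have [_] := @derive_affine _ _ _ _ H (fun p => (p, 0)) p _ _ (affy 0 p).
(* With [x] interior to [M], the horizontal segment around the point stays in the rectangle even
   when [y] is an end point of [N]; this case serves to exclude folds there. *)
have gx p : (M' `*` N') p -> a < p.1 < b -> partial_x g p = 'D_((1, 0), 0) F (p, 0).
  case: p => x y /KE[_ hy] /= /andP[ax xb]; rewrite -DxE.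
  have aff (h : R) : (h *: (1 : R) + x, y) = h *: ((1, 0) : R * R) + (x, y).
    by congr pair; rewrite /= ?scaler0 ?add0r.
  have [_ <-] := @derive_affine _ _ _ _ (fun p => F (p, 0)) (fun s => (s, y)) x 1 (1, 0) aff.
  have [_ E] := @derive_affine _ _ _ _ g (fun s => (s, y)) x 1 (1, 0) aff.
  rewrite /partial_x -E; apply: near_eq_derive.
  have := near_and (lt_nbhsr ax) (lt_nbhsl xb); apply: filterS => s [as_ sb] /=.
  by apply: gF; apply/KE; split => //; rewrite !ltW.
(* The [y]-derivative and the second [x]-derivative are compared on a full neighbourhood, hence at
   points interior in both directions. *)
have nK p : a < p.1 < b -> c < p.2 < d ->
    \forall p' \near p, [/\ (M' `*` N') p', a < p'.1 < b & c < p'.2 < d].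
  move=> /andP[h1 h2] /andP[h3 h4].
  have id2 := clinear_id (R * R)%type.
  have s1 : smooth_at (fun p : R * R => p.1) p by exact/smooth_at_clinear/clinear_fst.
  have s2 : smooth_at (fun p : R * R => p.2) p by exact/smooth_at_clinear/clinear_snd.
  have := near_and (near_and (smooth_at_near_open s1 (@open_gt _ a) h1)
      (smooth_at_near_open s1 (@open_lt _ b) h2))
    (near_and (smooth_at_near_open s2 (@open_gt _ c) h3)
      (smooth_at_near_open s2 (@open_lt _ d) h4)).
  apply: filterS => -[x y] /= [[k1 k2] [k3 k4]]; split; [|by rewrite k1|by rewrite k3].
  by apply/KE; rewrite !ltW.
have foldE p : (M' `*` N') p -> F (p, 0) = 0 -> 'D_((1, 0), 0) F (p, 0) = 0 ->
    fold_set M' N' g p.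
  by move=> Kp F0 Fx0; split; [split => //; rewrite gF|rewrite gx//; exact: inner].
have nondeg p : ~ degenerate_folds M' N' g p by rewrite g_nondeg.
have equiv := @equiv_near R 'rV[R]_r F a b c d (ltW ab) (ltW cd).
have /equiv{equiv} : forall p, (M' `*` N') p -> smooth_at F (p, 0) by move=> p Kp; apply: sF.
move=> /(_ edge) equiv.
apply: (filterS _ (equiv _ _)).
- move=> l [X [Y [S [sS S0 E diff]]]]; exists X, Y, S; split => // x y Kxy.
  rewrite gF// E//; congr (_ * _); rewrite GF//.
  (* [G] and [F] agree only over the rectangle, so the image point must stay in it. *)
  by have [_ [maps _ _] _] := diff; split => //; exact: (maps _ Kxy).
- move=> p [Kp F0 Fx0]; have hx := inner p Kp F0; have fp := foldE p Kp F0 Fx0.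
  (* A fold on a horizontal side would contradict the last condition of [Vf]. *)
  have hy : c < p.2 < d.
    case: p Kp F0 Fx0 hx fp => x y Kp F0 Fx0 hx fp.
    have [hxM /andP[cy yd]] := (KE _ _).1 Kp.
    rewrite /= !lt_neqAle cy yd !andbT; apply/andP; split; apply/eqP => Ey.
      have /(gfold x y) : (M' `*` boundary N') (x, y) by split; [exact: Kp.1|rewrite /= -Ey].
      by rewrite gF// F0 => /(_ erefl); rewrite gx// Fx0 eqxx.
    have /(gfold x y) : (M' `*` boundary N') (x, y) by split; [exact: Kp.1|rewrite /= Ey].
    by rewrite gF// F0 => /(_ erefl); rewrite gx// Fx0 eqxx.
  have near_p := nK p hx hy.
  split => //; apply/negP => /eqP E0; apply: (nondeg p).
    left; left; split; first exact: fp.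
    rewrite -E0 -(DyE F); apply: near_eq_derive.
    by apply: filterS near_p => p' [Kp' _ _]; exact: gF.
  left; right; split; first exact: fp.
  rewrite -E0 -(DxE ('D_((1, 0), 0) F)); apply: near_eq_derive.
  by apply: filterS near_p => p' [Kp' hx' _]; exact: gx.
- move=> p p' [Kp F0 Fx0] [Kp' F0' Fx0'] E; apply: contrapT => pp'.
  apply: (nondeg p); right; split; first exact: foldE.
  apply: (@card_ge2 _ _ p p') => //; split => //; exact: foldE.
Qed.
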